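(* Let $d\in\mathbb{N}$, $2<p<\infty$, $0<r_0<1/2$ and $r_1=r_0+1/2$. If $\theta=2/p$ and $r=r_0+1/p$, then $$ \big(\mathbf{B}^{r_0}_{\infty,\infty}(\mathbb{T}^d),\mathbf{W}^{r_1}_2(\mathbb{T}^d)\big)_{\theta,p}=\mathbf{B}^r_{p,p}(\mathbb{T}^d) $$ in the sense of equivalent norms, where $(\cdot,\cdot)_{\theta,p}$ denotes the real interpolation method.
   Context: $\mathbb{T}^d$ is the $d$-dimensional torus represented by $[0,2\pi]^d$; functions are complex-valued and $2\pi$-periodic in each variable; convolution is $f*g(\mathbf{x})=(2\pi)^{-d}\int_{\mathbb{T}^d}f(\mathbf{x}-\mathbf{y})g(\mathbf{y})\,d\mathbf{y}$. De la Vallée Poussin blocks: $\mathcal{V}_m(t):=\frac1m\sum_{k=m}^{2m-1}\mathcal{D}_k(t)$ with the Dirichlet kernel $\mathcal{D}_k(t)=\sum_{|j|\le k}e^{ijt}$; $\mathcal{A}_0:=\mathcal{V}_1$, $\mathcal{A}_s:=\mathcal{V}_{2^s}-\mathcal{V}_{2^{s-1}}$ for $s\ge1$; $\mathcal{A}_{\mathbf{s}}(\mathbf{x}):=\prod_{i=1}^d\mathcal{A}_{s_i}(x_i)$ for $\mathbf{s}\in\mathbb{N}_0^d$; $A_{\mathbf{s}}(f,\cdot):=f*\mathcal{A}_{\mathbf{s}}$. Besov space of mixed smoothness: for $r>0$, $1\le p,q\le\infty$, $\mathbf{B}^r_{p,q}(\mathbb{T}^d)$ is the space of all $f\in L_p(\mathbb{T}^d)$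 with $\|f\|_{\mathbf{B}^r_{p,q}}:=\big(\sum_{\mathbf{s}\in\mathbb{N}_0^d}2^{r\|\mathbf{s}\|_1q}\|A_{\mathbf{s}}(f,\cdot)\|_p^q\big)^{1/q}<\infty$ (supremum over $\mathbf{s}$ if $q=\infty$), $\|\mathbf{s}\|_1=s_1+\dots+s_d$. Sobolev space of mixed smoothness: for $r>0$ let $F_r(x):=1+2\sum_{k=1}^\infty k^{-r}\cos(kx)$ and $F_r(\mathbf{x}):=\prod_{j=1}^dF_r(x_j)$; $\mathbf{W}^r_2(\mathbb{T}^d)$ is the space of all $f=F_r*\varphi$ with $\varphi\in L_2(\mathbb{T}^d)$, normed by $\|f\|_{\mathbf{W}^r_2}:=\|\varphi\|_2$ (equivalently $\hat f(\mathbf{k})=\prod_j\max(1,|k_j|)^{-r}\hat\varphi(\mathbf{k})$). Real interpolation: for a compatible couple of Banach spaces $(A_0,A_1)$, $K(t,a;A_0,A_1):=\inf_{a=a_0+a_1}(\|a_0\|_{A_0}+t\|a_1\|_{A_1})$, and $(A_0,A_1)_{\theta,p}$ is the space of $a\in A_0+A_1$ with $\big(\int_0^\infty(t^{-\theta}K(t,a;A_0,A_1))^p\frac{dt}{t}\big)^{1/p}<\infty$, this expression being the norm. *)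

(* Defs.v *)
From HB Require Import structures.
From mathcomp Require Import all_boot all_order all_algebra.
From mathcomp Require Import all_classical all_reals all_analysis.
From mathcomp Require Import complex.
Set Implicit Arguments.
Unset Strict Implicit.
Unset Printing Implicit Defensive.
Import Order.TTheory GRing.Theory Num.Theory numFieldNormedType.Exports.
Local Open Scope classical_set_scope.
Local Open Scope ring_scope.
Local Open Scope complex_scope.

(* A normed space, given by its carrier and its norm inside an ambient abelian
   group; only the values of [nnorm] on [carrier] matter. *)
Record nspace (R : realType) (V : zmodType) := NSpace {
  carrier : set V ;
  nnorm : V -> \bar R }.

Definition same_space_equiv_norms (R : realType) (V : zmodType)
    (X Y : nspace R V) : Prop :=
  carrier X = carrier Y /\
  exists c C : R, [/\ 0 < c, 0 < C & forall f, carrier X f ->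
    (c%:E * nnorm X f <= nnorm Y f)%E /\ (nnorm Y f <= C%:E * nnorm X f)%E].

Section interpolation.
Context (R : realType) (V : zmodType) (A0 A1 : nspace R V).

Definition sum_carrier : set V :=
  [set a | exists a0 a1, [/\ carrier A0 a0, carrier A1 a1 & a = a0 + a1]].

Definition K_functional (t : R) (a : V) : \bar R :=
  ereal_inf [set y | exists a0 a1, [/\ carrier A0 a0, carrier A1 a1,
    a = a0 + a1 & y = (nnorm A0 a0 + t%:E * nnorm A1 a1)%E]].

Definition interpolation_norm (theta p : R) (a : V) : \bar R :=
  ((\int[lebesgue_measure]_(t in `]0%R, +oo[)
     (((t `^ (- theta))%:E * K_functional t a) `^ p * (t^-1)%:E)) `^ p^-1)%E.

Definition real_interpolation (theta p : R) : nspace R V := {|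
  carrier := [set a | sum_carrier a /\ (interpolation_norm theta p a < +oo)%E];
  nnorm := interpolation_norm theta p |}.

End interpolation.

Notation point R d := (d.-tuple (measurableTypeR R)).

Section torus_measure.
Variable R : realType.

Lemma twopi_gt0 : 0 < 2 * pi :> R.
Proof. by rewrite mulr_gt0// pi_gt0. Qed.

Definition tcons n (x : measurableTypeR R * point R n) : point R n.+1 :=
  [tuple of x.1 :: x.2].

Lemma measurable_tcons n : measurable_fun setT (@tcons n).
Proof. exact: measurable_cons. Qed.

HB.instance Definition _ n :=
  isMeasurableFun.Build _ _ _ _ (@tcons n) (@measurable_tcons n).

(* The normalised Lebesgue measure [(2 pi)^-d dx] on the cube [[0, 2 pi]^d],
   as a measure on [R^d] carried by that cube; [uniform_prob] is
   [(2 pi)^-1 dx] on [[0, 2 pi]]. *)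
Fixpoint torus_measure (d : nat) : probability (point R d) R :=
  match d with
  | 0 => \d_ [tuple]
  | n.+1 => distribution (uniform_prob twopi_gt0 \x torus_measure n)%E
      [the {mfun (measurableTypeR R * point R n)%type >-> point R n.+1}
       of @tcons n]
  end.

End torus_measure.

Section torus_functions.
Context (R : realType) (d : nat).

Definition point_sub (x y : point R d) : point R d :=
  [tuple (tnth x i : R) - (tnth y i : R) | i < d].

Definition shift_coord (i : 'I_d) (x : point R d) : point R d :=
  [tuple (tnth x j : R) + (if j == i then 2 * pi else 0) | j < d].

(* A (measurable) function on the torus is a measurable [2 pi]-periodic function
   on [R^d].  Functions are not quotiented by a.e. equality; instead the
   carriers of all the spaces below are closed under a.e. equality, so that
   equality of carriers is equality of spaces of classes. *)
Definition torus_fun : set (point R d -> R[i]) :=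
  [set f | [/\ measurable_fun setT (fun x => complex.Re (f x)),
               measurable_fun setT (fun x => complex.Im (f x)) &
               forall i x, f (shift_coord i x) = f x]].

Definition torus_integral (f : point R d -> R[i]) : R[i] :=
  (\int[torus_measure R d]_x complex.Re (f x)) +i*
  (\int[torus_measure R d]_x complex.Im (f x)).

(* No factor [(2 pi)^-d]: it is part of [torus_measure].  The same normalisation
   is used in [torus_norm]. *)
Definition conv (f g : point R d -> R[i]) (x : point R d) : R[i] :=
  torus_integral (fun y => f (point_sub x y) * g y).

Definition torus_norm (p : \bar R) (f : point R d -> R[i]) : \bar R :=
  Lnorm (torus_measure R d) p (fun x => (Normc.normc (f x))%:E).

Definition torus_Lp (p : \bar R) : set (point R d -> R[i]) :=
  [set f | torus_fun f /\ (torus_norm p f < +oo)%E].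

End torus_functions.

Section kernels.
Variable R : realType.

(* [\sum_(|j| <= k) e^(ijt)], reindexed by [j + k] in [0, 2k]. *)
Definition dirichlet_kernel (k : nat) (t : R) : R[i] :=
  \sum_(0 <= l < (2 * k).+1)
    (cos ((l%:R - k%:R) * t) +i* sin ((l%:R - k%:R) * t)).

Definition vallee_poussin (m : nat) (t : R) : R[i] :=
  m%:R^-1 * \sum_(m <= k < 2 * m) dirichlet_kernel k t.

Definition block1 (s : nat) (t : R) : R[i] :=
  if s is s'.+1 then vallee_poussin (2 ^ s) t - vallee_poussin (2 ^ s') t
  else vallee_poussin 1 t.

Definition block d (s : d.-tuple nat) (x : point R d) : R[i] :=
  \prod_(i < d) block1 (tnth s i) (tnth x i).

Definition block_op d (s : d.-tuple nat) (f : point R d -> R[i]) :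
    point R d -> R[i] :=
  conv f (block s).

End kernels.

Definition norm1 d (s : d.-tuple nat) : nat := (\sum_(i < d) tnth s i)%N.

Section function_spaces.
Context (R : realType) (d : nat).

(* The last branch is the case [q = +oo]; [q = -oo] is meaningless. *)
Definition besov_norm (r : R) (p q : \bar R) (f : point R d -> R[i]) : \bar R :=
  if q is q'%:E then
    ((\esum_(s in [set: d.-tuple nat])
       ((2 `^ (r * (norm1 s)%:R * q'))%:E * torus_norm p (block_op s f) `^ q'))
     `^ q'^-1)%E
  else
    ereal_sup [set ((2 `^ (r * (norm1 s)%:R))%:E *
                    torus_norm p (block_op s f))%E | s in [set: d.-tuple nat]].

Definition besov (r : R) (p q : \bar R) : nspace R (point R d -> R[i]) := {|
  carrier := [set f | torus_Lp p f /\ (besov_norm r p q f < +oo)%E];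
  nnorm := besov_norm r p q |}.

(* For [r <= 1] the series diverges on [2 pi Z]; the value of [limn] there is
   irrelevant since this set is null. *)
Definition bernoulli_kernel1 (r x : R) : R :=
  1 + 2 * limn (fun n => \sum_(1 <= k < n) (k%:R `^ (- r)) * cos (k%:R * x)).

Definition bernoulli_kernel (r : R) (x : point R d) : R[i] :=
  (\prod_(j < d) bernoulli_kernel1 r (tnth x j))%:C.

(* [f = F_r * phi] as elements of [L_2]. *)
Definition sobolev_repr (r : R) (f phi : point R d -> R[i]) : Prop :=
  torus_Lp 2%:E phi /\
  {ae torus_measure R d, forall x, f x = conv (bernoulli_kernel r) phi x}.

(* [phi] is determined by [f] up to a.e. equality, so the infimum defining the
   norm ranges over a single value. *)
Definition sobolev2 (r : R) : nspace R (point R d -> R[i]) := {|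
  carrier := [set f | torus_fun f /\ exists phi, sobolev_repr r f phi];
  nnorm := fun f => ereal_inf (torus_norm 2%:E @` sobolev_repr r f) |}.

End function_spaces.

(* Main.v *)
(** Put [g_s = 2^(r0 |s|) A_s(f)]; then [||f||^p] in [B^r_(p,p)] is the sum over [s] of
[2^|s|] times the integral of [|g_s|^p], and the interpolation norm to the power [p] is the
integral of [K(t)^p t^(-3) dt].

If [f = a0 + a1] with [||a0|| <= L] and [t ||a1|| <= L], where [L > K(t)], then [a0] contributes
at most [L] to each [|g_s|], and Bessel's and Chebyshev's inequalities applied to [a1] give
[sum_s 2^|s| mu{|g_s| > 2 L} <= C t^-2].  As [K] at most doubles when [t] doubles, [|g|^p] is
bounded by a multiple of the integral of [K(t)^p 1{4 K(t) < |g|} dt / t], and integrating the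
weak estimate against [K(t)^p dt / t] bounds the Besov norm.

Conversely, cut every block of [f] at the height [|g_s| = l].  Only finitely many blocks
have a part above [l]; multiplied by a smooth multiplier equal to [1] on the spectrum of [A_s],
these parts add up to a trigonometric polynomial [a1] with [||a1||^2 <= C G(l)], where [G(l)] is
the sum over [s] of [2^|s|] times the integral of [|g_s|^2] over [{|g_s| > l}], while
[||f - a1|| <= C l].  Hence [K(t) <= C (l + t G(l)^(1/2))] for all [l], and Tonelli's theorem
bounds the integral of [K(t)^p t^(-3) dt] by that of [G(l) l^(p-3) dl], which is the Besov sum. *)

From HB Require Import structures.
From mathcomp Require Import all_boot all_order all_algebra.
From mathcomp Require Import all_classical all_reals all_analysis measurable_realfun ess_sup_inf.
From mathcomp Require Import complex.
From mathcomp Require Import ring lra zify.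
Require Import Defs.
Set Implicit Arguments.
Unset Strict Implicit.
Unset Printing Implicit Defensive.
Import Order.TTheory GRing.Theory Num.Theory numFieldNormedType.Exports.
Local Open Scope ring_scope.
Local Open Scope classical_set_scope.

(** * Reflection and translation invariance of the torus measure *)

(** The exponents fit because [theta * p = 2], [r * p = r0 * p + 1] and [2 * r1 = 2 * r0 + 1]: the
    Besov weight [2^(r |s| p)] splits off one factor [2^|s|], which is exactly what the extra half
    derivative of the Sobolev space pays for in a squared L_2 norm. The obstacle is that the
    endpoint Besov space asks for membership in L_oo, not only for bounded block norms. For sums in
    the couple this comes from [r1 > 1/2], which puts the Bernoulli kernel in L_2. For a function of
    the target Besov space it takes a Nikolskii-type bound on the blocks together with the fact that
    Fourier coefficients determine a function a.e.; that uniqueness is proved by approximating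
    half-spaces with trigonometric polynomials. Cutting a block pointwise destroys its frequency
    localisation; the multiplier restores it, so that only neighbouring scales interact. The L_1
    bounds of the kernels, uniform in the scale, come from nonnegative Fejer majorants. *)

Section circle.
Variable R : realType.
Local Notation leb := (@lebesgue_measure R).
Implicit Types F : measurableTypeR R -> \bar R.

Lemma ge0_integral_itv_reflect F (c a b : R) :
  measurable_fun setT F -> (forall x, (0 <= F x)%E) ->
  (\int[leb]_(y in `[a, b]) F (c - y)%R = \int[leb]_(y in `[(c - b)%R, (c - a)%R]) F y)%E.
Proof.
move=> mF F0.
pose phi (y : measurableTypeR R) : measurableTypeR R := c - y.
have mphi : measurable_fun setT phi by exact: measurable_funB.
(* Lebesgue measure is determined by its values on half-open intervals, and the preimage [[c - v, c
   - u[] of []u, v]] has the same length. *)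
have inv A : measurable A -> leb A = pushforward leb phi A.
  pose phi' := HB.pack_for {mfun measurableTypeR R >-> measurableTypeR R} phi
    (isMeasurableFun.Build _ _ _ _ phi mphi).
  move: A; apply: (@lebesgue_measure_unique _ (pushforward leb phi')) => _ [[u v]] _ <-.
  transitivity (leb `[c - v, c - u[%classic).
    rewrite /= !lebesgue_measure_itv/= !lte_fin ltrD2l ltrN2; case: ifP => // _.
    by rewrite -!EFinB; congr EFin; ring.
  rewrite /pushforward; congr (leb _); apply/seteqP.
  by split=> y; rewrite /= !in_itv /= /phi => /andP[*]; apply/andP; split; lra.
rewrite [RHS](@eq_measure_integral _ _ _ _ (pushforward leb phi)); last first.
  by move=> A mA _; exact: inv.
rewrite ge0_integral_pushforward //; last exact: measurable_funS mF.
congr (integral _ _ _); apply/seteqP; split=> y; rewrite /phi /= !in_itv /= => /andP[] *; apply/andP; split; lra.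
Qed.

(** A translation is the composition of two reflections. *)
Lemma ge0_integral_itv_translate F (c a b : R) :
  measurable_fun setT F -> (forall x, (0 <= F x)%E) ->
  (\int[leb]_(y in `[a, b]) F (y + c)%R = \int[leb]_(y in `[(a + c)%R, (b + c)%R]) F y)%E.
Proof.
move=> mF F0.
have mN (e : R) : measurable_fun setT (fun y : measurableTypeR R => e - y : measurableTypeR R).
  exact: measurable_funB.
transitivity (\int[leb]_(y in `[a, b]) F (0 - (- c - y))%R)%E.
  by apply: eq_integral => y _; congr F; ring.
rewrite (@ge0_integral_itv_reflect (fun y => F (0 - y)))//; last by apply: (measurableT_comp mF); exact: mN.
rewrite ge0_integral_itv_reflect//.
have e1 (u : R) : 0 - (- c - u) = u + c by ring.
by rewrite !e1.
Qed.

(** Cut at [2 * pi]: the piece beyond it is the translate by one period of the missing piece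
    [[0, a]]. *)
Lemma ge0_integral_period_lt F (a : R) :
  measurable_fun setT F -> (forall x, (0 <= F x)%E) -> (forall x, F (x + 2 * pi) = F x) ->
  0 <= a < 2 * pi ->
  (\int[leb]_(y in `[a, (a + 2 * pi)%R]) F y = \int[leb]_(y in `[0%R, (2 * pi)%R]) F y)%E.
Proof.
move=> mF F0 Fper /andP[a0 a2].
have split2 (u v w : R) : u <= v -> v <= w ->
    (\int[leb]_(y in `[u, w]) F y =
     \int[leb]_(y in `[u, v]) F y + \int[leb]_(y in `[v, w]) F y)%E.
  move=> uv vw.
  rewrite -[X in (X + _)%E]integral_itv_bndo_bndc; last exact: measurable_funS mF.
  rewrite -ge0_integral_setU//=; last 2 first.
  - exact: measurable_funS mF.
  - apply/disj_setPS => y [] /=; rewrite !in_itv /= => /andP[_ yv] /andP[vy _]; lra.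
  congr (integral _ _ _); apply/seteqP; split=> y /=; rewrite !in_itv /=.
    by move=> /andP[uy yw]; case: (ltrP y v) => yv; [left|right]; apply/andP; split.
  by case=> /andP[] *; apply/andP; split; lra.
rewrite (split2 a (2 * pi)) ?(split2 0 a (2 * pi)); [|lra..].
rewrite addeC; congr (_ + _)%E.
rewrite -[X in `[X, _]](add0r (2 * pi)) -ge0_integral_itv_translate//.
by apply: eq_integral => y _; rewrite Fper.
Qed.

Lemma ge0_integral_period F (a : R) :
  measurable_fun setT F -> (forall x, (0 <= F x)%E) -> (forall x, F (x + 2 * pi) = F x) ->
  (\int[leb]_(y in `[a, (a + 2 * pi)%R]) F y = \int[leb]_(y in `[0%R, (2 * pi)%R]) F y)%E.
Proof.
move=> mF F0 Fper; have pi2 := twopi_gt0 R.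
pose W (u : R) := (\int[leb]_(y in `[u, (u + 2 * pi)%R]) F y)%E.
have W1 u : W (u + 2 * pi) = W u.
  rewrite /W -ge0_integral_itv_translate//.
  by apply: eq_integral => y _; rewrite Fper.
have Wn (n : nat) u : W (u + n%:R * (2 * pi)) = W u.
  elim: n => [|n IH]; first by rewrite mul0r addr0.
  by rewrite -[RHS]IH -[RHS]W1 -addn1 natrD; congr W; ring.
have Wz (n : int) u : W (u + n%:~R * (2 * pi)) = W u.
  case: n => n; first exact: Wn.
  by rewrite -[LHS](Wn n.+1) NegzE mulrNz -pmulrn mulNr subrK.
(* Subtracting [floor (a / (2 * pi))] periods brings the left end into [[0, 2 * pi[]. *)
rewrite -/(W a) -(Wz (- Num.floor (a / (2 * pi)))) /W ge0_integral_period_lt//.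
have /andP[h1 h2] := Num.Theory.floor_itv (a / (2 * pi)).
rewrite mulrNz; apply/andP; split.
  by move: h1; rewrite ler_pdivlMr//; lra.
by move: h2; rewrite ltr_pdivrMr// intrD mulrDl; lra.
Qed.

Lemma ge0_integral_circle_reflect F (x : R) :
  measurable_fun setT F -> (forall x, (0 <= F x)%E) -> (forall x, F (x + 2 * pi) = F x) ->
  (\int[uniform_prob (twopi_gt0 R)]_y F (x - y)%R = \int[uniform_prob (twopi_gt0 R)]_y F y)%E.
Proof.
move=> mF F0 Fper; rewrite !integral_uniform//; last first.
  by apply: measurableT_comp => //; exact: measurable_funB.
congr (_ * _)%E; rewrite ge0_integral_itv_reflect// subr0.
by rewrite -[X in `[_, X]](subrK (2 * pi)) ge0_integral_period.
Qed.

End circle.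

Section torus_reflection.
Variable R : realType.

Lemma ge0_integral_torusS n (F : point R n.+1 -> \bar R) :
  measurable_fun setT F -> (forall x, 0 <= F x)%E ->
  (\int[torus_measure R n.+1]_x F x =
   \int[uniform_prob (twopi_gt0 R)]_u \int[torus_measure R n]_v F (tcons (u, v)))%E.
Proof.
move=> mF F0 /=; rewrite ge0_integral_distribution//.
rewrite fubini_tonelli1//; last by move=> x; exact: F0.
by apply: (measurableT_comp mF); exact: measurable_tcons.
Qed.

Lemma measurable_point_sub d (x : point R d) :
  measurable_fun [set: point R d] (point_sub x).
Proof.
apply/measurable_fun_tnthP => i.
rewrite (_ : _ \o _ = fun y => (tnth x i - tnth y i : measurableTypeR R)).
  by apply: measurable_funB => //; exact: measurable_tnth.
by apply/funext => y /=; rewrite tnth_mktuple.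
Qed.

Lemma point_sub_tcons n (x : point R n.+1) u (v : point R n) :
  point_sub x (tcons (u, v)) = tcons (thead x - u, point_sub [tuple of behead x] v).
Proof.
apply: eq_from_tnth => i; rewrite tnth_mktuple.
case: (unliftP ord0 i) => [j|] ->; last by rewrite (tuple_eta x) !tnth0.
by rewrite [in LHS](tuple_eta x) !tnthS tnth_mktuple.
Qed.

Lemma shift_coord_tcons0 n u (v : point R n) :
  shift_coord ord0 (tcons (u, v)) = tcons (u + 2 * pi, v).
Proof.
apply: eq_from_tnth => i; rewrite tnth_mktuple.
case: (unliftP ord0 i) => [j|] ->; last by rewrite eqxx !tnth0.
by rewrite !tnthS eq_sym (negbTE (neq_lift _ _)) addr0.
Qed.

Lemma shift_coord_tconsS n i u (v : point R n) :
  shift_coord (lift ord0 i) (tcons (u, v)) = tcons (u, shift_coord i v).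
Proof.
apply: eq_from_tnth => j; rewrite tnth_mktuple.
case: (unliftP ord0 j) => [k|] ->.
  by rewrite !tnthS tnth_mktuple (inj_eq lift_inj).
by rewrite !tnth0 (negbTE (neq_lift _ _)) addr0.
Qed.

(** Tonelli peels off the first coordinate; the others are reflected by induction and the first one
    by the circle case. *)
Lemma ge0_integral_torus_reflect d (F : point R d -> \bar R) (x : point R d) :
  measurable_fun setT F -> (forall x, 0 <= F x)%E ->
  (forall i x, F (shift_coord i x) = F x) ->
  (\int[torus_measure R d]_y F (point_sub x y) = \int[torus_measure R d]_y F y)%E.
Proof.
elim: d F x => [|n IH] F x mF F0 Fper.
  by apply: eq_integral => y _; rewrite tuple0 [y]tuple0.
have mFx y : measurable_fun setT (fun z => F (point_sub y z)).
  by apply: (measurableT_comp mF); exact: measurable_point_sub.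
rewrite !ge0_integral_torusS//.
have mFt u : measurable_fun setT (fun v => F (tcons (u, v))).
  by apply: (measurableT_comp mF); apply: (measurableT_comp (@measurable_tcons R n)).
under eq_integral => u _.
  under eq_integral do rewrite point_sub_tcons.
  rewrite (IH (fun v => F (tcons (thead x - u, v))))//.
    over.
  by move=> i v; rewrite -shift_coord_tconsS Fper.
rewrite (@ge0_integral_circle_reflect _ (fun u => \int[torus_measure R n]_v F (tcons (u, v)))%E)//.
- apply: (@measurable_fun_fubini_tonelli_F _ _ _ _ R (torus_measure R n) (fun z => F (tcons z))) => //.
  by apply: (measurableT_comp mF); exact: measurable_tcons.
- by move=> u; apply: integral_ge0.
- by move=> u; apply: eq_integral => v _; rewrite -shift_coord_tcons0 Fper.
Qed.

Lemma integral_torus_reflect d (F : point R d -> \bar R) (x : point R d) :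
  measurable_fun setT F -> (forall i x, F (shift_coord i x) = F x) ->
  (\int[torus_measure R d]_y F (point_sub x y) = \int[torus_measure R d]_y F y)%E.
Proof.
move=> mF Fper; rewrite integralE [RHS]integralE; congr (_ - _)%E.
  rewrite -(@ge0_integral_torus_reflect _ (F^\+)%E x)//.
  - by apply: eq_integral => y _; rewrite !funeposE.
  - exact: measurable_funepos.
  - by move=> i y; rewrite !funeposE Fper.
rewrite -(@ge0_integral_torus_reflect _ (F^\-)%E x)//.
- by apply: eq_integral => y _; rewrite !funenegE.
- exact: measurable_funeneg.
- by move=> i y; rewrite !funenegE Fper.
Qed.

End torus_reflection.

(** * Complex-valued integration on the torus *)

Notation normc := Normc.normc.

Section complex_modulus.
Variable R : rcfType.
Implicit Types z w : R[i].

Lemma normc_sqr z : normc z ^+ 2 = complex.Re z ^+ 2 + complex.Im z ^+ 2.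
Proof. by case: z => a b /=; rewrite sqr_sqrtr// addr_ge0// sqr_ge0. Qed.

Lemma normc_ge0 z : 0 <= normc z.
Proof. by case: z => a b; exact: sqrtr_ge0. Qed.

Lemma Re_le_normc z : `|complex.Re z| <= normc z.
Proof.
rewrite -ler_sqr ?nnegrE ?normc_ge0// normc_sqr real_normK ?num_real//.
by rewrite lerDl sqr_ge0.
Qed.

Lemma Im_le_normc z : `|complex.Im z| <= normc z.
Proof.
rewrite -ler_sqr ?nnegrE ?normc_ge0// normc_sqr real_normK ?num_real//.
by rewrite lerDr sqr_ge0.
Qed.

Lemma normc_le_ReIm z : normc z <= `|complex.Re z| + `|complex.Im z|.
Proof.
rewrite -ler_sqr ?nnegrE ?normc_ge0 ?addr_ge0// normc_sqr sqrrD !real_normK ?num_real//.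
by rewrite -addrA lerD2l lerDr mulrn_wge0// mulr_ge0.
Qed.

Lemma normcE z : `|z| = (normc z)%:C%C.
Proof. by case: z. Qed.

Lemma normcD_le z w : normc (z + w) <= normc z + normc w.
Proof. by rewrite -lecR rmorphD/= -!normcE ler_normD. Qed.

Lemma normc_opp z : normc (- z) = normc z.
Proof. by apply: (@complexI R); rewrite -!normcE normrN. Qed.

Lemma normc_conj z : normc (z^*)%C = normc z.
Proof. by apply: (@complexI R); rewrite -!normcE normcJ. Qed.

Lemma normcB_le z w : normc (z - w) <= normc z + normc w.
Proof. by rewrite (le_trans (normcD_le _ _))// normc_opp. Qed.

Lemma normc_real (x : R) : normc (x%:C)%C = `|x|.
Proof. by rewrite /= expr0n addr0 sqrtr_sqr. Qed.

Lemma normc_sum I (s : seq I) (P : pred I) (F : I -> R[i]) :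
  normc (\sum_(i <- s | P i) F i) <= \sum_(i <- s | P i) normc (F i).
Proof.
elim/big_ind2 : _ => [|x1 x2 y1 y2 h1 h2|//]; first by rewrite Normc.normc0.
by rewrite (le_trans (normcD_le _ _))// lerD.
Qed.

Lemma normc_prod I (s : seq I) (P : pred I) (F : I -> R[i]) :
  normc (\prod_(i <- s | P i) F i) = \prod_(i <- s | P i) normc (F i).
Proof. by apply: big_morph; [exact: Normc.normcM|exact: Normc.normc1]. Qed.

Lemma Re_mul z w : complex.Re (z * w) =
  complex.Re z * complex.Re w - complex.Im z * complex.Im w.
Proof. by case: z w => a b [c e]. Qed.

Lemma Im_mul z w : complex.Im (z * w) =
  complex.Re z * complex.Im w + complex.Im z * complex.Re w.
Proof. by case: z w => a b [c e]. Qed.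

Lemma ReD z w : complex.Re (z + w) = complex.Re z + complex.Re w.
Proof. by case: z w => a b [c e]. Qed.

Lemma ImD z w : complex.Im (z + w) = complex.Im z + complex.Im w.
Proof. by case: z w => a b [c e]. Qed.

Lemma mul_conj z : z * (z^*)%C = (normc z ^+ 2)%:C%C.
Proof. by rewrite -sqr_normc normcE rmorphXn. Qed.

End complex_modulus.

Section torus_integration.
Variables (R : realType) (d : nat).
Local Notation mu := (torus_measure R d).
Implicit Types f g : point R d -> R[i].

Definition cmeas f :=
  measurable_fun setT (fun x => complex.Re (f x)) /\
  measurable_fun setT (fun x => complex.Im (f x)).

Definition periodic T (f : point R d -> T) := forall i x, f (shift_coord i x) = f x.

Definition cint f :=
  cmeas f /\ (\int[mu]_x (normc (f x))%:E < +oo)%E.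

Lemma cmeas_normc f : cmeas f -> measurable_fun setT (fun x => normc (f x)).
Proof.
move=> [mr mi].
rewrite (_ : (fun _ => _) = (fun x => Num.sqrt (complex.Re (f x) ^+ 2 + complex.Im (f x) ^+ 2))).
  apply: (measurableT_comp (continuous_measurable_fun (@sqrt_continuous R))).
  by apply: measurable_funD; exact: measurable_funX.
by apply/funext => x; case: (f x).
Qed.

Lemma cmeas_Enormc f : cmeas f -> measurable_fun setT (fun x => (normc (f x))%:E).
Proof. by move=> mf; apply/measurable_EFinP; exact: cmeas_normc. Qed.

Lemma cmeas_normc2 f : cmeas f -> measurable_fun setT (fun x => (normc (f x) ^+ 2)%:E).
Proof. by move=> mf; apply/measurable_EFinP; apply: measurable_funX; exact: cmeas_normc. Qed.

Lemma cmeas_cst z : cmeas (fun=> z).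
Proof. by split; exact: measurable_cst. Qed.

Lemma cmeasD f g : cmeas f -> cmeas g -> cmeas (fun x => f x + g x).
Proof.
move=> [fr fi] [gr gi]; split.
  by under eq_fun do rewrite ReD; exact: measurable_funD.
by under eq_fun do rewrite ImD; exact: measurable_funD.
Qed.

Lemma cmeasM f g : cmeas f -> cmeas g -> cmeas (fun x => f x * g x).
Proof.
move=> [fr fi] [gr gi]; split.
  by under eq_fun do rewrite Re_mul; apply: measurable_funB; exact: measurable_funM.
by under eq_fun do rewrite Im_mul; apply: measurable_funD; exact: measurable_funM.
Qed.

Lemma cmeasN f : cmeas f -> cmeas (fun x => - f x).
Proof.
move=> mf; have := cmeasM (cmeas_cst (-1)) mf.
by under eq_fun do rewrite mulN1r.
Qed.

Lemma cmeasB f g : cmeas f -> cmeas g -> cmeas (fun x => f x - g x).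
Proof. by move=> mf mg; exact: cmeasD mf (cmeasN mg). Qed.

Lemma cmeas_sum I (s : seq I) (F : I -> point R d -> R[i]) :
  (forall i, cmeas (F i)) -> cmeas (fun x => \sum_(i <- s) F i x).
Proof.
move=> mF; elim: s => [|a s IH].
  by under eq_fun do rewrite big_nil; exact: cmeas_cst.
by under eq_fun do rewrite big_cons; exact: cmeasD.
Qed.

Lemma cmeas_prod I (s : seq I) (F : I -> point R d -> R[i]) :
  (forall i, cmeas (F i)) -> cmeas (fun x => \prod_(i <- s) F i x).
Proof.
move=> mF; elim: s => [|a s IH].
  by under eq_fun do rewrite big_nil; exact: cmeas_cst.
by under eq_fun do rewrite big_cons; exact: cmeasM.
Qed.

Lemma cmeas_sub f x : cmeas f -> cmeas (fun y => f (point_sub x y)).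
Proof.
move=> [fr fi]; split.
  exact: (measurableT_comp fr (measurable_point_sub x)).
exact: (measurableT_comp fi (measurable_point_sub x)).
Qed.

Lemma cmeas_real (u : point R d -> R) :
  measurable_fun setT u -> cmeas (fun x => (u x)%:C%C).
Proof. by move=> mu; split => //=. Qed.

Lemma cint_Re f : cint f -> mu.-integrable setT (fun x => (complex.Re (f x))%:E).
Proof.
move=> [[mr mi] fi]; apply/integrableP; split; first exact/measurable_EFinP.
apply: le_lt_trans fi; apply: ge0_le_integral => //=.
- by apply/measurable_EFinP; exact: measurableT_comp.
- exact: cmeas_Enormc.
- by move=> x _; rewrite lee_fin Re_le_normc.
Qed.

Lemma cint_Im f : cint f -> mu.-integrable setT (fun x => (complex.Im (f x))%:E).
Proof.
move=> [[mr mi] fi]; apply/integrableP; split; first exact/measurable_EFinP.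
apply: le_lt_trans fi; apply: ge0_le_integral => //=.
- by apply/measurable_EFinP; exact: measurableT_comp.
- exact: cmeas_Enormc.
- by move=> x _; rewrite lee_fin Im_le_normc.
Qed.

Lemma cint_le f (g : point R d -> \bar R) : cmeas f ->
  measurable_fun setT g -> (\int[mu]_x g x < +oo)%E ->
  (forall x, ((normc (f x))%:E <= g x)%E) -> cint f.
Proof.
move=> mf mg gi fg; split => //; apply: le_lt_trans gi.
apply: ge0_le_integral => //=.
- by move=> x _; rewrite lee_fin normc_ge0.
- exact: cmeas_Enormc.
Qed.

Lemma cint_bounded f (M : R) : cmeas f -> (forall x, normc (f x) <= M) -> cint f.
Proof.
move=> mf fM; apply: (@cint_le _ (cst M%:E)) => //.
by rewrite integral_cst//= probability_setT mule1 ltry.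
Qed.

Lemma cintD f g : cint f -> cint g -> cint (fun x => f x + g x).
Proof.
move=> [mf fi] [mg gi]; apply: (@cint_le _ (fun x => (normc (f x))%:E + (normc (g x))%:E)%E).
- exact: cmeasD.
- by apply: emeasurable_funD; exact: cmeas_Enormc.
- rewrite ge0_integralD//=; first exact: lte_add_pinfty.
  + by move=> x _; rewrite lee_fin normc_ge0.
  + exact: cmeas_Enormc.
  + by move=> x _; rewrite lee_fin normc_ge0.
  + exact: cmeas_Enormc.
- by move=> x; rewrite -EFinD lee_fin normcD_le.
Qed.

Lemma cintMr f g (M : R) : cint f -> cmeas g -> (forall x, normc (g x) <= M) ->
  cint (fun x => f x * g x).
Proof.
move=> [mf fi] mg gM; apply: (@cint_le _ (fun x => M%:E * (normc (f x))%:E)%E).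
- exact: cmeasM.
- by apply: emeasurable_funM; [exact: measurable_cst|exact: cmeas_Enormc].
- rewrite ge0_integralZl//=.
  + by rewrite lte_mul_pinfty// lee_fin (le_trans (normc_ge0 (g [tuple of nseq d 0])))//.
  + exact: cmeas_Enormc.
  + by move=> x _; rewrite lee_fin normc_ge0.
  + by rewrite lee_fin (le_trans (normc_ge0 (g [tuple of nseq d 0])))//.
- by move=> x; rewrite -EFinM lee_fin Normc.normcM mulrC ler_wpM2r// normc_ge0.
Qed.

Lemma cintZ f z : cint f -> cint (fun x => z * f x).
Proof.
move=> fi; have := @cintMr f (fun=> z) (normc z) fi (cmeas_cst z) (fun=> lexx _).
by under eq_fun do rewrite mulrC.
Qed.

Lemma cintN f : cint f -> cint (fun x => - f x).
Proof.
by move=> fi; have := @cintZ f (-1) fi; under eq_fun do rewrite mulN1r.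
Qed.

Lemma cint_sum I (s : seq I) (F : I -> point R d -> R[i]) :
  (forall i, cint (F i)) -> cint (fun x => \sum_(i <- s) F i x).
Proof.
move=> mF; elim: s => [|a s IH].
  under eq_fun do rewrite big_nil.
  by apply: (@cint_bounded _ 0); [exact: cmeas_cst|move=> x; rewrite Normc.normc0].
by under eq_fun do rewrite big_cons; exact: cintD.
Qed.

Lemma torus_integralD f g : cint f -> cint g ->
  torus_integral (fun x => f x + g x) = torus_integral f + torus_integral g.
Proof.
move=> fi gi; rewrite /torus_integral.
under eq_Rintegral do rewrite ReD.
under [X in (_ +i* X)%C]eq_Rintegral do rewrite ImD.
rewrite RintegralD ?RintegralD//; first exact: cint_Im.
- exact: cint_Im.
- exact: cint_Re.
- exact: cint_Re.
Qed.

Lemma torus_integralZ f z : cint f ->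
  torus_integral (fun x => z * f x) = z * torus_integral f.
Proof.
move=> fi; rewrite /torus_integral.
under eq_Rintegral do rewrite Re_mul.
under [X in (_ +i* X)%C]eq_Rintegral do rewrite Im_mul.
have ir := cint_Re fi; have ii := cint_Im fi.
have iZ (c : R) (h : point R d -> R) : mu.-integrable setT (EFin \o h) ->
    mu.-integrable setT (EFin \o (fun x => c * h x)).
  by move=> hi; have := integrableZl measurableT c hi.
rewrite RintegralB ?RintegralD ?RintegralZl//; try exact: iZ.
by case: z.
Qed.

Lemma eq_torus_integral f g : f =1 g -> torus_integral f = torus_integral g.
Proof. by move=> /funext ->. Qed.

Lemma torus_integral0 : torus_integral (fun _ : point R d => 0 : R[i]) = 0 :> R[i].
Proof. by rewrite /torus_integral/= !Rintegral_cst// !mul0r. Qed.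

Lemma torus_integral_cst (z : R[i]) : torus_integral (fun _ : point R d => z) = z :> R[i].
Proof.
rewrite /torus_integral/= !Rintegral_cst//.
rewrite (_ : fine _ = 1); last exact: (congr1 fine (probability_setT mu)).
by rewrite !mulr1; case: z.
Qed.

Lemma torus_integral_sum I (s : seq I) (F : I -> point R d -> R[i]) :
  (forall i, cint (F i)) ->
  torus_integral (fun x => \sum_(i <- s) F i x) = \sum_(i <- s) torus_integral (F i).
Proof.
move=> Fi; elim: s => [|a s IH].
  by under eq_torus_integral do rewrite big_nil; rewrite big_nil torus_integral0.
under eq_torus_integral do rewrite big_cons.
by rewrite torus_integralD ?IH ?big_cons//; exact: cint_sum.
Qed.

Lemma torus_integral_real (u : point R d -> R) :
  torus_integral (fun x => (u x)%:C%C) = (\int[mu]_x u x)%:C%C.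
Proof. by rewrite /torus_integral/= Rintegral_cst// mul0r. Qed.

(** The 2 comes from bounding real and imaginary parts separately; it ends up in the equivalence
    constants. *)
Lemma le_normc_torus_integral f : cint f ->
  ((normc (torus_integral f))%:E <= 2%:E * \int[mu]_x (normc (f x))%:E)%E.
Proof.
move=> fi.
have h (u : point R d -> R) : mu.-integrable setT (EFin \o u) ->
    (forall x, `|u x| <= normc (f x)) ->
    (`|\int[mu]_x u x|%:E <= \int[mu]_x (normc (f x))%:E)%E.
  move=> ui uf; rewrite EFin_normr_Rintegral//.
  have mu' : measurable_fun setT (EFin \o u) by case/integrableP: ui.
  apply: (le_trans (le_abse_integral _ _ _)) => //.
  apply: ge0_le_integral => //=.
  - exact: (measurableT_comp (@abse_measurable _ setT) mu').
  - by apply: cmeas_Enormc; case: fi.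
  - by move=> x _; rewrite lee_fin.
apply: (@le_trans _ _ (`|\int[mu]_x complex.Re (f x)|%:E + `|\int[mu]_x complex.Im (f x)|%:E)%E).
  by rewrite -EFinD lee_fin normc_le_ReIm.
rewrite -[2%R]/(1 + 1)%R EFinD ge0_muleDl// !mul1e; apply: leeD; apply: h.
- exact: cint_Re.
- by move=> x; exact: Re_le_normc.
- exact: cint_Im.
- by move=> x; exact: Im_le_normc.
Qed.

Lemma torus_integral_reflect f x : cmeas f -> periodic f ->
  torus_integral (fun y => f (point_sub x y)) = torus_integral f.
Proof.
move=> [mr mi] fper; rewrite /torus_integral /Rintegral.
have pr : periodic (fun x => (complex.Re (f x))%:E) by move=> i y; rewrite fper.
have pi : periodic (fun x => (complex.Im (f x))%:E) by move=> i y; rewrite fper.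
have mr' : measurable_fun setT (fun x => (complex.Re (f x))%:E) by exact/measurable_EFinP.
have mi' : measurable_fun setT (fun x => (complex.Im (f x))%:E) by exact/measurable_EFinP.
rewrite -(integral_torus_reflect x mr')//.
by rewrite -(integral_torus_reflect x mi').
Qed.

Lemma integral_normc_reflect f x : cmeas f -> periodic f ->
  (\int[mu]_y (normc (f (point_sub x y)))%:E = \int[mu]_y (normc (f y))%:E)%E.
Proof.
move=> mf fper.
rewrite -(@integral_torus_reflect _ _ (fun y => (normc (f y))%:E) x)//.
- exact: cmeas_Enormc.
- by move=> i y; rewrite fper.
Qed.

Lemma cint_reflect f x : cint f -> periodic f -> cint (fun y => f (point_sub x y)).
Proof.
by move=> [mf fi] fp; split; [exact: cmeas_sub|rewrite integral_normc_reflect].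
Qed.

End torus_integration.

(** * Trigonometric polynomials, Parseval and Bessel *)

Section exponentials.
Variable R : realType.
Implicit Types (j k : int) (t u : R).

Definition e1 (j : int) (t : R) : R[i] := (cos (j%:~R * t) +i* sin (j%:~R * t))%C.

Arguments e1 : simpl never.

Lemma e1D j k t : e1 (j + k) t = e1 j t * e1 k t.
Proof.
rewrite /e1 intrD mulrDl cosD sinD.
by apply/eqP; rewrite eq_complex /= eqxx/= addrC.
Qed.

Lemma e1_addt j t u : e1 j (t + u) = e1 j t * e1 j u.
Proof.
rewrite /e1 mulrDr cosD sinD.
by apply/eqP; rewrite eq_complex /= eqxx/= addrC.
Qed.

Lemma e1_0 t : e1 0 t = 1.
Proof. by rewrite /e1 mul0r cos0 sin0. Qed.

Lemma e1_at0 j : e1 j 0 = 1.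
Proof. by rewrite /e1 mulr0 cos0 sin0. Qed.

Lemma e1_conj j t : e1 (- j) t = ((e1 j t)^*)%C.
Proof. by rewrite /e1 intrN mulNr cosN sinN. Qed.

Lemma e1_oppt j t : e1 j (- t) = e1 (- j) t.
Proof. by rewrite /e1 intrN mulNr mulrN. Qed.

Lemma normc_e1 j t : normc (e1 j t) = 1.
Proof. by rewrite /e1/= cos2Dsin2 sqrtr1. Qed.

Lemma e1_nat (n : nat) t : e1 n%:Z t = e1 1 t ^+ n.
Proof.
elim: n => [|n IH]; first by rewrite e1_0 expr0.
by rewrite exprS -IH -e1D.
Qed.

Lemma e1_2pi j : e1 j (2 * pi) = 1 :> R[i].
Proof.
have h (n : nat) : e1 n%:Z (2 * pi) = 1 :> R[i].
  by rewrite e1_nat /e1 mul1r mulr_natl cos2pi sin2pi expr1n.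
case: j => n; first exact: h.
by rewrite NegzE e1_conj h conjc1.
Qed.

Lemma e1_periodic j t : e1 j (t + 2 * pi) = e1 j t.
Proof. by rewrite e1_addt e1_2pi mulr1. Qed.

End exponentials.

Section torus_exponentials.
Variables (R : realType) (d : nat).
Local Notation mu := (torus_measure R d).
Local Notation freq := {ffun 'I_d -> int}.
Implicit Types (k l : freq) (x y : point R d) (f g : point R d -> R[i]).

Definition expo k x : R[i] := \prod_i e1 (k i) (tnth x i).

Lemma expoD k l x : expo (k + l) x = expo k x * expo l x.
Proof. by rewrite /expo -big_split; apply: eq_bigr => i _; rewrite !ffunE e1D. Qed.

Lemma expo0 x : expo 0 x = 1.
Proof. by rewrite /expo big1// => i _; rewrite ffunE e1_0. Qed.

Lemma normc_expo k x : normc (expo k x) = 1.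
Proof. by rewrite /expo normc_prod big1// => i _; rewrite normc_e1. Qed.

Lemma expoN k x : expo (- k) x = ((expo k x)^*)%C.
Proof.
rewrite /expo rmorph_prod; apply: eq_bigr => i _.
by rewrite ffunE e1_conj.
Qed.

Lemma expo_sub k x y : expo k (point_sub x y) = expo k x * expo (- k) y.
Proof.
rewrite /expo -big_split; apply: eq_bigr => i _.
by rewrite tnth_mktuple e1_addt e1_oppt ffunE.
Qed.

Lemma expo_periodic k : periodic (expo k).
Proof.
move=> i x; rewrite /expo; apply: eq_bigr => j _; rewrite tnth_mktuple.
by case: eqP => _; rewrite ?addr0// e1_periodic.
Qed.

Lemma cmeas_coord (h : R -> R[i]) (i : 'I_d) :
  measurable_fun setT (fun t => complex.Re (h t)) ->
  measurable_fun setT (fun t => complex.Im (h t)) ->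
  cmeas (fun x : point R d => h (tnth x i)).
Proof.
have mi : measurable_fun setT (fun x : point R d => tnth x i : measurableTypeR R).
  exact: measurable_tnth.
by move=> hr hi; split; [exact: (measurableT_comp hr mi)|exact: (measurableT_comp hi mi)].
Qed.

Lemma cmeas_expo k : cmeas (expo k).
Proof.
apply: cmeas_prod => i; apply: (@cmeas_coord (e1 (k i))); rewrite /e1/=.
  apply: (measurableT_comp (continuous_measurable_fun (@continuous_cos R))).
  exact: measurable_funM.
apply: (measurableT_comp (continuous_measurable_fun (@continuous_sin R))).
exact: measurable_funM.
Qed.

Lemma cint_expo k : cint (expo k).
Proof. by apply: (@cint_bounded _ _ _ 1); [exact: cmeas_expo|move=> x; rewrite normc_expo]. Qed.

Lemma cint_mul_expo f k : cint f -> cint (fun x => f x * expo k x).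
Proof.
move=> fi; apply: (@cintMr _ _ _ _ 1) => //; first exact: cmeas_expo.
by move=> x; rewrite normc_expo.
Qed.

(** Reflection at [x] gives [I(k) = expo k x * I(-k)] for every [x]. Points where [expo k] is 1 and
    -1 give [I(k) = I(-k) = - I(k)]. *)
Lemma torus_integral_expo k : torus_integral (expo k) = (k == 0)%:R.
Proof.
have [->|k0] := eqVneq k 0.
  by under eq_torus_integral do rewrite expo0; rewrite torus_integral_cst.
have h x : expo k x * torus_integral (expo (- k)) = torus_integral (expo k).
  rewrite -torus_integralZ; last exact: cint_expo.
  rewrite -[RHS](torus_integral_reflect x); [|exact: cmeas_expo|exact: expo_periodic].
  by apply: eq_torus_integral => y; rewrite expo_sub.
have [i ki] : exists i, k i != 0.
  apply/existsP; apply: contraNT k0 => /existsPn k0; apply/eqP/ffunP => i.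
  by rewrite ffunE; apply/eqP; move: (k0 i); rewrite negbK.
have e1x : expo k [tuple if j == i then pi / (k i)%:~R else 0 | j < d] = -1.
  rewrite /expo (bigD1 i)//= big1 ?mulr1; last first.
    by move=> j ji; rewrite tnth_mktuple (negbTE ji) e1_at0.
  rewrite tnth_mktuple eqxx /e1 mulrC divfK ?intr_eq0// cospi sinpi.
  by apply/eqP; rewrite eq_complex/= oppr0 !eqxx.
have e0x : expo k [tuple 0 | j < d] = 1.
  by rewrite /expo big1// => j _; rewrite tnth_mktuple e1_at0.
have h0 := h [tuple 0 | j < d]; rewrite e0x mul1r in h0.
have := h [tuple if j == i then pi / (k i)%:~R else 0 | j < d].
by rewrite e1x -h0 mulN1r => /eqP; rewrite eqNr => /eqP.
Qed.

Definition fcoef f k : R[i] := torus_integral (fun x => f x * expo (- k) x).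

Definition tpoly (S : seq freq) (c : freq -> R[i]) x : R[i] :=
  \sum_(k <- S) c k * expo k x.

Lemma point_subK x y : point_sub x (point_sub x y) = y.
Proof.
apply: eq_from_tnth => i; rewrite !tnth_mktuple; exact: subKr.
Qed.

(** The substitution of [point_sub x y] for [y] moves the shift from [f] to the exponential, where
    it factors out. *)
Lemma conv_expo f k x : cint f -> periodic f -> conv f (expo k) x = fcoef f k * expo k x.
Proof.
move=> fi fp; rewrite /conv /fcoef mulrC -torus_integralZ; last exact: cint_mul_expo.
pose F y := expo k x * (f y * expo (- k) y).
rewrite -[RHS](@torus_integral_reflect _ _ F x).
- apply: eq_torus_integral => y; rewrite /F mulrCA -expo_sub.
  by rewrite point_subK.
- by apply: cmeasM; [exact: cmeas_cst|apply: cmeasM; [case: fi|exact: cmeas_expo]].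
- by move=> i y; rewrite /F fp expo_periodic.
Qed.

Lemma conv_tpoly f S c x : cint f -> periodic f ->
  conv f (tpoly S c) x = tpoly S (fun k => c k * fcoef f k) x.
Proof.
move=> fi fp; rewrite /conv /tpoly.
under eq_torus_integral.
  move=> y; rewrite mulr_sumr.
  under eq_bigr do rewrite mulrCA.
  over.
rewrite torus_integral_sum.
  apply: eq_bigr => k _; rewrite torus_integralZ.
    by have := conv_expo k x fi fp; rewrite /conv => ->; rewrite mulrA.
  by apply: cint_mul_expo; exact: cint_reflect.
by move=> k; apply: cintZ; apply: cint_mul_expo; exact: cint_reflect.
Qed.

Lemma cmeas_tpoly S c : cmeas (tpoly S c).
Proof.
apply: cmeas_sum => k; apply: cmeasM; [exact: cmeas_cst|exact: cmeas_expo].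
Qed.

Lemma tpoly_periodic S c : periodic (tpoly S c).
Proof. by move=> i x; apply: eq_bigr => k _; rewrite expo_periodic. Qed.

Lemma normc_tpoly_le S c x : normc (tpoly S c x) <= \sum_(k <- S) normc (c k).
Proof.
rewrite (le_trans (normc_sum _ _ _))//; apply: ler_sum => k _.
by rewrite Normc.normcM normc_expo mulr1.
Qed.

Lemma cint_tpoly S c : cint (tpoly S c).
Proof.
apply: cint_bounded; first exact: cmeas_tpoly.
by move=> x; exact: normc_tpoly_le.
Qed.

Lemma fcoef_tpoly S c k : uniq S -> fcoef (tpoly S c) k = if k \in S then c k else 0.
Proof.
move=> uS; rewrite /fcoef.
under eq_torus_integral.
  move=> x; rewrite /tpoly mulr_suml.
  under eq_bigr do rewrite -mulrA -expoD.
  over.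
rewrite torus_integral_sum; last by move=> l; apply: cintZ; exact: cint_expo.
under eq_bigr => l _.
  rewrite torus_integralZ ?torus_integral_expo; last exact: cint_expo.
  over.
under eq_bigr do rewrite subr_eq0.
case: ifPn => kS.
  rewrite (bigD1_seq k)//= eqxx mulr1 big1 ?addr0// => l lk.
  by rewrite (negbTE lk) mulr0.
by rewrite big_seq big1// => l lS; case: eqP => [lk|_]; rewrite ?mulr0//; move: kS; rewrite -lk lS.
Qed.

Lemma eq_tpoly S c c' : {in S, c =1 c'} -> tpoly S c =1 tpoly S c'.
Proof. by move=> cc x; apply: eq_big_seq => k kS; rewrite cc. Qed.

Lemma fcoefD f g k : cint f -> cint g -> fcoef (fun x => f x + g x) k = fcoef f k + fcoef g k.
Proof.
move=> fi gi; rewrite /fcoef.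
under eq_torus_integral do rewrite mulrDl.
by rewrite torus_integralD//; exact: cint_mul_expo.
Qed.

Lemma fcoefZ f z k : cint f -> fcoef (fun x => z * f x) k = z * fcoef f k.
Proof.
move=> fi; rewrite /fcoef.
under eq_torus_integral do rewrite -mulrA.
by rewrite torus_integralZ//; exact: cint_mul_expo.
Qed.

Lemma fcoefN f k : cint f -> fcoef (fun x => - f x) k = - fcoef f k.
Proof.
move=> fi; rewrite -mulN1r -fcoefZ//; apply: eq_torus_integral => x.
by rewrite mulN1r.
Qed.

Lemma fcoefB f g k : cint f -> cint g -> fcoef (fun x => f x - g x) k = fcoef f k - fcoef g k.
Proof. by move=> fi gi; rewrite fcoefD ?fcoefN//; exact: cintN. Qed.

Lemma fcoef_sum I (s : seq I) (F : I -> point R d -> R[i]) k : (forall i, cint (F i)) ->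
  fcoef (fun x => \sum_(i <- s) F i x) k = \sum_(i <- s) fcoef (F i) k.
Proof.
move=> Fi; rewrite /fcoef.
under eq_torus_integral do rewrite mulr_suml.
by rewrite torus_integral_sum// => i; exact: cint_mul_expo.
Qed.

Lemma normc_fcoef_le f k : cint f ->
  ((normc (fcoef f k))%:E <= 2%:E * \int[mu]_x (normc (f x))%:E)%E.
Proof.
move=> fi; apply: (le_trans (le_normc_torus_integral _)); first exact: cint_mul_expo.
by under eq_integral do rewrite Normc.normcM normc_expo mulr1.
Qed.

Lemma EFin_Rintegral_bounded (u : point R d -> R) (M : R) : measurable_fun setT u ->
  (forall x, `|u x| <= M) -> (\int[mu]_x (u x)%:E = (\int[mu]_x u x)%:E)%E.
Proof.
move=> mu' uM; rewrite /Rintegral fineK//; apply: integrable_fin_num => //.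
apply: measurable_bounded_integrable => //.
  by rewrite (le_lt_trans (probability_le1 _ _))// ltry.
by exists M; split; [exact: num_real|move=> N MN x _; exact: le_trans (uM x) (ltW MN)].
Qed.

Lemma cmeas_conj f : cmeas f -> cmeas (fun x => ((f x)^*)%C).
Proof.
move=> [fr fi]; split.
  by rewrite (_ : (fun _ => _) = (fun x => complex.Re (f x)))//; apply/funext => x; case: (f x).
rewrite (_ : (fun _ => _) = (fun x => - complex.Im (f x))); first exact: measurableT_comp.
by apply/funext => x; case: (f x).
Qed.

Lemma torus_integral_mul_conj_tpoly f S c : cint f ->
  torus_integral (fun x => f x * ((tpoly S c x)^*)%C) =
  \sum_(k <- S) ((c k)^*)%C * fcoef f k.
Proof.
move=> fi; under eq_torus_integral.
  move=> x; rewrite /tpoly rmorph_sum mulr_sumr.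
  under eq_bigr do rewrite rmorphM/= -expoN mulrCA.
  over.
rewrite torus_integral_sum.
  by apply: eq_bigr => k _; rewrite torus_integralZ//; exact: cint_mul_expo.
by move=> k; apply: cintZ; exact: cint_mul_expo.
Qed.

Lemma parseval_tpoly S c : uniq S ->
  (\int[mu]_x (normc (tpoly S c x) ^+ 2)%:E = (\sum_(k <- S) normc (c k) ^+ 2)%:E)%E.
Proof.
move=> uS; rewrite (@EFin_Rintegral_bounded _ ((\sum_(k <- S) normc (c k)) ^+ 2)).
- congr EFin; apply: (@complexI R); rewrite -torus_integral_real.
  under eq_torus_integral do rewrite -mul_conj.
  rewrite torus_integral_mul_conj_tpoly; last exact: cint_tpoly.
  rewrite rmorph_sum; apply: eq_big_seq => k kS.
  by rewrite fcoef_tpoly// kS mulrC mul_conj.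
- by apply: measurable_funX; apply: cmeas_normc; exact: cmeas_tpoly.
- move=> x; rewrite normrX ler_sqr ?nnegrE//; last by apply: sumr_ge0 => k _; exact: normc_ge0.
  by rewrite ger0_norm ?normc_ge0// normc_tpoly_le.
Qed.

Lemma cint_sqr f : cmeas f -> (\int[mu]_x (normc (f x) ^+ 2)%:E < +oo)%E -> cint f.
Proof.
move=> mf fi; apply: (@cint_le _ _ _ (fun x => 1%:E + (normc (f x) ^+ 2)%:E)%E) => //.
- by apply: emeasurable_funD => //; exact: cmeas_normc2.
- rewrite ge0_integralD//=; last 2 first.
  + by move=> x _; rewrite lee_fin sqr_ge0.
  + exact: cmeas_normc2.
  rewrite integral_cst//= mul1e lte_add_pinfty//.
  by rewrite (le_lt_trans (probability_le1 _ _))// ltry.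
- move=> x; rewrite -EFinD lee_fin; have := normc_ge0 (f x); nra.
Qed.

(** With [T] the partial Fourier sum over [S], integrate [2 Re (f conj T) <= |f|^2 + |T|^2]: the
    integrals of [Re (f conj T)] and of [|T|^2] both equal the sum on the left. An infinite
    right-hand side is split off first, since only a square integrable [f] is known to be
    integrable. *)
Lemma bessel f S : cmeas f -> uniq S ->
  ((\sum_(k <- S) normc (fcoef f k) ^+ 2)%:E <= \int[mu]_x (normc (f x) ^+ 2)%:E)%E.
Proof.
move=> mf uS; have [->|] := eqVneq (\int[mu]_x (normc (f x) ^+ 2)%:E)%E +oo%E; first by rewrite leey.
rewrite -ltey => fi; have fint := cint_sqr mf fi.
set T := tpoly S (fcoef f).
have pT : (\int[mu]_x (normc (T x) ^+ 2)%:E = (\sum_(k <- S) normc (fcoef f k) ^+ 2)%:E)%E.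
  exact: parseval_tpoly.
have iT : cint (fun x => f x * ((T x)^*)%C).
  apply: (@cintMr _ _ _ _ (\sum_(k <- S) normc (fcoef f k))) => //.
    by apply: cmeas_conj; exact: cmeas_tpoly.
  by move=> x; rewrite normc_conj normc_tpoly_le.
have cross : (\int[mu]_x (complex.Re (f x * ((T x)^*)%C))%:E =
    (\sum_(k <- S) normc (fcoef f k) ^+ 2)%:E)%E.
  have := torus_integral_mul_conj_tpoly S (fcoef f) fint; rewrite -/T => E.
  have : complex.Re (torus_integral (fun x => f x * ((T x)^*)%C)) = \sum_(k <- S) normc (fcoef f k) ^+ 2.
    rewrite E; transitivity (complex.Re ((\sum_(k <- S) normc (fcoef f k) ^+ 2)%:C%C)); last by [].
    by congr complex.Re; rewrite rmorph_sum; apply: eq_bigr => k _; rewrite mulrC mul_conj.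
  rewrite /torus_integral/= => <-; rewrite /Rintegral fineK//.
  by apply: integrable_fin_num => //; exact: cint_Re.
have pw : (2%:E * \int[mu]_x (complex.Re (f x * ((T x)^*)%C))%:E <=
    \int[mu]_x (normc (f x) ^+ 2)%:E + \int[mu]_x (normc (T x) ^+ 2)%:E)%E.
  rewrite -ge0_integralD//; last 4 first.
  - by move=> x _; rewrite lee_fin sqr_ge0.
  - exact: cmeas_normc2.
  - by move=> x _; rewrite lee_fin sqr_ge0.
  - by apply: cmeas_normc2; exact: cmeas_tpoly.
  rewrite -integralZl//; last exact: cint_Re.
  apply: le_integral => //=.
  - by apply: integrableZl => //; exact: cint_Re.
  - apply/integrableP; split.
      by apply: emeasurable_funD; apply: cmeas_normc2 => //; exact: cmeas_tpoly.
    under eq_integral do rewrite gee0_abs -?EFinD ?lee_fin ?addr_ge0 ?sqr_ge0// EFinD.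
    rewrite ge0_integralD//=.
    + by rewrite lte_add_pinfty// pT ltry.
    + by move=> x _; rewrite lee_fin sqr_ge0.
    + exact: cmeas_normc2.
    + by move=> x _; rewrite lee_fin sqr_ge0.
    + by apply: cmeas_normc2; exact: cmeas_tpoly.
  - move=> x _; rewrite -EFinM -EFinD lee_fin Re_mul !normc_sqr.
    case: (f x) (T x) => a b [u v] /=.
    by have := sqr_ge0 (a - u); have := sqr_ge0 (b - v); nra.
move: pw; rewrite cross pT.
case: (\int[mu]_x (normc (f x) ^+ 2)%:E)%E => [A||]; rewrite ?leey//.
by rewrite -EFinM -EFinD !lee_fin; lra.
Qed.

End torus_exponentials.

(** * Uniqueness of Fourier coefficients *)

Section coordinate_marginals.
Variable R : realType.

Lemma integral_probability_cst dT (T : measurableType dT) (P : probability T R) (c : \bar R) :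
  (\int[P]_x c = c)%E.
Proof.
rewrite [LHS](@integral_cst _ _ _ P setT measurableT c).
by rewrite [X in (_ * X)%E](probability_setT P) mule1.
Qed.

Lemma integral_torus_cst d (c : \bar R) : (\int[torus_measure R d]_x c = c)%E.
Proof. exact: integral_probability_cst. Qed.

Lemma ge0_integral_coord d (i : 'I_d) (h : measurableTypeR R -> \bar R) :
  measurable_fun setT h -> (forall t, 0 <= h t)%E ->
  (\int[torus_measure R d]_x h (tnth x i) = \int[uniform_prob (twopi_gt0 R)]_t h t)%E.
Proof.
move=> mh h0; elim: d i => [[]//|d IH] i.
rewrite ge0_integral_torusS//; last by apply: (measurableT_comp mh); exact: measurable_tnth.
case: (unliftP ord0 i) => [j|] ->.
  under eq_integral => u _ do under eq_integral do rewrite tnthS.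
  under eq_integral => u _ do rewrite IH.
  exact: integral_probability_cst.
apply: eq_integral => u _.
under eq_integral do rewrite tnth0.
exact: (integral_torus_cst d (h u)).
Qed.

(** Each coordinate is uniformly distributed on [[0, 2 * pi]], so exceptional sets can be checked in
    dimension one. *)
Lemma ae_coord d (i : 'I_d) (B : set (measurableTypeR R)) : measurable B ->
  lebesgue_measure (B `&` `[0, 2 * pi]) = 0%E ->
  {ae torus_measure R d, forall x, ~ B (tnth x i)}.
Proof.
move=> mB B0.
have mi : measurable [set x : point R d | B (tnth x i)].
  by rewrite -[X in measurable X]setTI; exact: (measurable_tnth (T := measurableTypeR R) i measurableT).
exists [set x | B (tnth x i)]; split => //; last by move=> x /= /contrapT.
rewrite -[LHS]/(torus_measure R d _) -[[set x | _]]setIT -integral_indic//.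
transitivity (\int[torus_measure R d]_x ((\1_B (tnth x i : measurableTypeR R)) : R)%:E)%E.
  by apply: eq_integral => x _; rewrite !indicE; congr (_%:R%:E); apply/idP/idP; rewrite !inE.
have mB1 : measurable_fun setT (fun t : measurableTypeR R => (\1_B t : R)%:E).
  exact/measurable_EFinP/measurable_indic.
rewrite (@ge0_integral_coord _ i (fun t => (\1_B t)%:E))// integral_uniform//.
by rewrite [X in (_ * X)%E](_ : _ = 0%E) ?mule0// integral_indic//.
Qed.

End coordinate_marginals.

Lemma ae_imp dT (T : measurableType dT) (R : realType) (m : {measure set T -> \bar R}) (P Q : T -> Prop) :
  {ae m, forall x, P x} -> (forall x, P x -> Q x) -> {ae m, forall x, Q x}.
Proof.
move=> [N [mN N0 sN]] PQ; exists N; split => // x /= nQ; apply: sN => /= Px.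
exact: nQ (PQ x Px).
Qed.

Section trigonometric_functions.
Variables (R : realType) (d : nat).
Local Notation mu := (torus_measure R d).
Local Notation freq := {ffun 'I_d -> int}.
Implicit Types (T U : point R d -> R[i]).

(** Frequencies may repeat in the list, so that sums and products are plain concatenation and
    pairwise products. *)
Definition trig T := exists s : seq (R[i] * freq),
  forall x, T x = \sum_(a <- s) a.1 * expo a.2 x.

Lemma trig_expo (k : freq) : trig (expo k).
Proof. by exists [:: (1, k)] => x; rewrite big_seq1 mul1r. Qed.

Lemma trig_cst z : trig (fun=> z).
Proof. by exists [:: (z, 0)] => x; rewrite big_seq1 expo0 mulr1. Qed.

Lemma trigD T U : trig T -> trig U -> trig (fun x => T x + U x).
Proof. by move=> [s hs] [t ht]; exists (s ++ t) => x; rewrite big_cat hs ht. Qed.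

Lemma trigM T U : trig T -> trig U -> trig (fun x => T x * U x).
Proof.
move=> [s hs] [t ht]; exists [seq (a.1 * b.1, a.2 + b.2) | a <- s, b <- t] => x.
rewrite hs ht big_allpairs_dep mulr_suml; apply: eq_bigr => a _.
by rewrite mulr_sumr; apply: eq_bigr => b _ /=; rewrite expoD mulrACA.
Qed.

Lemma trigB T U : trig T -> trig U -> trig (fun x => T x - U x).
Proof.
move=> hT hU; have := trigD hT (trigM (trig_cst (-1)) hU).
by under eq_fun do rewrite mulN1r.
Qed.

Lemma trigX T n : trig T -> trig (fun x => T x ^+ n).
Proof.
move=> hT; elim: n => [|n IH]; first by under eq_fun do rewrite expr0; exact: trig_cst.
by under eq_fun do rewrite exprS; exact: trigM.
Qed.

Lemma trig_cos (i : 'I_d) (b : R) : trig (fun x => (cos (tnth x i - b))%:C%C).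
Proof.
pose k (z : int) : freq := [ffun j => if j == i then z else 0].
have ek z x : expo (k z) x = e1 z (tnth x i) :> R[i].
  rewrite /expo (bigD1 i)//= ffunE eqxx big1 ?mulr1// => j ji.
  by rewrite ffunE (negbTE ji) e1_0.
have : trig (fun x => 2^-1 * (e1 1 (- b) * expo (k 1) x + e1 (-1) (- b) * expo (k (-1)) x)).
  apply: trigM; first exact: trig_cst.
  by apply: trigD; apply: trigM; (exact: trig_cst || exact: trig_expo).
congr trig; apply/funext => x; rewrite !ek -!e1_addt !(addrC (- b)) e1_conj.
apply: (@mulfI _ 2); rewrite ?pnatr_eq0// mulrA divff ?pnatr_eq0// mul1r addcJ.
by rewrite /e1/= mul1r.
Qed.

Lemma torus_integral_mul_trig f T : cint f -> (forall k, fcoef f k = 0) -> trig T ->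
  torus_integral (fun x => f x * T x) = 0.
Proof.
move=> fi f0 [s hs].
under eq_torus_integral.
  move=> x; rewrite hs mulr_sumr.
  under eq_bigr do rewrite mulrCA.
  over.
rewrite torus_integral_sum; last by move=> k; apply: cintZ; exact: cint_mul_expo.
rewrite big1// => a _; rewrite torus_integralZ; last exact: cint_mul_expo.
by have := f0 (- a.2); rewrite /fcoef opprK => ->; rewrite mulr0.
Qed.

Lemma cmeas_trig T : trig T -> cmeas T.
Proof.
move=> [s hs]; rewrite (_ : T = fun x => \sum_(a <- s) a.1 * expo a.2 x); last exact/funext.
by apply: cmeas_sum => a; apply: cmeasM; [exact: cmeas_cst|exact: cmeas_expo].
Qed.

(** Multiplying approximants makes these sets a pi-system, and the bounds by 0 and 1 make dominated
    convergence available. *)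
Definition trig_approx (A : set (point R d)) := measurable A /\
  exists tau : nat -> point R d -> R,
  [/\ forall n, trig (fun x => (tau n x)%:C%C),
      forall n x, 0 <= tau n x <= 1 &
      {ae mu, forall x, (tau n x @[n --> \oo] --> (\1_A x : R))}].

Lemma trig_approxI : setI_closed trig_approx.
Proof.
move=> A B [mA [s [st s01 sA]]] [mB [t [tt t01 tB]]]; split; first exact: measurableI.
exists (fun n x => s n x * t n x); split.
- by move=> n; under eq_fun do rewrite rmorphM/=; exact: trigM.
- move=> n x; have /andP[? ?] := s01 n x; have /andP[? ?] := t01 n x.
  by rewrite mulr_ge0//= mulr_ile1.
- apply: filterS2 sA tB => x sx tx; rewrite indicI.
  exact: cvgM.
Qed.

Lemma trig_approx_cst (b : bool) A : measurable A -> {ae mu, forall x, (x \in A) = b} -> trig_approx A.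
Proof.
move=> mA Ab; split => //; exists (fun _ _ => b%:R); split => //.
- by move=> n; exact: trig_cst.
- by move=> n x; case: b {Ab}; rewrite ?lexx ler01.
- by apply: filterS Ab => x Ax; rewrite indicE Ax; exact: cvg_cst.
Qed.

End trigonometric_functions.

Section uniqueness.
Variables (R : realType) (d : nat).
Local Notation mu := (torus_measure R d).

Lemma bernoulli_le (x : R) (N : nat) : 0 <= x <= 1 -> 1 - N%:R * x <= (1 - x) ^+ N.
Proof.
move=> /andP[x0 x1]; elim: N => [|N IH]; first by rewrite mul0r subr0 expr0.
rewrite exprS; apply: (@le_trans _ _ ((1 - x) * (1 - N%:R * x))).
  by rewrite -natr1; have : 0 <= N%:R :> R by []; nra.
by rewrite ler_wpM2l// subr_ge0.
Qed.

Lemma expr_1B_le (x : R) (N : nat) : 0 <= x <= 1 -> (1 - x) ^+ N * (1 + N%:R * x) <= 1.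
Proof.
move=> /andP[x0 x1]; elim: N => [|N IH]; first by rewrite mul0r addr0 expr0 mulr1.
apply: le_trans IH; rewrite exprS mulrAC mulrC ler_wpM2l ?exprn_ge0 ?subr_ge0//.
by rewrite -natr1; have : 0 <= N%:R :> R by []; nra.
Qed.

(* The exponents are chosen so that [2 ^ n * q ^ n] tends to [0] or to infinity according as [q < 1 / 2] or [q > 1 / 2]. *)
Lemma threshold_cvg (q : R) : 0 <= q <= 1 -> q != 2^-1 ->
  (1 - q ^+ n) ^+ (2 ^ n) @[n --> \oo] --> ((q < 2^-1)%R%:R : R).
Proof.
move=> /andP[q0 q1] qneq.
have qn n : 0 <= q ^+ n <= 1 by rewrite exprn_ge0// exprn_ile1.
have Nq n : (2 ^ n)%:R * q ^+ n = (2 * q) ^+ n :> R by rewrite natrX exprMn.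
case: ltrP => /= qh.
  apply: (@squeeze_cvgr _ _ _ _ (fun n => 1 - (2 * q) ^+ n) (fun=> 1)).
  - near=> n; rewrite -Nq bernoulli_le//=; have /andP[a b] := qn n.
    by rewrite exprn_ile1//; lra.
  - rewrite -[X in _ --> X]subr0; apply: cvgB; first exact: cvg_cst.
    by apply: cvg_expr; rewrite ger0_norm; lra.
  - exact: cvg_cst.
have {}qh : 2^-1 < q by rewrite lt_neqAle eq_sym qneq.
apply: (@squeeze_cvgr _ _ _ _ (fun=> 0) (fun n => ((2 * q)^-1) ^+ n)).
- near=> n; have /andP[a b] := qn n; rewrite exprn_ge0/= ?subr_ge0//.
  have := @expr_1B_le (q ^+ n) (2 ^ n) (qn n); rewrite Nq exprVn => h.
  have q2 : 0 < (2 * q) ^+ n by rewrite exprn_gt0//; lra.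
  rewrite -[leRHS]mul1r ler_pdivlMr//; apply: le_trans h.
  by rewrite ler_wpM2l ?exprn_ge0 ?subr_ge0// lerDr.
- exact: cvg_cst.
- apply: cvg_expr; rewrite ger0_norm ?invr_ge0 ?invf_lt1; lra.
Unshelve. all: by end_near. Qed.

(** For [0 < a < 2 * pi], an affine function [q] of [cos (t - a / 2)] is above 1/2 on []0, a[] and
    below 1/2 on []a, 2 * pi[]. The polynomials [(1 - q^n)^(2^n)] then converge to the indicator of
    [a < t] off the null set where [q = 1/2]. *)
Lemma trig_approx_halfspace (i : 'I_d) (a : R) :
  @trig_approx R d [set x | a < tnth x i].
Proof.
have mA (b : R) : measurable [set x : point R d | b < tnth x i].
  rewrite (_ : [set x | _] = (fun x : point R d => tnth x i : measurableTypeR R) @^-1` `]b, +oo[).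
    rewrite -[X in measurable X]setTI.
    by apply: (measurable_tnth (T := measurableTypeR R) i measurableT); exact: measurable_itv.
  by apply/seteqP; split=> x /=; rewrite in_itv/= andbT.
have null (B : set (measurableTypeR R)) : B `<=` [set 0; a; 2 * pi] -> lebesgue_measure B = 0%E.
  move=> Bs; apply: countable_lebesgue_measure0.
  by apply: (sub_countable (subset_card_le Bs)); apply: finite_set_countable; rewrite !finite_setU; do !split; exact: finite_set1.
have pi2 := twopi_gt0 R.
have in02 : {ae mu, forall x : point R d, [/\ 0 < (tnth x i : R), (tnth x i : R) < 2 * pi & tnth x i != a :> R]}.
  have mB : measurable (~` `]0%R, 2 * pi[ `|` [set a] : set (measurableTypeR R)).
    by apply: measurableU; [apply: measurableC; exact: measurable_itv|exact: measurable_set1].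
  have B0 : lebesgue_measure ((~` `]0%R, 2 * pi[ `|` [set a]) `&` `[0, 2 * pi]) = 0%E.
    apply: null => t /= [[tB|->] ]; last by move=> _; left; right.
    rewrite in_itv/= => /andP[t0 t1]; move: tB; rewrite in_itv/= => /negP; rewrite negb_and -!leNgt.
    by move=> /orP[t0'|t1']; [left; left; lra|right; lra].
  have := ae_coord i mB B0; move/ae_imp; apply => x /= /not_orP[].
  by move=> /contrapT; rewrite in_itv/= => /andP[? ?] /eqP; split.
(* Up to a null set, the cube lies inside the half-space if [a <= 0] and outside it if
   [a >= 2 * pi]. *)
have [a0|a0] := leP a 0.
  apply: (@trig_approx_cst _ _ true _ (mA a)). apply: (ae_imp in02) => x [x0 _ _].
  by apply/idP; rewrite inE/=; lra.
have [a2|a2] := leP (2 * pi) a.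
  apply: (@trig_approx_cst _ _ false _ (mA a)); apply: (ae_imp in02) => x [_ x1 _].
  by apply/negbTE/negP; rewrite inE/=; lra.
split => //.
(* The difference of cosines is at most 2 in modulus, so dividing by 4 keeps [q] in [[0, 1]]; it
   vanishes at [t = 0] and [t = a]. *)
pose q (t : R) := 2^-1 + (cos (t - a / 2) - cos (a / 2)) / 4.
have q01 t : 0 <= q t <= 1.
  have := cos_geN1 (t - a / 2); have := cos_le1 (t - a / 2).
  by have := cos_geN1 (a / 2); have := cos_le1 (a / 2); rewrite /q; move=> *; apply/andP; split; lra.
exists (fun n x => (1 - q (tnth x i) ^+ n) ^+ (2 ^ n)); split.
- move=> n; under eq_fun do rewrite rmorphXn rmorphB rmorphXn/= rmorph1.
  apply: trigX; apply: trigB; first exact: trig_cst.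
  apply: trigX; rewrite /q.
  under eq_fun do rewrite rmorphD rmorphM rmorphB/=.
  apply: trigD; first exact: trig_cst.
  by apply: trigM; [apply: trigB; [exact: trig_cos|exact: trig_cst]|exact: trig_cst].
- move=> n x; have /andP[h0 h1] := q01 (tnth x i).
  by rewrite exprn_ge0/= ?exprn_ile1// ?subr_ge0 ?gerBl ?exprn_ge0// exprn_ile1.
- apply: (ae_imp in02) => x; set t : R := tnth x i => -[t0 t2 ta].
  have qE : q t = 2^-1 + sin (t / 2) * sin ((a - t) / 2) / 2.
    have e1 : t - a / 2 = t / 2 - (a - t) / 2 by field.
    have e2 : a / 2 = t / 2 + (a - t) / 2 by field.
    by rewrite /q e1 [in cos (a / 2)]e2 cosB cosD; field.
  have st : 0 < sin (t / 2) by apply: sin_gt0_pi; apply/andP; split; lra.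
  have qa : (q t < 2^-1) = (a < t).
    rewrite qE; case: (ltgtP a t) => at_.
    - have : 0 < sin ((t - a) / 2) by apply: sin_gt0_pi; apply/andP; split; lra.
      have -> : (a - t) / 2 = - ((t - a) / 2) by field.
      by rewrite sinN => s0; apply/idP; nra.
    - have s0 : 0 < sin ((a - t) / 2) by apply: sin_gt0_pi; apply/andP; split; lra.
      by apply/negbTE; rewrite -leNgt; nra.
    - by move: ta; rewrite at_ eqxx.
  have qneq : q t != 2^-1.
    rewrite qE; apply/eqP => h.
    have {}h : sin (t / 2) * sin ((a - t) / 2) = 0 by lra.
    move/eqP: h; rewrite mulf_eq0 gt_eqF//= => /eqP s0.
    case: (ltgtP a t) => at_.
    - have : 0 < sin ((t - a) / 2) by apply: sin_gt0_pi; apply/andP; split; lra.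
      have -> : (t - a) / 2 = - ((a - t) / 2) by field.
      by rewrite sinN s0; lra.
    - have : 0 < sin ((a - t) / 2) by apply: sin_gt0_pi; apply/andP; split; lra.
      by rewrite s0; lra.
    - by move: ta; rewrite at_ eqxx.
  have := threshold_cvg (q01 t) qneq; rewrite qa indicE.
  by have -> : (x \in [set x0 | a < tnth x0 i]) = (a < t) by apply/idP/idP; rewrite inE.
Qed.

(** The half-spaces [a < tnth x i] already generate the product sigma-algebra. *)
Lemma measurable_trig_approx : @measurable _ (point R d) = <<s @trig_approx R d >>.
Proof.
apply/seteqP; split; last first.
  by apply: smallest_sub; [exact: sigma_algebra_measurable|move=> A []].
apply: smallest_sub; first exact: smallest_sigma_algebra.
move=> A; rewrite -bigcup_seq/= => -[i _ [B mB <-]].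
pose aT := g_sigma_algebraType (@trig_approx R d).
have : measurable_fun setT ((fun x : point R d => tnth x i) : aT -> measurableTypeR R).
  apply: (@measurability _ _ _ _ _ _ (@RGenOInfty.G R)); first exact: RGenOInfty.measurableE.
  move=> _ [_ [a ->] <-]; rewrite setTI; apply: sub_sigma_algebra.
  rewrite (_ : _ @^-1` _ = [set x | a < tnth x i]); first exact: trig_approx_halfspace.
  by apply/seteqP; split=> x /=; rewrite in_itv/= andbT.
by move=> /(_ measurableT B mB).
Qed.

Lemma integral_trig_approx (u : point R d -> R) A : mu.-integrable setT (EFin \o u) ->
  (forall tau : point R d -> R, trig (fun x => (tau x)%:C%C) -> (\int[mu]_x (u x * tau x)%:E = 0)%E) ->
  trig_approx A -> (\int[mu]_(x in A) (u x)%:E = 0)%E.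
Proof.
move=> ui u0 [mA [tau [tt t01 tA]]].
have mu' : measurable_fun setT u by case/integrableP: ui => /measurable_EFinP.
have mt n : measurable_fun setT (tau n) by case: (cmeas_trig (tt n)).
rewrite integral_mkcond.
have mA' : measurable_fun setT ((EFin \o u) \_ A).
  by apply/(measurable_restrictT _ mA); apply: measurable_funTS; exact/measurable_EFinP.
have cv : {ae mu, forall x, setT x -> (u x * tau n x)%:E @[n --> \oo] --> ((EFin \o u) \_ A) x}.
  apply: (ae_imp tA) => x cx _; rewrite restrict_EFin/= patch_indic.
  apply: cvg_EFin; first exact: nearW.
  by apply: cvgM => //; exact: cvg_cst.
have dom : {ae mu, forall x (n : nat), setT x -> (`|(u x * tau n x)%:E| <= `|(u x)%:E|)%E}.
  apply: aeW => x n _; rewrite lee_fin normrM ler_piMr//.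
  by have /andP[? ?] := t01 n x; rewrite ger0_norm.
have [|_ _] := dominated_convergence measurableT _ mA' cv (integrable_abse ui) dom.
  by move=> n; apply/measurable_EFinP; exact: measurable_funM.
under eq_fun do rewrite u0//.
by move=> /(cvg_lim (@ereal_hausdorff R)) <-; rewrite lim_cst.
Qed.

(** Real and imaginary parts are orthogonal to all real trigonometric polynomials, hence have
    integral 0 over every set of the pi-system [trig_approx]. Dynkin's theorem extends this to all
    measurable sets, and such a function vanishes a.e. *)
Lemma fcoef_eq0_ae (f : point R d -> R[i]) : cint f -> (forall k, fcoef f k = 0) ->
  {ae mu, forall x, f x = 0}.
Proof.
move=> fi f0.
have key (u : point R d -> R) : mu.-integrable setT (EFin \o u) ->
    (forall tau : point R d -> R, trig (fun x => (tau x)%:C%C) -> (\int[mu]_x (u x * tau x)%:E = 0)%E) ->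
    {ae mu, forall x, u x = 0}.
  move=> ui u0.
  have uT : (\int[mu]_x (u x)%:E = 0)%E.
    have := u0 (fun=> 1) (trig_cst _ _).
    by under eq_integral do rewrite mulr1.
  have uA A : measurable A -> (\int[mu]_(x in A) (u x)%:E = 0)%E.
    rewrite [in X in X -> _]measurable_trig_approx.
    move: A; apply: (dynkin_induction (P := fun A => (\int[mu]_(x in A) (u x)%:E = 0)%E) measurable_trig_approx).
    - exact: trig_approxI.
    - exact: uT.
    - by move=> A; exact: integral_trig_approx.
    - move=> A mA A0; have : (\int[mu]_(x in A `|` ~` A) (u x)%:E = 0)%E.
        by rewrite setUv uT.
      rewrite integral_setU//; first by rewrite A0 add0e.
      + exact: measurableC.
      + by rewrite setUv; case/integrableP: ui.
      + by apply/disj_setPCl.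
    - move=> F mF tF F0; rewrite integral_bigcup//; first by rewrite eseries0.
      by apply: integrableS ui => //; exact: bigcupT_measurable.
  have := @integral_ae_eq _ _ _ mu setT measurableT (cst 0%E) (EFin \o u) ui (measurable_cst _).
  move=> /(_ _)/ae_imp; apply; last by move=> x /(_ I) [].
  by move=> E _ mE; rewrite integral0 uA.
have orth tau : trig (fun x => (tau x)%:C%C) ->
    (\int[mu]_x (complex.Re (f x) * tau x)%:E = 0)%E /\ (\int[mu]_x (complex.Im (f x) * tau x)%:E = 0)%E.
  move=> tt; have := torus_integral_mul_trig fi f0 tt.
  have [s hs] := tt.
  have ci : cint (fun x => f x * (tau x)%:C%C).
    apply: (@cintMr _ _ _ _ (\sum_(a <- s) normc a.1)) => //; first exact: cmeas_trig.
    move=> x; rewrite hs (le_trans (normc_sum _ _ _))//; apply: ler_sum => a _.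
    by rewrite Normc.normcM normc_expo mulr1.
  have eR x : complex.Re (f x) * tau x = complex.Re (f x * (tau x)%:C%C) by rewrite Re_mul/= mulr0 subr0.
  have eI x : complex.Im (f x) * tau x = complex.Im (f x * (tau x)%:C%C) by rewrite Im_mul/= mulr0 add0r.
  have fr := integrable_fin_num measurableT (cint_Re ci).
  have fim := integrable_fin_num measurableT (cint_Im ci).
  rewrite /torus_integral /Rintegral => -[hr hi].
  under eq_integral do rewrite eR.
  under [X in _ /\ X = _]eq_integral do rewrite eI.
  by rewrite -(fineK fr) -(fineK fim) hr hi.
have hr := key _ (cint_Re fi) (fun tau tt => (orth tau tt).1).
have hi := key _ (cint_Im fi) (fun tau tt => (orth tau tt).2).
apply: filterS2 hr hi => x; case: (f x) => a b /= -> ->; exact: erefl.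
Qed.

End uniqueness.

(** * De la Vallee Poussin kernels *)

Section boxes.
Variable d : nat.

Definition box (N : nat) : seq (d.-tuple nat) :=
  [seq [tuple (f i : nat) | i < d] | f : {ffun 'I_d -> 'I_N}].

Lemma mem_box N (s : d.-tuple nat) : (s \in box N) = [forall i, (tnth s i < N)%N].
Proof.
apply/mapP/forallP => [[f _ ->] i|h]; first by rewrite tnth_mktuple.
exists [ffun i => Ordinal (h i)]; first by rewrite mem_enum.
by apply: eq_from_tnth => i; rewrite tnth_mktuple ffunE.
Qed.

Lemma box_uniq N : uniq (box N).
Proof.
rewrite map_inj_uniq ?enum_uniq// => f g fg; apply/ffunP => i; apply/val_inj.
by have := congr1 (fun s : d.-tuple nat => tnth s i) fg; rewrite !tnth_mktuple.
Qed.

Lemma sub_box N M : (N <= M)%N -> {subset box N <= box M}.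
Proof.
by move=> NM s; rewrite !mem_box => /forallP h; apply/forallP => i; exact: leq_trans (h i) NM.
Qed.

(** The kernels and overlap counts below are products over the coordinates, so this and its integer
    analogue reduce their sums to dimension one. *)
Lemma sum_box_prod (R : comPzSemiRingType) N (F : 'I_d -> nat -> R) :
  \sum_(s <- box N) \prod_i F i (tnth s i) = \prod_i \sum_(j < N) F i j.
Proof.
rewrite big_image/= bigA_distr_bigA/=; apply: eq_bigr => f _.
by apply: eq_bigr => i _; rewrite tnth_mktuple.
Qed.

Definition boxZ (n : nat) : seq {ffun 'I_d -> int} :=
  [seq [ffun i => (tnth s i)%:Z - n%:Z] | s <- box (2 * n).+1].

Lemma mem_boxZ n (k : {ffun 'I_d -> int}) : (k \in boxZ n) = [forall i, (`|k i| <= n)%N].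
Proof.
apply/mapP/forallP => [[s + ->] i|h].
  by rewrite mem_box => /forallP/(_ i); rewrite ffunE; lia.
exists [tuple absz (k i + n%:Z) | i < d].
  by rewrite mem_box; apply/forallP => i; rewrite tnth_mktuple; have := h i; lia.
apply/ffunP => i; rewrite ffunE tnth_mktuple; move: (h i); move: (k i) => j; lia.
Qed.

Lemma boxZ_uniq n : uniq (boxZ n).
Proof.
rewrite map_inj_in_uniq ?box_uniq// => s t _ _ st; apply: eq_from_tnth => i.
by have := congr1 (fun f : {ffun 'I_d -> int} => f i) st; rewrite !ffunE => /addIr [].
Qed.

Definition ballZ (n : nat) : seq int := [seq l%:Z - n%:Z | l <- iota 0 (2 * n).+1].

Lemma mem_ballZ n (j : int) : (j \in ballZ n) = (`|j| <= n)%N.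
Proof.
apply/mapP/idP => [[l + ->]|jn]; first by rewrite mem_iota; lia.
by exists (absz (j + n%:Z)); rewrite ?mem_iota; lia.
Qed.

Lemma ballZ_uniq n : uniq (ballZ n).
Proof. by rewrite map_inj_uniq ?iota_uniq// => i j; lia. Qed.

Lemma sum_boxZ_prod (R : comPzSemiRingType) n (F : 'I_d -> int -> R) :
  \sum_(k <- boxZ n) \prod_i F i (k i) = \prod_i \sum_(j <- ballZ n) F i j.
Proof.
transitivity (\sum_(s <- box (2 * n).+1) \prod_i F i ((tnth s i)%:Z - n%:Z)).
  by rewrite big_map; apply: eq_bigr => s _; apply: eq_bigr => i _; rewrite ffunE.
rewrite (sum_box_prod _ (fun i (l : nat) => F i (l%:Z - n%:Z))).
apply: eq_bigr => i _; rewrite [RHS]big_map.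
by rewrite -(big_mkord xpredT (fun l : nat => F i (l%:Z - n%:Z))) /index_iota subn0.
Qed.

Lemma sum_ballZ_widen (V : nmodType) n m (F : int -> V) : (n <= m)%N ->
  (forall j, (n < `|j|)%N -> F j = 0) -> \sum_(j <- ballZ n) F j = \sum_(j <- ballZ m) F j.
Proof.
move=> nm F0; rewrite [RHS](bigID (fun j => j \in ballZ n))/= [X in _ = _ + X]big1 ?addr0; last first.
  by move=> j; rewrite mem_ballZ -ltnNge; exact: F0.
rewrite -[RHS]big_filter; apply: perm_big; apply: uniq_perm; rewrite ?filter_uniq ?ballZ_uniq//.
by move=> j; rewrite mem_filter !mem_ballZ; apply/idP/andP => [|[]//]; lia.
Qed.

End boxes.

Section vallee_poussin_kernels.
Variable R : realType.

(** The Fejer coefficient [max (N - |j|) 0], kept as the number of Dirichlet kernels [D_k], [k < N],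
    that contain the frequency [j]. *)
Definition fejc (N : nat) (j : int) : R := \sum_(0 <= k < N) ((`|j| <= k)%N)%:R.

(** The trapezoidal multiplier of [V_m]: 1 up to [m], then linear down to 0 at [2 m]. *)
Definition vpc (m : nat) (j : int) : R := m%:R^-1 * (fejc (2 * m) j - fejc m j).

Lemma fejc_small N j : (N <= `|j|)%N -> fejc N j = 0.
Proof.
move=> Nj; rewrite /fejc big_nat big1// => k /andP[_ kN].
by rewrite leqNgt (leq_trans kN Nj).
Qed.

Lemma fejc_le N j : 0 <= fejc N j <= N%:R.
Proof.
rewrite /fejc sumr_ge0//=.
have -> : N%:R = \sum_(0 <= k < N) 1 :> R by rewrite sumr_const_nat subn0.
by apply: ler_sum => k _; case: leqP.
Qed.

Lemma fejcD N M j : fejc (N + M) j - fejc N j = \sum_(N <= k < N + M) ((`|j| <= k)%N)%:R.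
Proof. by rewrite /fejc (big_cat_nat (leq0n N) (leq_addr M N))/= addrAC subrr add0r. Qed.

(** The convention [0^-1 = 0] makes [V_0] vanish, so [V_(2^s) - V_((2^s)./2)] is the block also for
    [s = 0]. *)
Lemma vpc0 j : vpc 0 j = 0.
Proof. by rewrite /vpc invr0 mul0r. Qed.

Lemma vpc_ge0 m j : 0 <= vpc m j.
Proof. by rewrite /vpc mul2n -addnn fejcD mulr_ge0// ?invr_ge0// sumr_ge0. Qed.

Lemma vpc_le1 m j : vpc m j <= 1.
Proof.
case: m => [|m]; first by rewrite vpc0 ler01.
rewrite /vpc ler_pdivrMl ?ltr0n// mulr1 mul2n -addnn fejcD.
have -> : m.+1%:R = \sum_(m.+1 <= k < m.+1 + m.+1) 1 :> R by rewrite sumr_const_nat addnK.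
by apply: ler_sum => k _; case: leqP.
Qed.

Lemma vpc_in m j : (0 < m)%N -> (`|j| <= m)%N -> vpc m j = 1.
Proof.
move=> m0 jm; rewrite /vpc mul2n -addnn fejcD big_nat (eq_bigr (fun=> 1)); last first.
  by move=> k /andP[mk _]; rewrite (leq_trans jm mk).
by rewrite -big_nat sumr_const_nat addnK mulVf// pnatr_eq0 -lt0n.
Qed.

Lemma vpc_out m j : (2 * m <= `|j|)%N -> vpc m j = 0.
Proof.
by move=> mj; rewrite /vpc !fejc_small ?subr0 ?mulr0//; lia.
Qed.

Lemma dirichlet_kernelE k n t : (k <= n)%N ->
  dirichlet_kernel k t = \sum_(j <- ballZ n) ((`|j| <= k)%N%:R : R)%:C%C * e1 j t.
Proof.
move=> kn; rewrite -(@sum_ballZ_widen _ k)//; last first.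
  by move=> j kj; rewrite leqNgt kj/= mul0r.
rewrite big_seq (eq_bigr (fun j => e1 j t)); last first.
  by move=> j; rewrite mem_ballZ => ->; rewrite mul1r.
rewrite -big_seq big_map /dirichlet_kernel /index_iota subn0; apply: eq_bigr => l _.
by rewrite /e1 rmorphB.
Qed.

(* The Fejer sum [\sum_(k < N) D_k] is the squared modulus of [\sum_(l < N) e^(ilt)]. *)
Definition fej (N : nat) (t : R) : R := normc (\sum_(0 <= l < N) e1 l%:Z t) ^+ 2.

Lemma fej_ge0 N t : 0 <= fej N t.
Proof. exact: sqr_ge0. Qed.

Lemma fej_le N t : fej N t <= N%:R ^+ 2.
Proof.
rewrite ler_sqr ?nnegrE ?normc_ge0// (le_trans (normc_sum _ _ _))//.
rewrite (eq_bigr (fun=> 1)); last by move=> l _; exact: normc_e1.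
by rewrite sumr_const_nat subn0.
Qed.

(** Expanding [|S + e_N|^2], the two cross terms are the frequencies [-N .. -1] and [1 .. N] of the
    Dirichlet kernel, and [|e_N|^2 = 1] is the frequency 0. *)
Lemma fejS N t : (fej N.+1 t)%:C%C = (fej N t)%:C%C + dirichlet_kernel N t.
Proof.
rewrite /fej -!mul_conj big_nat_recr//=; set S := \sum_(0 <= l < N) _.
rewrite rmorphD mulrDl !mulrDr -addrA; congr (_ + _).
rewrite mul_conj normc_e1 expr1n.
have hS : S * ((e1 N%:Z t)^*)%C = \sum_(0 <= l < N) e1 (l%:Z - N%:Z) t.
  by rewrite -e1_conj mulr_suml; apply: eq_bigr => l _; rewrite e1D.
have hS' : e1 N%:Z t * (S^*)%C = \sum_(0 <= l < N) e1 (l.+1)%:Z t.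
  rewrite (_ : (S^*)%C = \sum_(0 <= l < N) e1 (- l%:Z) t); last first.
    by rewrite rmorph_sum; apply: eq_bigr => l _; rewrite e1_conj.
  rewrite mulr_sumr big_nat_rev; apply: eq_big_nat => l /andP[_ lN].
  by rewrite -e1D; congr (e1 _ t); rewrite add0n -subzn// opprB addrC subrK.
rewrite hS hS' /dirichlet_kernel.
have sN : (N <= (2 * N).+1)%N by rewrite leqW// leq_pmull.
rewrite (big_cat_nat (leq0n N) sN)/=.
congr (_ + _); first by apply: eq_bigr => l _; rewrite /e1 rmorphB.
rewrite [RHS]big_ltn; last by rewrite ltnS leq_pmull.
rewrite subrr mul0r cos0 sin0 addrC; congr (_ + _).
have -> : (2 * N).+1 = (N + N.+1)%N by rewrite addnS mul2n addnn.
rewrite [RHS](big_addn 0 _ N.+1) addnK.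
apply: eq_bigr => l _; rewrite /e1 addnS -addSn natrD addrK.
by [].
Qed.


Lemma fejE N t : (fej N t)%:C%C = \sum_(0 <= k < N) dirichlet_kernel k t.
Proof.
elim: N => [|N IH]; last by rewrite fejS IH big_nat_recr.
by rewrite big_nil /fej big_nil Normc.normc0 expr0n.
Qed.

Lemma fej_expo N n t : (N <= n)%N ->
  (fej N t)%:C%C = \sum_(j <- ballZ n) (fejc N j)%:C%C * e1 j t.
Proof.
move=> Nn; rewrite fejE /fejc.
under [RHS]eq_bigr do rewrite rmorph_sum mulr_suml.
rewrite exchange_big; apply: eq_big_nat => k /andP[_ kN].
by apply: dirichlet_kernelE; exact: leq_trans (ltnW kN) Nn.
Qed.

Definition vp (m : nat) (t : R) : R := m%:R^-1 * (fej (2 * m) t - fej m t).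

(** Both Fejer sums are nonnegative, so this majorises [|vp m|], and its integral is simply its
    zeroth coefficient. *)
Definition vpmaj (m : nat) (t : R) : R := m%:R^-1 * (fej (2 * m) t + fej m t).

Lemma vallee_poussinE m t : vallee_poussin m t = (vp m t)%:C%C.
Proof.
rewrite /vallee_poussin /vp rmorphM rmorphB/= fmorphV/= rmorph_nat !fejE; congr (_ * _).
by rewrite (@big_cat_nat _ _ _ m 0 (2 * m))//= ?leq_pmull// addrAC subrr add0r.
Qed.

Lemma vp_expo m n t : (2 * m <= n)%N ->
  (vp m t)%:C%C = \sum_(j <- ballZ n) (vpc m j)%:C%C * e1 j t.
Proof.
move=> mn; rewrite /vp rmorphM rmorphB/= (@fej_expo _ n)// (@fej_expo m n); last by lia.
rewrite -sumrB mulr_sumr; apply: eq_bigr => j _.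
by rewrite /vpc rmorphM rmorphB/= -mulrBl mulrA.
Qed.

Lemma vpmaj_expo m n t : (2 * m <= n)%N -> (vpmaj m t)%:C%C =
  \sum_(j <- ballZ n) (m%:R^-1 * (fejc (2 * m) j + fejc m j))%:C%C * e1 j t.
Proof.
move=> mn; rewrite /vpmaj rmorphM rmorphD/= (@fej_expo _ n)// (@fej_expo m n); last by lia.
rewrite -big_split mulr_sumr; apply: eq_bigr => j _.
by rewrite rmorphM rmorphD/= -mulrDl mulrA.
Qed.

Lemma vpmaj_ge0 m t : 0 <= vpmaj m t.
Proof. by rewrite mulr_ge0 ?invr_ge0// addr_ge0 ?fej_ge0. Qed.

Lemma vp_le_maj m t : `|vp m t| <= vpmaj m t.
Proof.
rewrite normrM ger0_norm ?invr_ge0// ler_wpM2l ?invr_ge0// (le_trans (ler_normB _ _))//.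
by rewrite !ger0_norm ?fej_ge0.
Qed.

Lemma vpmaj_le m t : vpmaj m t <= 5 * m%:R.
Proof.
case: m => [|m]; first by rewrite /vpmaj invr0 mul0r mulr0.
rewrite ler_pdivrMl ?ltr0n// (le_trans (lerD (fej_le _ _) (fej_le _ _)))// natrM.
by rewrite exprMn; nra.
Qed.

Lemma vpmaj_coef0 m : m%:R^-1 * (fejc (2 * m) 0 + fejc m 0) <= 3 :> R.
Proof.
case: m => [|m]; first by rewrite invr0 mul0r.
rewrite ler_pdivrMl ?ltr0n//.
have /andP[_ h1] := fejc_le (2 * m.+1) 0; have /andP[_ h2] := fejc_le m.+1 0.
by rewrite natrM in h1; lra.
Qed.

End vallee_poussin_kernels.

Section product_kernels.
Variables (R : realType) (d : nat).
Local Notation mu := (torus_measure R d).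
Local Notation freq := {ffun 'I_d -> int}.
Implicit Types (A B : 'I_d -> nat) (k : freq) (x : point R d).

(** The dyadic blocks and the wider multipliers that reproduce them are both of this form, for
    different [A] and [B]. *)
Definition kcoef A B k : R := \prod_i (vpc R (A i) (k i) - vpc R (B i) (k i)).

Definition kern A B x : R := \prod_i (vp (A i) (tnth x i) - vp (B i) (tnth x i)).

Lemma kern_tpoly A B n x : (forall i, 2 * A i <= n)%N -> (forall i, 2 * B i <= n)%N ->
  (kern A B x)%:C%C = tpoly (boxZ d n) (fun k => (kcoef A B k)%:C%C) x.
Proof.
move=> An Bn; rewrite /tpoly /kern rmorph_prod.
under eq_bigr do rewrite rmorphB/= (@vp_expo _ _ n)// (@vp_expo _ _ n)// -sumrB.
rewrite -(sum_boxZ_prod n (fun i j => (vpc R (A i) j)%:C%C * e1 j (tnth x i) - (vpc R (B i) j)%:C%C * e1 j (tnth x i))).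
apply: eq_bigr => k _; rewrite /kcoef /expo rmorph_prod -big_split; apply: eq_bigr => i _.
by rewrite rmorphB/= mulrBl.
Qed.

Lemma kcoef_bound A B k : `|kcoef A B k| <= 1.
Proof.
rewrite normr_prod prodr_ile1// => i _; rewrite normr_ge0/=.
have h1 := vpc_ge0 R (A i) (k i); have h2 := vpc_ge0 R (B i) (k i).
have h3 := vpc_le1 R (A i) (k i); have h4 := vpc_le1 R (B i) (k i).
by rewrite ler_norml; apply/andP; split; lra.
Qed.

Lemma kern_le A B (M : 'I_d -> R) x : (forall i, 5 * (A i)%:R + 5 * (B i)%:R <= M i) ->
  `|kern A B x| <= \prod_i M i.
Proof.
move=> hM; rewrite normr_prod; apply: ler_prod => i _; rewrite normr_ge0/=.
apply: le_trans (hM i); rewrite (le_trans (ler_normB _ _))// lerD//.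
  by rewrite (le_trans (vp_le_maj _ _))// vpmaj_le.
by rewrite (le_trans (vp_le_maj _ _))// vpmaj_le.
Qed.

Lemma measurable_kern A B : measurable_fun setT (kern A B).
Proof.
pose n := (\sum_i (2 * A i + 2 * B i))%N.
have [h _] := @cmeas_tpoly R d (boxZ d n) (fun k => (kcoef A B k)%:C%C).
move: h; congr measurable_fun; apply/funext => x; rewrite -kern_tpoly//.
  by move=> i; rewrite /n (bigD1 i)//= -addnA leq_addr.
by move=> i; rewrite /n (bigD1 i)//= addnAC leq_addl.
Qed.

(** The product [M] of the majorants is a nonnegative trigonometric polynomial, so its integral is
    its coefficient at 0, at most [3 + 3] per coordinate. The bound does not depend on [A] and
    [B]. *)
Lemma kern_L1 A B : (\int[mu]_x `|kern A B x|%:E <= (6 ^+ d)%:E)%E.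
Proof.
pose n := (\sum_i (2 * A i + 2 * B i))%N.
have An i : (2 * A i <= n)%N by rewrite /n (bigD1 i)//= -addnA leq_addr.
have Bn i : (2 * B i <= n)%N by rewrite /n (bigD1 i)//= addnAC leq_addl.
pose mc i (j : int) : R := (A i)%:R^-1 * (fejc R (2 * A i) j + fejc R (A i) j) +
  (B i)%:R^-1 * (fejc R (2 * B i) j + fejc R (B i) j).
pose M x : R := \prod_i (vpmaj (A i) (tnth x i) + vpmaj (B i) (tnth x i)).
have ME x : (M x)%:C%C = tpoly (boxZ d n) (fun k => (\prod_i mc i (k i))%:C%C) x.
  rewrite /tpoly /M rmorph_prod.
  under eq_bigr do rewrite rmorphD/= (@vpmaj_expo _ _ n)// (@vpmaj_expo _ _ n)// -big_split.
  rewrite -(sum_boxZ_prod n (fun i j => (((A i)%:R^-1 * (fejc R (2 * A i) j + fejc R (A i) j))%:C%C * e1 j (tnth x i) +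
     ((B i)%:R^-1 * (fejc R (2 * B i) j + fejc R (B i) j))%:C%C * e1 j (tnth x i)))).
  apply: eq_bigr => k _; rewrite /expo rmorph_prod -big_split; apply: eq_bigr => i _.
  by rewrite /mc rmorphD/= mulrDl.
have mM : measurable_fun setT M.
  have [h _] := @cmeas_tpoly R d (boxZ d n) (fun k => (\prod_i mc i (k i))%:C%C).
  by move: h; congr measurable_fun; apply/funext => x; rewrite -ME.
have M0 x : 0 <= M x by apply: prodr_ge0 => i _; rewrite addr_ge0// vpmaj_ge0.
have bM x : `|M x| <= \sum_(k <- boxZ d n) normc ((\prod_i mc i (k i))%:C%C : R[i]).
  by rewrite -normc_real ME normc_tpoly_le.
apply: (@le_trans _ _ (\int[mu]_x (M x)%:E)%E).
  apply: ge0_le_integral => //=.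
  - by apply/measurable_EFinP; apply: measurableT_comp => //; exact: measurable_kern.
  - exact/measurable_EFinP.
  - move=> x _; rewrite lee_fin normr_prod; apply: ler_prod => i _; rewrite normr_ge0/=.
    by rewrite (le_trans (ler_normB _ _))// lerD// vp_le_maj.
rewrite (EFin_Rintegral_bounded mM bM) lee_fin -lecR -torus_integral_real.
have -> : torus_integral (fun x => (M x)%:C%C) = (\prod_i mc i 0)%:C%C.
  under eq_torus_integral do rewrite ME.
  have := @fcoef_tpoly R d (boxZ d n) (fun k => (\prod_i mc i (k i))%:C%C) 0 (boxZ_uniq d n).
  rewrite mem_boxZ ifT; last by apply/forallP => i; rewrite ffunE.
  rewrite /fcoef; under eq_torus_integral do rewrite oppr0 expo0 mulr1.
  by move=> ->; congr (_%:C%C); apply: eq_bigr => i _; rewrite ffunE.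
rewrite lecR -[X in _ ^+ X]card_ord -prodr_const; apply: ler_prod => i _.
have := vpmaj_coef0 R (A i); have := vpmaj_coef0 R (B i).
have /andP[a1 _] := fejc_le R (2 * A i) 0; have /andP[a2 _] := fejc_le R (A i) 0.
have /andP[b1 _] := fejc_le R (2 * B i) 0; have /andP[b2 _] := fejc_le R (B i) 0.
have ha : 0 <= (A i)%:R^-1 * (fejc R (2 * A i) 0 + fejc R (A i) 0) by rewrite mulr_ge0 ?invr_ge0// addr_ge0.
have hb : 0 <= (B i)%:R^-1 * (fejc R (2 * B i) 0 + fejc R (B i) 0) by rewrite mulr_ge0 ?invr_ge0// addr_ge0.
by rewrite /mc => h1 h2; apply/andP; split; lra.
Qed.

End product_kernels.

(** * Dyadic blocks *)

Section dyadic_blocks.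
Variable R : realType.

Definition alpha1 (s : nat) (j : int) : R := vpc R (2 ^ s) j - vpc R (2 ^ s)./2 j.

(** The first term is 1 up to [2^(s+1)] and the second vanishes from [2^(s-1)] on, so the difference
    is 1 wherever [alpha1 s] is not 0. For [s <= 1] the quotient is 0 and nothing is subtracted. *)
Definition beta1 (s : nat) (j : int) : R := vpc R (2 ^ s.+1) j - vpc R (2 ^ s %/ 4) j.

(** At most four scales [s] for each frequency, whence the powers of 4 below. *)
Definition inW (j : int) (s : nat) : bool :=
  (((trunc_log 2 `|j|).-1 <= s) && (s <= trunc_log 2 `|j| + 2))%N.

Lemma block1E s t : block1 s t = (vp (2 ^ s) t - vp (2 ^ s)./2 t : R)%:C%C.
Proof.
case: s => [|s]; rewrite /block1 !vallee_poussinE -?rmorphB//=.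
  by congr _%:C%C; rewrite [X in _ = _ - X](_ : _ = 0) ?subr0// /vp invr0 mul0r.
by congr (_ - vp _ _)%:C%C; rewrite expnS mul2n doubleK.
Qed.

(** A nonzero value forces [|j| < 2^(s+2)] and, if [2^s %/ 4] is positive, also [2^s %/ 4 < |j|];
    otherwise [s <= 1] and the upper end of the window is automatic. *)
Lemma beta1_window s j : beta1 s j != 0 -> inW j s.
Proof.
rewrite /beta1; case: (leqP (2 * 2 ^ s.+1) `|j|) => [h|jlt].
  rewrite !vpc_out ?subrr ?eqxx// (leq_trans _ h)// leq_mul2l/=.
  by rewrite (leq_trans (leq_div _ _))// leq_exp2l.
have tl : (0 < `|j|)%N -> (trunc_log 2 `|j| < s.+2)%N.
  move=> j0; have /andP[l1 _] := trunc_log_bounds (isT : (1 < 2)%N) j0.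
  by rewrite -(ltn_exp2l _ _ (isT : (1 < 2)%N)) (leq_ltn_trans l1)// expnS.
case: (posnP (2 ^ s %/ 4)) => [s4|s4] h.
  have s1 : (s <= 1)%N.
    rewrite leqNgt; apply/negP => s2; move: s4; rewrite -(subnKC s2) expnD mulKn//.
    by apply/eqP; rewrite -lt0n expn_gt0.
  rewrite /inW; apply/andP; split; last by lia.
  case: (posnP `|j|%N) => [->|j0]; first by [].
  have := tl j0.
  by lia.
have {h} jgt : (2 ^ s %/ 4 < `|j|)%N.
  rewrite ltnNge; apply/negP => jle; move/negP: h; apply.
  by rewrite !vpc_in ?subrr ?expn_gt0// (leq_trans jle)// (leq_trans (leq_div _ _))// leq_exp2l.
have j0 : (0 < `|j|)%N by exact: leq_ltn_trans jgt.
have s2 : (2 <= s)%N.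
  by rewrite leqNgt; apply/negP => s2; move: s4; case: s s2 {jlt jgt tl} => [|[|]].
have e4 : (2 ^ s %/ 4 = 2 ^ (s - 2))%N by rewrite -{1}(subnKC s2) expnD mulKn.
have /andP[l1 l2] := trunc_log_bounds (isT : (1 < 2)%N) j0.
rewrite /inW; apply/andP; split.
  have := tl j0.
  by lia.
have : (2 ^ (s - 2) < 2 ^ (trunc_log 2 `|j|).+1)%N by rewrite -e4; exact: ltn_trans jgt l2.
by rewrite ltn_exp2l//; lia.
Qed.

Lemma beta1_alpha1 s j : beta1 s j * alpha1 s j = alpha1 s j.
Proof.
have [->|] := eqVneq (alpha1 s j) 0; first by rewrite mulr0.
rewrite /alpha1 => h.
have jlt : (`|j| < 2 ^ s.+1)%N.
  rewrite ltnNge; apply/negP => jge; move/negP: h; apply.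
  rewrite !vpc_out ?subrr ?eqxx -?expnS//; apply: leq_trans jge.
  by rewrite expnS leq_mul2l/= -divn2 leq_div.
suff -> : beta1 s j = 1 by rewrite mul1r.
rewrite /beta1 vpc_in ?expn_gt0//; last exact: ltnW.
rewrite vpc_out ?subr0//.
have [s0|s0] := posnP (2 ^ s)./2.
  by case: s s0 {h jlt} => [//|s]; rewrite expnS mul2n doubleK => /eqP; rewrite expn_eq0.
have jgt : ((2 ^ s)./2 < `|j|)%N.
  rewrite ltnNge; apply/negP => jle; move/negP: h; apply.
  by rewrite !vpc_in ?subrr ?expn_gt0// (leq_trans jle)// -divn2 leq_div.
apply: leq_trans (ltnW jgt); rewrite -divn2 (_ : 4 = 2 * 2)%N// divnMA mulnC.
exact: leq_trunc_div.
Qed.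

Lemma sum_alpha1 N j : \sum_(s < N.+1) alpha1 s j = vpc R (2 ^ N) j.
Proof.
elim: N => [|N IH]; first by rewrite big_ord1 /alpha1 vpc0 subr0.
by rewrite big_ord_recr/= IH /alpha1 expnS mul2n doubleK addrC subrK.
Qed.

Lemma window_scale j s : inW j s ->
  (maxn 1 `|j| <= 4 * 2 ^ s)%N /\ (2 ^ s <= 4 * maxn 1 `|j|)%N.
Proof.
rewrite /inW => /andP[h1 h2].
case: (posnP `|j|%N) => [j0|j0].
  rewrite j0 in h1 h2 *; rewrite trunc_log0 in h1 h2.
  have s0 : (0 < 2 ^ s)%N by rewrite expn_gt0.
  split; first by rewrite maxn0 (leq_trans s0)// leq_pmull.
  by rewrite maxn0 muln1 (_ : 4 = 2 ^ 2)%N// leq_exp2l//; lia.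
have /andP[l1 l2] := trunc_log_bounds (isT : (1 < 2)%N) j0.
rewrite (maxn_idPr j0); split.
  rewrite (leq_trans (ltnW l2))// (_ : 4 = 2 ^ 2)%N// -expnD leq_exp2l//; lia.
rewrite (_ : 4 = 2 ^ 2)%N//; apply: leq_trans (leq_mul (leqnn _) l1).
by rewrite -expnD leq_exp2l//; lia.
Qed.

Variable d : nat.
Local Notation freq := {ffun 'I_d -> int}.
Implicit Types (s : d.-tuple nat) (k : freq) (x : point R d).

(* [alpha s] is the multiplier of [block_op s]; [beta s] equals [1] on its support and lives on the same dyadic scale. *)
Definition alpha s k : R := kcoef R (fun i => 2 ^ tnth s i)%N (fun i => (2 ^ tnth s i)./2) k.
Definition beta s k : R := kcoef R (fun i => 2 ^ (tnth s i).+1)%N (fun i => 2 ^ tnth s i %/ 4)%N k.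
Definition akern s x : R := kern (fun i => 2 ^ tnth s i)%N (fun i => (2 ^ tnth s i)./2) x.
Definition bkern s x : R := kern (fun i => 2 ^ (tnth s i).+1)%N (fun i => 2 ^ tnth s i %/ 4)%N x.

Lemma blockE s x : block s x = (akern s x)%:C%C.
Proof. by rewrite /block /akern /kern rmorph_prod; apply: eq_bigr => i _; exact: block1E. Qed.

Lemma expn_lt_box N s i : s \in box d N -> (2 * 2 ^ (tnth s i).+1 <= 2 ^ N.+1)%N.
Proof.
by rewrite mem_box => /forallP/(_ i) sN; rewrite -expnS leq_exp2l.
Qed.

Lemma akern_tpoly N s x : s \in box d N ->
  (akern s x)%:C%C = tpoly (boxZ d (2 ^ N.+1)) (fun k => (alpha s k)%:C%C) x.
Proof.
move=> sN; apply: kern_tpoly => i; apply: leq_trans (expn_lt_box i sN); rewrite leq_mul2l/=.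
  by rewrite leq_exp2l.
by rewrite -divn2 (leq_trans (leq_div _ _))// leq_exp2l.
Qed.

Lemma bkern_tpoly N s x : s \in box d N ->
  (bkern s x)%:C%C = tpoly (boxZ d (2 ^ N.+1)) (fun k => (beta s k)%:C%C) x.
Proof.
move=> sN; apply: kern_tpoly => i; apply: leq_trans (expn_lt_box i sN); rewrite leq_mul2l/=.
  exact: leqnn.
by rewrite (leq_trans (leq_div _ _))// leq_exp2l.
Qed.

Lemma alphaE s k : alpha s k = \prod_i alpha1 (tnth s i) (k i).
Proof. by []. Qed.

Lemma betaE s k : beta s k = \prod_i beta1 (tnth s i) (k i).
Proof. by []. Qed.

Lemma beta_alpha s k : beta s k * alpha s k = alpha s k.
Proof.
by rewrite alphaE betaE -big_split; apply: eq_bigr => i _ /=; rewrite beta1_alpha1.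
Qed.

Definition window k s : bool := [forall i, inW (k i) (tnth s i)].

Lemma beta_window s k : beta s k != 0 -> window k s.
Proof.
rewrite betaE => /prodf_neq0 h; apply/forallP => i; apply: beta1_window; exact: h.
Qed.

Lemma alpha_window s k : alpha s k != 0 -> window k s.
Proof.
move=> a0; apply: beta_window; apply: contraNneq a0 => b0.
by rewrite -beta_alpha b0 mul0r.
Qed.

Lemma sum_alpha N k : (forall i, `|k i| <= 2 ^ N)%N -> \sum_(s <- box d N.+1) alpha s k = 1.
Proof.
move=> kN; rewrite (sum_box_prod N.+1 (fun i j => alpha1 j (k i))) big1// => i _.
by rewrite sum_alpha1 vpc_in ?expn_gt0.
Qed.

Lemma prodr_natb (I : finType) (P : pred I) : \prod_i ((P i)%:R : R) = ([forall i, P i])%:R.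
Proof.
case: forallP => [h|h]; first by rewrite big1// => i _; rewrite h.
have /forallPn[i iP] : ~~ [forall i, P i] by apply/forallP.
by rewrite (bigD1 i)//= (negbTE iP) mul0r.
Qed.

Lemma sum_itv_le N a b : \sum_(j < N) ((a <= j <= b)%N)%:R <= (b.+1 - a)%:R :> R.
Proof.
rewrite -natr_sum ler_nat -(big_mkord xpredT (fun j => nat_of_bool (a <= j <= b)%N)).
rewrite -big_mkcond/= sum1_count -size_filter.
rewrite -(size_iota a (b.+1 - a)); apply: uniq_leq_size; first by rewrite filter_uniq// iota_uniq.
by move=> j; rewrite mem_filter mem_iota => /andP[/andP[h1 h2] _]; lia.
Qed.

Lemma card_window N k : \sum_(s <- box d N) (window k s)%:R <= 4 ^+ d :> R.
Proof.
under eq_bigr do rewrite /window -prodr_natb.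
rewrite (sum_box_prod N (fun i j => (inW (k i) j)%:R)) -[X in _ ^+ X]card_ord -prodr_const.
apply: ler_prod => i _; rewrite sumr_ge0//=; apply: (le_trans (sum_itv_le _ _ _)).
by rewrite ler_nat; lia.
Qed.

(** A window has four consecutive scales at most, so two indices with a common frequency differ by
    at most 3 in each coordinate; this leaves at most 7 choices per coordinate. *)
Definition near_idx s (s' : d.-tuple nat) : bool :=
  [forall i, (tnth s' i <= tnth s i + 3)%N && (tnth s i <= tnth s' i + 3)%N].

Lemma window_near k s s' : window k s -> window k s' -> near_idx s s'.
Proof.
move=> /forallP h /forallP h'; apply/forallP => i.
by move: (h i) (h' i); rewrite /inW; lia.
Qed.

Lemma card_near N s : \sum_(s' <- box d N) (near_idx s s')%:R <= 7 ^+ d :> R.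
Proof.
under eq_bigr do rewrite /near_idx -prodr_natb.
rewrite (sum_box_prod N (fun i j => ((j <= tnth s i + 3)%N && (tnth s i <= j + 3)%N)%:R)).
rewrite -[X in _ ^+ X]card_ord -prodr_const.
apply: ler_prod => i _; rewrite sumr_ge0//=.
have := sum_itv_le N (tnth s i - 3) (tnth s i + 3) => h.
apply: le_trans (le_trans h _); last by rewrite ler_nat; lia.
by apply: ler_sum => j _; rewrite ler_nat; case: andP => // -[? ?]; rewrite (_ : (_ <= _ <= _)%N)//; lia.
Qed.

Lemma norm1_near s s' : near_idx s s' -> (norm1 s' <= norm1 s + 3 * d)%N.
Proof.
move=> /forallP h; rewrite /norm1.
apply: (@leq_trans (\sum_(i < d) (tnth s i + 3))%N).
  by apply: leq_sum => i _; have /andP[] := h i.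
by rewrite big_split/= sum_nat_const card_ord mulnC.
Qed.

(* The Fourier multiplier of [F_r] at [k] is [bweight k `^ (- r)]. *)
Definition bweight k : R := \prod_i (maxn 1 `|k i|)%:R.

Lemma bweight_ge1 k : 1 <= bweight k.
Proof.
apply: (@le_trans _ _ (\prod_(i < d) 1)); first by rewrite big1.
by apply: ler_prod => i _; rewrite ler01/= ler1n leq_maxl.
Qed.

Lemma exp2_norm1 s : 2 ^+ norm1 s = \prod_i (2 ^ tnth s i)%:R :> R.
Proof.
rewrite /norm1 (big_morph _ (exprD 2) (expr0 2)); apply: eq_bigr => i _.
by rewrite natrX.
Qed.

Lemma window_bweight k s : window k s ->
  bweight k <= 4 ^+ d * 2 ^+ norm1 s /\ 2 ^+ norm1 s <= 4 ^+ d * bweight k.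
Proof.
move=> /forallP h; rewrite exp2_norm1 /bweight.
rewrite -[X in _ ^+ X](card_ord d) -prodr_const -!big_split/=.
split; apply: ler_prod => i _; have [h1 h2] := window_scale (h i); rewrite ler0n/=.
  by rewrite -natrM ler_nat.
by rewrite -natrM ler_nat.
Qed.

(** In each coordinate, 20 absorbs [5 * 2^(s+1) + 5 * 2^s / 4] relative to [2^s]. *)
Lemma bkern_sup s x : `|bkern s x| <= 20 ^+ d * 2 ^+ norm1 s.
Proof.
rewrite exp2_norm1 -[X in _ ^+ X](card_ord d) -prodr_const -big_split/=.
apply: kern_le => i; rewrite -!natrM -natrD ler_nat.
have := leq_div (2 ^ tnth s i) 4; rewrite expnS; lia.
Qed.

End dyadic_blocks.

(** * Bernoulli kernels *)

Section cosine_series.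
Variable R : realType.
Implicit Types (r x : R).

Lemma cvg_natpow0 r : 0 < r -> k.+1%:R `^ (- r) @[k --> \oo] --> (0 : R).
Proof.
move=> r0; apply/cvgrPdist_le => /= e e0.
pose M := Num.bound (e `^ (- r^-1)); have hM : e `^ (- r^-1) < M%:R := archi_boundP (powR_ge0 _ _).
near=> n; rewrite sub0r normrN ger0_norm ?powR_ge0//.
have Mn : e `^ (- r^-1) <= n.+1%:R.
  rewrite (le_trans (ltW hM))// ler_nat.
  by near: n; exists M => // m /= Mm; exact: leqW.
have -> : e = (e `^ (- r^-1)) `^ (- r).
  by rewrite -powRrM mulrN mulNr opprK mulVf ?gt_eqF// powRr1// ltW.
rewrite !(powRN _ r) lef_pV2 ?posrE ?powR_gt0//.
by apply: ge0_ler_powR; rewrite ?nnegrE ?powR_ge0// ltW.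
Unshelve. all: by end_near. Qed.

Lemma natpow_nonincr r k : 0 < r -> k.+2%:R `^ (- r) <= k.+1%:R `^ (- r) :> R.
Proof.
move=> r0; rewrite !powRN lef_pV2 ?posrE ?powR_gt0//.
by apply: ge0_ler_powR; rewrite ?nnegrE ?ltW// ltr_nat.
Qed.

(* Summation by parts turns the series, multiplied by [2 sin (x / 2)], into an absolutely convergent one. *)
Lemma cos_series_by_parts (b : nat -> R) x n :
  2 * sin (x / 2) * \sum_(0 <= k < n) b k * cos (k.+1%:R * x) =
  \sum_(0 <= k < n) (b k - b k.+1) * sin ((k.+1%:R + 2^-1) * x) +
    b n * sin ((n%:R + 2^-1) * x) - b 0 * sin (2^-1 * x).
Proof.
elim: n => [|n IH]; first by rewrite !big_nil mulr0 add0r add0r subrr.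
rewrite !big_nat_recr//= mulrDr IH.
have -> : sin ((n.+1%:R + 2^-1) * x) = sin (n.+1%:R * x + x / 2) by congr sin; field.
have -> : sin ((n%:R + 2^-1) * x) = sin (n.+1%:R * x - x / 2).
  by congr sin; rewrite -natr1; field.
by rewrite sinB sinD; ring.
Qed.

Lemma is_cvg_cos_series r x : 0 < r -> sin (x / 2) != 0 ->
  cvgn (fun n => \sum_(1 <= k < n) k%:R `^ (- r) * cos (k%:R * x)).
Proof.
move=> r0 sx; pose b k : R := k.+1%:R `^ (- r).
have cb : b @ \oo --> 0 by exact: cvg_natpow0.
suff : cvgn (fun n => \sum_(1 <= k < n.+1) k%:R `^ (- r) * cos (k%:R * x)).
  move=> /cvg_ex[l]; rewrite (cvg_shiftS (fun n => \sum_(1 <= k < n) k%:R `^ (- r) * cos (k%:R * x))) => h.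
  by apply/cvg_ex; exists l.
have -> : (fun n => \sum_(1 <= k < n.+1) k%:R `^ (- r) * cos (k%:R * x)) =
    (fun n => (2 * sin (x / 2))^-1 * (\sum_(0 <= k < n) (b k - b k.+1) * sin ((k.+1%:R + 2^-1) * x) +
       b n * sin ((n%:R + 2^-1) * x) - b 0 * sin (2^-1 * x))).
  apply/funext => n; rewrite -cos_series_by_parts mulKf ?mulf_neq0// ?pnatr_eq0//.
  by rewrite big_add1.
apply: is_cvgM; first exact: is_cvg_cst.
apply: is_cvgB; last exact: is_cvg_cst.
apply: is_cvgD.
  (* Absolute convergence: the sines are at most 1, and the nonnegative differences of [b]
     telescope. *)
  have bb k : 0 <= b k - b k.+1 by rewrite subr_ge0 natpow_nonincr.
  have nle k : `|(b k - b k.+1) * sin ((k.+1%:R + 2^-1) * x)| <= b k - b k.+1.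
    by rewrite normrM ger0_norm// ler_piMr// ler_norml sin_le1 sin_geN1.
  apply: (@normed_cvg _ R^o).
  apply: (@series_le_cvg _ _ (fun k => b k - b k.+1)) => //.
  - by move=> k; rewrite normr_ge0.
  have -> : series (fun k => b k - b k.+1) = (fun n => b 0%N - b n).
    apply/funext => n; rewrite seriesEnat/=; elim: n => [|n IH]; first by rewrite big_nil subrr.
    by rewrite big_nat_recr//= IH addrA subrK.
  by apply: is_cvgB; [exact: is_cvg_cst|apply/cvg_ex; exists 0].
apply/cvg_ex; exists 0; apply/cvgrPdist_le => /= e e0.
move/cvgrPdist_le : cb => /(_ _ e0); apply: filterS => n; rewrite !sub0r !normrN => h.
rewrite normrM (le_trans _ h)// ler_piMr// ler_norml sin_le1 sin_geN1//.
Qed.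

(** Cauchy condensation: the [2^N] terms from [2^N] on add up to at most [q^N] with
    [q = 2^(1 - s) < 1]. *)
Lemma sum_natpow_bounded (s : R) : 1 < s ->
  exists C : R, forall n, \sum_(1 <= k < n) k%:R `^ (- s) <= C.
Proof.
move=> s1; pose q : R := 2 `^ (1 - s).
have q0 : 0 < q by rewrite powR_gt0.
have q1 : q < 1.
  rewrite /q -(opprB s 1) powRN invf_lt1 ?powR_gt0//.
  have : 1 `^ (s - 1) < 2 `^ (s - 1) :> R.
    by apply: gt0_ltr_powR; rewrite ?subr_gt0 ?nnegrE ?ltr1n.
  by rewrite powR1.
have dyad N : \sum_(1 <= k < 2 ^ N) k%:R `^ (- s) <= \sum_(0 <= i < N) q ^+ i.
  elim: N => [|N IH]; first by rewrite !big_nil.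
  rewrite (@big_cat_nat _ _ _ (2 ^ N))/= ?expn_gt0// ?leq_exp2l// [leRHS]big_nat_recr//=.
  apply: lerD => //.
  apply: (@le_trans _ _ (\sum_(2 ^ N <= k < 2 ^ N.+1) (2 ^ N)%:R `^ (- s))).
    rewrite big_nat [leRHS]big_nat; apply: ler_sum => k /andP[kN _].
    have k0 : (0 < k)%N by apply: leq_trans kN; rewrite expn_gt0.
    rewrite !powRN lef_pV2 ?posrE ?powR_gt0 ?ltr0n ?expn_gt0//.
    by apply: ge0_ler_powR; rewrite ?nnegrE ?ler_nat//; lra.
  have aE : (2 ^ N)%:R = 2 `^ N%:R :> R by rewrite natrX powR_mulrn.
  rewrite sumr_const_nat expnS mul2n -addnn addnK -[leLHS]mulr_natr aE -powRrM -powRD; last first.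
    by rewrite pnatr_eq0 implybT.
  rewrite -[leRHS]powR_mulrn ?(ltW q0)// /q -powRrM le_eqVlt; apply/orP; left.
  by apply/eqP; congr (_ `^ _); ring.
exists (1 - q)^-1 => n.
apply: (@le_trans _ _ (\sum_(1 <= k < 2 ^ n) k%:R `^ (- s))).
  case: n => [|n]; first by rewrite big_geq// sumr_ge0// => *; rewrite powR_ge0.
  rewrite [leRHS](@big_cat_nat _ _ _ n.+1)//= ?(ltnW (ltn_expl _ _))//.
  by rewrite lerDl sumr_ge0// => *; rewrite powR_ge0.
apply: le_trans (dyad n) _; rewrite -[leRHS]mul1r ler_pdivlMr ?subr_gt0//.
have -> : (\sum_(0 <= i < n) q ^+ i) * (1 - q) = 1 - q ^+ n.
  elim: n => [|n IH]; first by rewrite big_nil mul0r expr0 subrr.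
  by rewrite big_nat_recr//= mulrDl IH exprS; ring.
by rewrite gerBl exprn_ge0// ltW.
Qed.

End cosine_series.

Section ballZ_sums.
Lemma sum_ballZ_sym (V : nmodType) n (F : int -> V) :
  \sum_(j <- ballZ n) F j = F 0 + \sum_(1 <= k < n.+1) (F k%:Z + F (- k%:Z)).
Proof.
elim: n => [|n IH]; first by rewrite /ballZ big_seq1 subr0 big_geq// addr0.
rewrite big_nat_recr//= addrA -IH.
have h : perm_eq (ballZ n.+1) [:: n.+1%:Z, - n.+1%:Z & ballZ n].
  apply: uniq_perm; first exact: ballZ_uniq.
    by rewrite 2!cons_uniq ballZ_uniq inE !mem_ballZ; lia.
  by move=> j; rewrite mem_ballZ 2!in_cons mem_ballZ; lia.
transitivity (F n.+1%:Z + (F (- n.+1%:Z) + \sum_(j <- ballZ n) F j)).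
  by rewrite (perm_big _ h) 2!big_cons.
by rewrite addrA addrC.
Qed.
End ballZ_sums.

Section bernoulli_kernel.
Variables (R : realType) (d : nat) (r : R).
Hypothesis r0 : 0 < r.
Local Notation mu := (torus_measure R d).
Local Notation freq := {ffun 'I_d -> int}.

Definition bpart1 (n : nat) (x : R) : R :=
  1 + 2 * \sum_(1 <= k < n) k%:R `^ (- r) * cos (k%:R * x).

Lemma cvg_bpart1 x : sin (x / 2) != 0 -> bpart1 n x @[n --> \oo] --> bernoulli_kernel1 r x.
Proof.
move=> sx; apply: cvgD; first exact: cvg_cst.
by apply: cvgM; [exact: cvg_cst|exact: is_cvg_cos_series].
Qed.

Lemma cos_natmul1 (x : R) (k : nat) : sin (x / 2) = 0 -> cos (k%:R * x) = 1.
Proof.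
move=> sx; have e1x : e1 1 x = 1.
  have -> : x = x / 2 + x / 2 by rewrite -splitr.
  rewrite e1_addt /e1 mul1r sx.
  have := cos2Dsin2 (x / 2); rewrite sx expr0n addr0 => c2.
  by apply/eqP; rewrite eq_complex/= !mulr0 !mul0r subr0 addr0 -expr2 c2 !eqxx.
have := e1_nat k x; rewrite e1x expr1n => /(congr1 (@complex.Re R)).
by rewrite /e1/=.
Qed.

(** The partial sums need not converge where [sin (x / 2) = 0]. There all cosines are 1, so [limn]
    takes the same value as at 0, and replacing the partial sums by that constant gives convergence
    everywhere. *)
Lemma measurable_bernoulli_kernel1 : measurable_fun setT (bernoulli_kernel1 r : R -> R).
Proof.
have ms : measurable_fun setT (fun x : R => sin (x / 2)).
  apply: (measurableT_comp (continuous_measurable_fun (@continuous_sin R))).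
  exact: measurable_funM.
have mb : measurable_fun setT (fun x : R => sin (x / 2) == 0).
  by apply: measurable_fun_eqr => //.
pose h n x : R := if sin (x / 2) == 0 then bernoulli_kernel1 r 0 else bpart1 n x.
apply: (@measurable_fun_cvg _ _ _ _ h) => [n|x _].
  apply: measurable_fun_ifT => //.
  apply: measurable_funD => //; apply: measurable_funM => //.
  apply: measurable_sum => k; apply: measurable_funM => //.
  apply: (measurableT_comp (continuous_measurable_fun (@continuous_cos R))).
  exact: measurable_funM.
rewrite /h; case: eqVneq => sx; last exact: cvg_bpart1.
rewrite (_ : bernoulli_kernel1 r x = bernoulli_kernel1 r 0); first exact: cvg_cst.
rewrite /bernoulli_kernel1; congr (1 + 2 * _); congr (limn _); apply/funext => n.
by apply: eq_bigr => k _; rewrite mulr0 cos0 cos_natmul1.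
Qed.

Lemma bernoulli_kernel1_periodic x : bernoulli_kernel1 r (x + 2 * pi) = bernoulli_kernel1 r x :> R.
Proof.
rewrite /bernoulli_kernel1; congr (1 + 2 * _); congr (limn _); apply/funext => n.
apply: eq_bigr => k _; have := e1_periodic k%:Z x => /(congr1 (@complex.Re R)).
by rewrite /e1/= => ->.
Qed.

Lemma bernoulli_kernel_periodic : periodic (@bernoulli_kernel R d r).
Proof.
move=> i x; rewrite /bernoulli_kernel; congr (_%:C%C); apply: eq_bigr => j _.
by rewrite tnth_mktuple; case: eqP => _; rewrite ?addr0// bernoulli_kernel1_periodic.
Qed.

Lemma cmeas_bernoulli_kernel : cmeas (@bernoulli_kernel R d r).
Proof.
have h : cmeas (fun x : point R d => \prod_(j < d) (bernoulli_kernel1 r (tnth x j))%:C%C).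
  apply: cmeas_prod => i; apply: (@cmeas_coord _ _ (fun t => (bernoulli_kernel1 r t)%:C%C)) => /=.
    exact: measurable_bernoulli_kernel1.
  exact: measurable_cst.
by move: h; congr cmeas; apply/funext => x; rewrite /bernoulli_kernel rmorph_prod.
Qed.

Definition fweight (k : freq) : R := bweight R k `^ (- r).

Definition fpart (n : nat) (x : point R d) : R := \prod_i bpart1 n.+1 (tnth x i).

Lemma powR_prod (I : finType) (F : I -> R) (a : R) : (forall i, 0 <= F i) ->
  (\prod_i F i) `^ a = \prod_i (F i `^ a).
Proof.
move=> F0; suff [] : (\prod_i F i) `^ a = \prod_i (F i `^ a) /\ 0 <= \prod_i F i by [].
elim/big_ind2 : _ => [|x1 x2 y1 y2 [<- ?] [<- ?]|i _]; first by rewrite powR1.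
  by split; [rewrite powRM|rewrite mulr_ge0].
by [].
Qed.

Lemma fweight_prod k : fweight k = \prod_i ((maxn 1 `|k i|)%:R `^ (- r)).
Proof. by rewrite /fweight /bweight powR_prod. Qed.

Lemma bpart1_expo n x : (bpart1 n.+1 x)%:C%C =
  \sum_(j <- ballZ n) ((maxn 1 `|j|)%:R `^ (- r))%:C%C * e1 j x.
Proof.
rewrite sum_ballZ_sym e1_0 mulr1 maxn0 powR1 /bpart1 rmorphD rmorphM rmorph_sum/=.
congr (_ + _); rewrite mulr_sumr; apply: eq_big_nat => k /andP[k1 _].
rewrite abszN ?absz_nat (maxn_idPr k1) -mulrDr e1_conj addcJ rmorphM/= mulrCA.
by congr (_ * (_ * _)); exact: (rmorph_nat (real_complex R) 2).
Qed.

Lemma fpart_tpoly n x :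
  (fpart n x)%:C%C = tpoly (boxZ d n) (fun k => (fweight k)%:C%C) x.
Proof.
rewrite /fpart rmorph_prod/= /tpoly.
under eq_bigr do rewrite bpart1_expo.
rewrite -(sum_boxZ_prod n (fun i j => ((maxn 1 `|j|)%:R `^ (- r))%:C%C * e1 j (tnth x i))).
by apply: eq_bigr => k _; rewrite big_split/= fweight_prod rmorph_prod.
Qed.

End bernoulli_kernel.

Section bernoulli_L2.
Variables (R : realType) (d : nat) (r : R).
Hypothesis r_gt : 1 / 2 < r.
Local Notation mu := (torus_measure R d).
Local Notation freq := {ffun 'I_d -> int}.
Local Notation c := (fun k => (fweight r k)%:C%C).

Lemma tpoly_widen (S S' : seq freq) (a : freq -> R[i]) x : uniq S -> uniq S' ->
  {subset S <= S'} -> (forall k, k \notin S -> a k = 0) -> tpoly S' a x = tpoly S a x.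
Proof.
move=> uS uS' SS a0; rewrite /tpoly (bigID (mem S))/= [X in _ + X]big1 ?addr0; last first.
  by move=> k kS; rewrite a0// mul0r.
rewrite -big_filter; apply: perm_big; apply: uniq_perm; rewrite ?filter_uniq//.
by move=> k; rewrite mem_filter; apply/andP/idP => [[]//|kS]; split => //; exact: SS.
Qed.

Lemma boxZ_sub n m : (n <= m)%N -> {subset boxZ d n <= boxZ d m}.
Proof.
by move=> nm k; rewrite !mem_boxZ => /forallP h; apply/forallP => i; exact: leq_trans (h i) nm.
Qed.

(** By Parseval, the squared L_2 norm of the partial sum [fpart r n]. *)
Definition fmass n : R := \sum_(k <- boxZ d n) fweight r k ^+ 2.

Lemma fmass_split n m : (n <= m)%N ->
  fmass m = fmass n + \sum_(k <- boxZ d m | k \notin boxZ d n) fweight r k ^+ 2.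
Proof.
move=> nm; rewrite /fmass (bigID (mem (boxZ d n)))/=; congr (_ + _).
rewrite -big_filter; apply: perm_big; apply: uniq_perm; rewrite ?filter_uniq ?boxZ_uniq//.
by move=> k; rewrite mem_filter; apply/andP/idP => [[]//|kS]; split => //; exact: boxZ_sub kS.
Qed.

Lemma fmass_nondecreasing : nondecreasing_seq fmass.
Proof.
by move=> n m nm; rewrite (fmass_split nm) lerDl sumr_ge0// => k _; rewrite sqr_ge0.
Qed.

(** The sum factors over the coordinates and [2 * r > 1] bounds each factor; frequency 0 gives the
    1, the two signs give the 2. *)
Lemma fmass_bounded : exists C, forall n, fmass n <= C.
Proof.
have r0 : 0 < r by move: r_gt; lra.
have r2 : 1 < 2 * r by move: r_gt; lra.
have [C hC] := sum_natpow_bounded r2.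
exists (\prod_(i < d) (1 + 2 * C)) => n.
have -> : fmass n = \prod_(i < d) \sum_(j <- ballZ n) ((maxn 1 `|j|)%:R `^ (- r)) ^+ 2.
  rewrite -(sum_boxZ_prod n (fun i j => ((maxn 1 `|j|)%:R `^ (- r)) ^+ 2)).
  by apply: eq_bigr => k _; rewrite fweight_prod -prodrXl.
apply: ler_prod => i _; rewrite sumr_ge0/=; last by move=> *; rewrite sqr_ge0.
rewrite sum_ballZ_sym maxn0 powR1 expr1n lerD2l.
apply: (@le_trans _ _ (2 * \sum_(1 <= k < n.+1) k%:R `^ (- (2 * r)))); last by rewrite ler_pM2l.
rewrite mulr_sumr big_nat [leRHS]big_nat; apply: ler_sum => k /andP[k1 _].
rewrite abszN ?absz_nat (maxn_idPr k1).
have -> : (k%:R `^ (- r)) ^+ 2 = k%:R `^ (- (2 * r)) :> R.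
  by rewrite -powR_mulrn ?powR_ge0// -powRrM; congr (_ `^ _); ring.
lra.
Qed.

Lemma l2dist_fpart n m : (n <= m)%N ->
  (\int[mu]_x (normc (tpoly (boxZ d m) c x - tpoly (boxZ d n) c x) ^+ 2)%:E =
   (fmass m - fmass n)%:E)%E.
Proof.
move=> nm; pose a k : R[i] := if k \in boxZ d n then 0 else c k.
have E x : tpoly (boxZ d m) c x - tpoly (boxZ d n) c x = tpoly (boxZ d m) a x.
  pose b k : R[i] := if k \in boxZ d n then c k else 0.
  have -> : tpoly (boxZ d n) c x = tpoly (boxZ d m) b x.
    rewrite (@tpoly_widen (boxZ d n)) ?boxZ_uniq//; last 2 first.
    - exact: boxZ_sub.
    - by move=> k kn; rewrite /b (negbTE kn).
    by apply: eq_tpoly => k kn; rewrite /b kn.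
  rewrite /tpoly -sumrB; apply: eq_bigr => k _; rewrite -mulrBl; congr (_ * _).
  by rewrite /a /b; case: ifP => _; rewrite ?subrr ?subr0.
under eq_integral do rewrite E.
rewrite parseval_tpoly ?boxZ_uniq//; congr EFin.
rewrite (fmass_split nm) addrAC subrr add0r [RHS]big_mkcond; apply: eq_bigr => k _.
rewrite /a; case: ifP => _; first by rewrite Normc.normc0 expr0n.
by rewrite normc_real real_normK ?num_real.
Qed.

Lemma ae_cvg_fpart :
  {ae mu, forall x, fpart r n x @[n --> \oo] --> complex.Re (bernoulli_kernel r x)}.
Proof.
have r0 : 0 < r by move: r_gt; lra.
have h (i : 'I_d) : {ae mu, forall x : point R d, sin ((tnth x i : R) / 2) != 0}.
  have mB : measurable (~` `]0%R, 2 * pi[ : set (measurableTypeR R)).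
    by apply: measurableC; exact: measurable_itv.
  have B0 : lebesgue_measure ((~` `]0%R, 2 * pi[) `&` `[0, 2 * pi] : set (measurableTypeR R)) = 0%E.
    apply: countable_lebesgue_measure0.
    apply: (@sub_countable _ _ _ [set 0; 2 * pi]); last first.
      by apply: finite_set_countable; rewrite finite_setU; split; exact: finite_set1.
    apply: subset_card_le => t /= [] /negP; rewrite !in_itv/= negb_and -!leNgt.
    by move=> /orP[t0'|t1'] /andP[t0 t1]; [left; lra|right; lra].
  have := ae_coord i mB B0; move/ae_imp; apply => x /= /contrapT.
  rewrite in_itv/= => /andP[t0 t1]; rewrite gt_eqF//.
  by apply: sin_gt0_pi; apply/andP; split; lra.
apply: (ae_imp (filter_forall _ h)) => x hx; rewrite /bernoulli_kernel/= /fpart.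
elim: (index_enum _) => [|i s IH].
  by under eq_fun do rewrite big_nil; rewrite big_nil; exact: cvg_cst.
under eq_fun do rewrite big_cons; rewrite big_cons; apply: cvgM => //.
rewrite (cvg_shiftS (fun n => bpart1 r n (tnth x i))).
exact: cvg_bpart1.
Qed.

(** Fatou for the squared distance between the partial sums of orders [m + n] and [n] as [m] grows:
    a.e. convergence identifies the integrand, Parseval the integrals. *)
Lemma bernoulli_kernel_fpart n :
  (\int[mu]_x (normc (bernoulli_kernel r x - tpoly (boxZ d n) c x) ^+ 2)%:E <=
   (limn fmass - fmass n)%:E)%E.
Proof.
have r0 : 0 < r by move: r_gt; lra.
have [C hC] := fmass_bounded.
have cf : fmass @ \oo --> limn fmass.
  apply: nondecreasing_is_cvgn; first exact: fmass_nondecreasing.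
  by exists C => _ [m _ <-].
pose u m x := ((normc (tpoly (boxZ d (m + n)) c x - tpoly (boxZ d n) c x) ^+ 2)%:E : \bar R).
have mu_ m : measurable_fun setT (u m).
  by apply: cmeas_normc2; apply: cmeasB; exact: cmeas_tpoly.
have u0 m x : (0 <= u m x)%E by rewrite lee_fin sqr_ge0.
have iu m : (\int[mu]_x u m x = (fmass (m + n) - fmass n)%:E)%E by exact: l2dist_fpart (leq_addl _ _).
have cu : (fun m => (fmass (m + n) - fmass n)%:E) @ \oo --> (limn fmass - fmass n)%:E.
  apply: cvg_EFin; first exact: nearW.
  apply: cvgB; last exact: cvg_cst.
  by rewrite (cvg_shiftn n fmass).
apply: (@le_trans _ _ (\int[mu]_x limn_einf (u ^~ x))%E).
  apply: ae_ge0_le_integral => //.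
  - by move=> x _; rewrite lee_fin sqr_ge0.
  - by apply: cmeas_normc2; apply: cmeasB; [exact: cmeas_bernoulli_kernel|exact: cmeas_tpoly].
  - move=> x _; rewrite limn_einf_lim; apply: lime_ge; first exact: is_cvg_einfs.
    by apply: nearW => m; apply: le_ereal_inf_tmp => _ [j _ <-].
  - rewrite (_ : (fun _ => _) = (fun x => - limn_esup (fun m => - u m x))%E); last first.
      by apply/funext => x; rewrite (limn_esupN (u ^~ x)) oppeK.
    apply: measurableT_comp => //; apply: measurable_fun_limn_esup => m.
    exact: measurableT_comp.
  apply: (ae_imp ae_cvg_fpart) => x fx _.
  suff cx : u m x @[m --> \oo] --> (normc (bernoulli_kernel r x - tpoly (boxZ d n) c x) ^+ 2)%:E.
    by rewrite (cvg_limn_einf_sup cx).1.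
  have E (a b : R) : normc (a%:C%C - b%:C%C) ^+ 2 = (a - b) ^+ 2.
    by rewrite -rmorphB normc_real real_normK ?num_real.
  have e1 : normc (bernoulli_kernel r x - tpoly (boxZ d n) c x) ^+ 2 =
      (complex.Re (bernoulli_kernel r x) - fpart r n x) ^+ 2.
    by rewrite -fpart_tpoly /bernoulli_kernel E.
  rewrite e1 /u; under eq_fun do rewrite -!fpart_tpoly E.
  apply: cvg_EFin; first exact: nearW.
  rewrite expr2; under eq_fun do rewrite /= expr2.
  have cc : fpart r (m + n) x - fpart r n x @[m --> \oo] --> complex.Re (bernoulli_kernel r x) - fpart r n x.
    apply: cvgB; last exact: cvg_cst.
    by rewrite (cvg_shiftn n (fun m => fpart r m x)).
  exact: cvgM.
apply: (le_trans (fatou _ _ _ _)) => //.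
under eq_fun do rewrite iu.
by rewrite (cvg_limn_einf_sup cu).1.
Qed.

Lemma bernoulli_kernel_approx (e : R) : 0 < e -> exists n0, forall n, (n0 <= n)%N ->
  (\int[mu]_x (normc (bernoulli_kernel r x - tpoly (boxZ d n) c x) ^+ 2)%:E <= e%:E)%E.
Proof.
move=> e0; have [C hC] := fmass_bounded.
have cf : fmass @ \oo --> limn fmass.
  apply: nondecreasing_is_cvgn; first exact: fmass_nondecreasing.
  by exists C => _ [m _ <-].
move/cvgrPdist_le : cf => /(_ _ e0) [n0 _ h]; exists n0 => n n0n.
apply: (le_trans (bernoulli_kernel_fpart n)); rewrite lee_fin.
exact: le_trans (ler_norm _) (h n n0n).
Qed.

Lemma cint_bernoulli_kernel : cint (@bernoulli_kernel R d r).
Proof.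
have r0 : 0 < r by move: r_gt; lra.
have [n0 /(_ n0 (leqnn _)) h] := bernoulli_kernel_approx ltr01.
have ci : cint (fun x => bernoulli_kernel r x - tpoly (boxZ d n0) c x).
  apply: cint_sqr; last exact: le_lt_trans h (ltry _).
  by apply: cmeasB; [exact: cmeas_bernoulli_kernel|exact: cmeas_tpoly].
have := cintD ci (cint_tpoly (boxZ d n0) c).
by under eq_fun do rewrite subrK.
Qed.

(** Bessel for the single frequency [k] bounds the error by the L_2 distance to a partial sum that
    contains [k]. *)
Lemma fcoef_bernoulli_kernel k : fcoef (@bernoulli_kernel R d r) k = (fweight r k)%:C%C.
Proof.
have r0 : 0 < r by move: r_gt; lra.
apply/eqP; rewrite -subr_eq0; apply/eqP/Normc.eq0_normc.
apply/eqP; rewrite -sqrf_eq0 eq_le sqr_ge0 andbT; apply/ler_addgt0Pl => e e0; rewrite addr0.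
have [n0 h] := bernoulli_kernel_approx e0.
pose n := maxn n0 (\sum_i `|k i|).
have kn : k \in boxZ d n.
  rewrite mem_boxZ; apply/forallP => i; rewrite leq_max; apply/orP; right.
  by rewrite (bigD1 i)//= leq_addr.
have ci := cint_bernoulli_kernel.
have -> : (fweight r k)%:C%C = fcoef (tpoly (boxZ d n) c) k.
  by rewrite fcoef_tpoly ?boxZ_uniq// kn.
rewrite -fcoefB//; last exact: cint_tpoly.
rewrite -lee_fin; apply: le_trans (h n (leq_maxl _ _)).
have := @bessel R d (fun x => bernoulli_kernel r x - tpoly (boxZ d n) c x) [:: k].
rewrite big_seq1; apply => //.
by apply: cmeasB; [exact: cmeas_bernoulli_kernel|exact: cmeas_tpoly].
Qed.

End bernoulli_L2.

(** * Sobolev functions *)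

Section norms.
Variables (R : realType) (d : nat).
Local Notation mu := (torus_measure R d).
Local Notation freq := {ffun 'I_d -> int}.
Implicit Types f g phi : point R d -> R[i].

Lemma torus_norm_ge0 p f : (0 <= torus_norm p f)%E.
Proof. exact: Lnorm_ge0. Qed.

Lemma torus_norm_pow (p : R) f : p != 0 ->
  (torus_norm p%:E f `^ p = \int[mu]_x (normc (f x) `^ p)%:E)%E.
Proof.
move=> p0; transitivity (\int[mu]_x (`|(normc (f x))%:E| `^ p))%E.
  exact: (@poweR_Lnorm _ _ _ mu (fun x => (normc (f x))%:E)).
by apply: eq_integral => x _; rewrite gee0_abs ?lee_fin ?normc_ge0.
Qed.

Lemma poweRK (x : \bar R) (p : R) : (0 <= x)%E -> p != 0 -> ((x `^ p) `^ p^-1 = x)%E.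
Proof. by move=> x0 p0; rewrite -poweRrM divff// poweRe1. Qed.

Lemma poweR_le (x y : \bar R) (p : R) : 0 < p -> (0 <= x)%E -> (0 <= y)%E ->
  (x `^ p <= y `^ p)%E = (x <= y)%E.
Proof.
move=> p0 x0 y0; have p0' : 0 <= p^-1 by rewrite invr_ge0 ltW.
apply/idP/idP => h.
  rewrite -(poweRK x0 (lt0r_neq0 p0)) -(poweRK y0 (lt0r_neq0 p0)).
  by apply: gt0_ler_poweR; rewrite // in_itv/= leey poweR_ge0.
by apply: gt0_ler_poweR; rewrite ?(ltW p0)// in_itv/= leey ?x0 ?y0.
Qed.

Lemma integral_normc2E f :
  (\int[mu]_x (normc (f x) `^ 2)%:E = \int[mu]_x (normc (f x) ^+ 2)%:E)%E.
Proof. by apply: eq_integral => x _; rewrite powR_mulrn ?normc_ge0. Qed.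

Lemma torus_norm2_le f (t : R) : 0 <= t ->
  (torus_norm 2%:E f <= t%:E)%E = (\int[mu]_x (normc (f x) ^+ 2)%:E <= (t ^+ 2)%:E)%E.
Proof.
move=> t0; rewrite -(@poweR_le _ _ 2)// ?torus_norm_ge0//.
by rewrite torus_norm_pow// integral_normc2E poweR_EFin powR_mulrn.
Qed.

Lemma torus_norm_lty (p : R) f : p != 0 ->
  (torus_norm p%:E f < +oo)%E -> (\int[mu]_x (normc (f x) `^ p)%:E < +oo)%E.
Proof. by move=> p0 h; rewrite -torus_norm_pow//; exact: poweR_lty. Qed.

Lemma lty_torus_norm (p : R) f : p != 0 ->
  (\int[mu]_x (normc (f x) `^ p)%:E < +oo)%E -> (torus_norm p%:E f < +oo)%E.
Proof. by move=> p0; rewrite -torus_norm_pow//; exact: lty_poweRy. Qed.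

Lemma torus_normy_le f (M : R) :
  (torus_norm +oo%E f <= M%:E)%E <-> {ae mu, forall x, normc (f x) <= M}.
Proof.
rewrite /torus_norm unlock.
have -> : ((0 < mu [set: point R d])%E : bool) = true.
  by have -> : mu [set: point R d] = 1%E := probability_setT mu; rewrite lte01.
split.
  by move=> /ess_supP h; apply: (ae_imp h) => x /=; rewrite ger0_norm ?normc_ge0 ?lee_fin.
by move=> h; apply/ess_supP; apply: (ae_imp h) => x /=; rewrite ger0_norm ?normc_ge0 ?lee_fin.
Qed.

Lemma ae_and (P Q : point R d -> Prop) : {ae mu, forall x, P x} -> {ae mu, forall x, Q x} ->
  {ae mu, forall x, P x /\ Q x}.
Proof. exact: filterI. Qed.

Lemma ae_le_integral (u v : point R d -> R) : measurable_fun setT u -> measurable_fun setT v ->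
  (forall x, 0 <= u x) -> (forall x, 0 <= v x) -> {ae mu, forall x, u x <= v x} ->
  (\int[mu]_x (u x)%:E <= \int[mu]_x (v x)%:E)%E.
Proof.
move=> mu' mv u0 v0 uv; apply: ae_ge0_le_integral => //.
- by move=> x _; rewrite lee_fin.
- exact/measurable_EFinP.
- by move=> x _; rewrite lee_fin.
- exact/measurable_EFinP.
- by apply: (ae_imp uv) => x h _; rewrite lee_fin.
Qed.

Lemma cint_ae_bounded f (M : R) : cmeas f -> 0 <= M -> {ae mu, forall x, normc (f x) <= M} ->
  cint f /\ (\int[mu]_x (normc (f x))%:E <= M%:E)%E.
Proof.
move=> mf M0 fM; have h : (\int[mu]_x (normc (f x))%:E <= M%:E)%E.
  rewrite -[leRHS](integral_torus_cst d); apply: (@ae_le_integral _ (fun=> M)) => //.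
  - exact: cmeas_normc.
  - by move=> x; exact: normc_ge0.
by split => //; split => //; exact: le_lt_trans h (ltry _).
Qed.

Lemma young2 (a b l : R) : 0 < l -> a * b <= (l * a ^+ 2 + l^-1 * b ^+ 2) / 2.
Proof.
move=> l0; rewrite -subr_ge0.
have -> : (l * a ^+ 2 + l^-1 * b ^+ 2) / 2 - a * b = l / 2 * (a - l^-1 * b) ^+ 2.
  by field; rewrite gt_eqF.
by rewrite mulr_ge0 ?sqr_ge0 ?divr_ge0// ltW.
Qed.

Lemma integral_normc2_reflect f x : cmeas f -> periodic f ->
  (\int[mu]_y (normc (f (point_sub x y)) ^+ 2)%:E = \int[mu]_y (normc (f y) ^+ 2)%:E)%E.
Proof.
move=> mf fper.
rewrite -(@integral_torus_reflect _ _ (fun y => (normc (f y) ^+ 2)%:E) x)//.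
- exact: cmeas_normc2.
- by move=> i y; rewrite fper.
Qed.

(** Cauchy-Schwarz in the form of Young's inequality with a free parameter [l], to be chosen by the
    caller. *)
Lemma conv_L2 f g x (A B l : R) : cmeas f -> periodic f -> cmeas g -> 0 < l ->
  (\int[mu]_y (normc (f y) ^+ 2)%:E <= A%:E)%E -> (\int[mu]_y (normc (g y) ^+ 2)%:E <= B%:E)%E ->
  cint (fun y => f (point_sub x y) * g y) /\ normc (conv f g x) <= l * A + l^-1 * B.
Proof.
move=> mf pf mg l0 fA gB; set h := fun y => f (point_sub x y) * g y.
have mfx := cmeas_sub x mf.
have mh : cmeas h by exact: cmeasM.
have hb : (\int[mu]_y (normc (h y))%:E <= ((l * A + l^-1 * B) / 2)%:E)%E.
  apply: (@le_trans _ _ (\int[mu]_y ((l / 2)%:E * (normc (f (point_sub x y)) ^+ 2)%:E +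
      (l^-1 / 2)%:E * (normc (g y) ^+ 2)%:E))%E).
    apply: ge0_le_integral => //=.
    - by move=> y _; rewrite lee_fin normc_ge0.
    - exact: cmeas_Enormc.
    - by apply: emeasurable_funD; apply: emeasurable_funM => //; exact: cmeas_normc2.
    - move=> y _; rewrite -!EFinM -EFinD lee_fin Normc.normcM (le_trans (young2 _ _ l0))//.
      by rewrite le_eqVlt; apply/orP; left; apply/eqP; field; rewrite gt_eqF.
  have l20 : 0 <= l / 2 by rewrite divr_ge0// ltW.
  have li20 : 0 <= l^-1 / 2 by rewrite divr_ge0// invr_ge0 ltW.
  rewrite ge0_integralD//; last 4 first.
  - by move=> y _; rewrite -EFinM lee_fin mulr_ge0// sqr_ge0.
  - by apply: emeasurable_funM => //; exact: cmeas_normc2.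
  - by move=> y _; rewrite -EFinM lee_fin mulr_ge0// sqr_ge0.
  - by apply: emeasurable_funM => //; exact: cmeas_normc2.
  rewrite ge0_integralZl//; last 2 first.
  - exact: cmeas_normc2.
  - by move=> y _; rewrite lee_fin sqr_ge0.
  rewrite ge0_integralZl//; last 2 first.
  - exact: cmeas_normc2.
  - by move=> y _; rewrite lee_fin sqr_ge0.
  rewrite integral_normc2_reflect//.
  have -> : (l * A + l^-1 * B) / 2 = l / 2 * A + l^-1 / 2 * B by field; rewrite gt_eqF.
  by rewrite EFinD !EFinM leeD// lee_wpmul2l// lee_fin.
have ci : cint h by split => //; exact: le_lt_trans hb (ltry _).
split => //; rewrite -lee_fin (le_trans (le_normc_torus_integral ci))//.
apply: (@le_trans _ _ (2%:E * ((l * A + l^-1 * B) / 2)%:E)%E); first by rewrite lee_pmul2l.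
by rewrite -EFinM mulrC divfK.
Qed.

Lemma tpoly_conv S (c : freq -> R[i]) phi x : cint phi ->
  conv (tpoly S c) phi x = tpoly S (fun k => c k * fcoef phi k) x.
Proof.
move=> ci; rewrite /conv /tpoly.
under eq_torus_integral.
  move=> y; rewrite mulr_suml.
  under eq_bigr do rewrite expo_sub mulrA -mulrA (mulrC (expo (- _) y)).
  over.
rewrite torus_integral_sum; last by move=> k; apply: cintZ; exact: cint_mul_expo.
apply: eq_bigr => k _; rewrite torus_integralZ; last exact: cint_mul_expo.
by rewrite -/(fcoef phi k) mulrAC.
Qed.

End norms.

Section sobolev.
Variables (R : realType) (d : nat) (r : R).
Hypothesis r_gt : 1 / 2 < r.
Local Notation mu := (torus_measure R d).
Local Notation freq := {ffun 'I_d -> int}.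
Local Notation c := (fun k => (fweight r k)%:C%C).

Lemma fweight_gt0 (k : freq) : 0 < fweight r k.
Proof. by rewrite powR_gt0// (lt_le_trans ltr01)// bweight_ge1. Qed.

Lemma sobolev_tpoly (S : seq freq) (a : freq -> R[i]) x :
  conv (bernoulli_kernel r) (tpoly S (fun k => a k / c k)) x = tpoly S a x.
Proof.
have r0 : 0 < r by move: r_gt; lra.
rewrite conv_tpoly; [|exact: cint_bernoulli_kernel|exact: bernoulli_kernel_periodic].
apply: eq_bigr => k _; rewrite fcoef_bernoulli_kernel// divfK//.
by rewrite -(rmorph0 (real_complex R)) (inj_eq (@complexI R)) gt_eqF// fweight_gt0.
Qed.

Section representation.
Variables f phi : point R d -> R[i].
Hypotheses (tf : torus_fun f) (fphi : sobolev_repr r f phi).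

Let mf : cmeas f. Proof. by case: tf. Qed.
Let mphi : cmeas phi. Proof. by case: fphi => -[[]]. Qed.
Let phi2 : (\int[mu]_x (normc (phi x) ^+ 2)%:E < +oo)%E.
Proof. by case: fphi => -[_ h] _; rewrite -integral_normc2E; exact: torus_norm_lty h. Qed.
Let phii : cint phi. Proof. exact: cint_sqr. Qed.
Let r0 : 0 < r. Proof. by move: r_gt; lra. Qed.

(** The difference is a.e. the convolution of [phi] with the tail of the Bernoulli kernel, whose L_2
    norm tends to 0; hence the approximation is uniform. *)
Lemma sobolev_dist (e : R) : 0 < e -> exists n0, forall n, (n0 <= n)%N ->
  {ae mu, forall x, normc (f x - tpoly (boxZ d n) (fun k => c k * fcoef phi k) x) <= e}.
Proof.
move=> e0.
pose B := fine (\int[mu]_x (normc (phi x) ^+ 2)%:E)%E + 1.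
have I0 : (0 <= \int[mu]_x (normc (phi x) ^+ 2)%:E)%E by apply: integral_ge0 => x _; rewrite lee_fin sqr_ge0.
have IB : (\int[mu]_x (normc (phi x) ^+ 2)%:E <= B%:E)%E.
  by rewrite /B EFinD fineK ?ge0_fin_numE// leeDl.
have B0 : 0 < B by rewrite /B ltr_pwDr// fine_ge0.
(* With [A = e / (2 * l)] for the tail, the bound [l * A + l^-1 * B] is [e / 2 + e / 2]. *)
pose l := 2 * B / e.
have l0 : 0 < l by rewrite divr_gt0 ?mulr_gt0.
have [n0 hn] := bernoulli_kernel_approx d r_gt (divr_gt0 e0 (mulr_gt0 (ltr0Sn _ 1) l0)).
exists n0 => n n0n; have [_ fE] := fphi; apply: (ae_imp fE) => x ->.
have mF := cmeas_bernoulli_kernel d r0; have pF := @bernoulli_kernel_periodic R d r.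
have cF := cint_bernoulli_kernel d r_gt.
have mT := cmeas_tpoly (boxZ d n) c; have pT := @tpoly_periodic _ _ (boxZ d n) c.
have mD := cmeasB mF mT.
have pD : periodic (fun x => bernoulli_kernel r x - tpoly (boxZ d n) c x) by move=> i y; rewrite pF pT.
have [i2 h2] := @conv_L2 _ _ _ _ x _ B l mD pD mphi l0 (hn n n0n) IB.
have i3 : cint (fun y => tpoly (boxZ d n) c (point_sub x y) * phi y).
  under eq_fun do rewrite mulrC.
  apply: (cintMr phii); first exact: cmeas_sub.
  by move=> y; exact: normc_tpoly_le.
have i1 : cint (fun y => bernoulli_kernel r (point_sub x y) * phi y).
  have := cintD i2 i3; congr cint; apply/funext => y.
  by rewrite -mulrDl subrK.
have -> : conv (bernoulli_kernel r) phi x - tpoly (boxZ d n) (fun k => c k * fcoef phi k) x =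
   conv (fun x => bernoulli_kernel r x - tpoly (boxZ d n) c x) phi x.
  rewrite -tpoly_conv//.
  apply/eqP; rewrite subr_eq; apply/eqP; rewrite /conv -(torus_integralD i2 i3).
  by apply: eq_torus_integral => y; rewrite -mulrDl subrK.
apply: (le_trans h2); rewrite le_eqVlt; apply/orP; left; apply/eqP.
by rewrite /l; field; rewrite !gt_eqF.
Qed.

(** The embedding into L_oo: [f] is a.e. within 1 of a trigonometric polynomial. *)
Lemma sobolev_ae_bounded : exists M : R, 0 <= M /\ {ae mu, forall x, normc (f x) <= M}.
Proof.
have [n0 /(_ n0 (leqnn _)) h] := sobolev_dist ltr01.
exists (1 + \sum_(k <- boxZ d n0) normc (c k * fcoef phi k)).
split; first by rewrite addr_ge0// sumr_ge0// => k _; exact: normc_ge0.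
apply: (ae_imp h) => x hx.
rewrite -[f x](subrK (tpoly (boxZ d n0) (fun k => c k * fcoef phi k) x)).
by rewrite (le_trans (normcD_le _ _))// lerD// normc_tpoly_le.
Qed.

Lemma fcoef_sobolev k : fcoef f k = c k * fcoef phi k.
Proof.
apply/eqP; rewrite -subr_eq0; apply/eqP/Normc.eq0_normc.
apply/eqP; rewrite eq_le normc_ge0 andbT; apply/ler_addgt0Pl => e e0; rewrite addr0.
(* The half compensates the factor 2 of [normc_fcoef_le]. *)
have [n0 hn] := sobolev_dist (divr_gt0 e0 (ltr0Sn _ 1)).
pose n := maxn n0 (\sum_i `|k i|).
have kn : k \in boxZ d n.
  rewrite mem_boxZ; apply/forallP => i; rewrite leq_max; apply/orP; right.
  by rewrite (bigD1 i)//= leq_addr.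
have {}hn := hn n (leq_maxl _ _).
set T := tpoly (boxZ d n) (fun k => c k * fcoef phi k) in hn.
have -> : c k * fcoef phi k = fcoef T k by rewrite fcoef_tpoly ?boxZ_uniq// kn.
have [M [M0 fM]] := sobolev_ae_bounded.
have [ci _] := cint_ae_bounded mf M0 fM.
rewrite -fcoefB//; last exact: cint_tpoly.
have mD := cmeasB mf (cmeas_tpoly (boxZ d n) (fun k => c k * fcoef phi k)).
have [cD hD] := cint_ae_bounded mD (ltW (divr_gt0 e0 (ltr0Sn _ 1))) hn.
rewrite -lee_fin (le_trans (normc_fcoef_le _ cD))//.
apply: (@le_trans _ _ (2%:E * (e / 2)%:E)%E); first by rewrite lee_pmul2l.
by rewrite -EFinM mulrC divfK.
Qed.

End representation.

End sobolev.

(** * From interpolation to Besov spaces *)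

Section block_operators.
Variables (R : realType) (d : nat).
Local Notation mu := (torus_measure R d).
Local Notation freq := {ffun 'I_d -> int}.
Implicit Types (f g : point R d -> R[i]) (s : d.-tuple nat) (k : freq).

Lemma mem_box_norm1 s : s \in box d (norm1 s).+1.
Proof.
by rewrite mem_box; apply/forallP => i; rewrite ltnS /norm1 (bigD1 i)//= leq_addr.
Qed.

(** One frequency set serves all blocks of a box, so that their norms can be summed frequency by
    frequency. *)
Lemma block_op_tpoly N s f x : s \in box d N -> cint f -> periodic f ->
  block_op s f x = tpoly (boxZ d (2 ^ N.+1)) (fun k => (alpha R s k)%:C%C * fcoef f k) x.
Proof.
move=> sN fi fp; rewrite /block_op -conv_tpoly//; congr conv; apply/funext => y.
by rewrite blockE (akern_tpoly _ sN).
Qed.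

Lemma block_opD s f g x : cint f -> periodic f -> cint g -> periodic g ->
  block_op s (fun x => f x + g x) x = block_op s f x + block_op s g x.
Proof.
move=> fi fp gi gp; have sN := mem_box_norm1 s.
rewrite !(block_op_tpoly _ sN)//; last 2 first.
- exact: cintD.
- by move=> i y; rewrite fp gp.
rewrite /tpoly -big_split; apply: eq_bigr => k _.
by rewrite fcoefD// mulrDr mulrDl.
Qed.

Lemma cmeas_block_op s f : cint f -> periodic f -> cmeas (block_op s f).
Proof.
move=> fi fp; have := cmeas_tpoly (boxZ d (2 ^ (norm1 s).+2)) (fun k => (alpha R s k)%:C%C * fcoef f k).
by congr cmeas; apply/funext => x; rewrite (block_op_tpoly _ (mem_box_norm1 s)).
Qed.

Lemma block_op_periodic s f : cint f -> periodic f -> periodic (block_op s f).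
Proof.
by move=> fi fp i x; rewrite !(block_op_tpoly _ (mem_box_norm1 s))// tpoly_periodic.
Qed.

Lemma parseval_block_op N s f : s \in box d N -> cint f -> periodic f ->
  (\int[mu]_x (normc (block_op s f x) ^+ 2)%:E =
   (\sum_(k <- boxZ d (2 ^ N.+1)) alpha R s k ^+ 2 * normc (fcoef f k) ^+ 2)%:E)%E.
Proof.
move=> sN fi fp; under eq_integral do rewrite (block_op_tpoly _ sN)//.
rewrite parseval_tpoly ?boxZ_uniq//; congr EFin; apply: eq_bigr => k _.
by rewrite Normc.normcM normc_real exprMn real_normK ?num_real.
Qed.

Variables (r0 r1 : R).
Hypotheses (r1E : r1 = r0 + 1 / 2) (r0_gt0 : 0 < r0).

Definition gblock f s x : R := 2 `^ (r0 * (norm1 s)%:R) * normc (block_op s f x).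

Lemma gblock_ge0 f s x : 0 <= gblock f s x.
Proof. by rewrite mulr_ge0 ?powR_ge0 ?normc_ge0. Qed.

Lemma measurable_gblock f s : cint f -> periodic f -> measurable_fun setT (gblock f s).
Proof.
by move=> fi fp; apply: measurable_funM => //; apply: cmeas_normc; exact: cmeas_block_op.
Qed.

(** Here [r1 = r0 + 1/2] enters: the extra half derivative absorbs the factor [2^|s|] of the Besov
    sum. *)
Lemma exp2_weight (n : nat) : 2 ^+ n * (2 `^ (r0 * n%:R)) ^+ 2 = (2 ^+ n) `^ (2 * r1) :> R.
Proof.
rewrite -!powR_mulrn ?powR_ge0// -!powRrM -powRD; last by rewrite pnatr_eq0 implybT.
by congr (_ `^ _); rewrite r1E; field.
Qed.

Lemma weight_window s k : window k s ->
  2 ^+ norm1 s * (2 `^ (r0 * (norm1 s)%:R)) ^+ 2 * fweight r1 k ^+ 2 <= (4 ^+ d) `^ (2 * r1) :> R.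
Proof.
move=> w; have [_ h] := window_bweight R w.
have r1_ge : 0 <= 2 * r1 by rewrite r1E; move: r0_gt0; lra.
have b0 : 0 < bweight R k by exact: lt_le_trans ltr01 (bweight_ge1 R k).
have -> : fweight r1 k ^+ 2 = bweight R k `^ (- (2 * r1)).
  by rewrite -powR_mulrn ?powR_ge0// /fweight -powRrM; congr (_ `^ _); ring.
rewrite exp2_weight powRN ler_pdivrMr ?powR_gt0// -powRM ?exprn_ge0//; last exact: ltW.
by apply: ge0_ler_powR; rewrite ?nnegrE ?exprn_ge0// mulr_ge0 ?exprn_ge0// ltW.
Qed.

(** The number of scales that meet a frequency, times the distortion of the weight over one
    window. *)
Definition overlap_const : R := 4 ^+ d * (4 ^+ d) `^ (2 * r1).

Lemma alpha_overlap N k :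
  \sum_(s <- box d N) 2 ^+ norm1 s * (2 `^ (r0 * (norm1 s)%:R)) ^+ 2 * alpha R s k ^+ 2 * fweight r1 k ^+ 2
    <= overlap_const.
Proof.
apply: (@le_trans _ _ (\sum_(s <- box d N) (window k s)%:R * (4 ^+ d) `^ (2 * r1))); last first.
  by rewrite -mulr_suml ler_wpM2r ?powR_ge0// card_window.
apply: ler_sum => s _; have [w|nw] := boolP (window k s); last first.
  have -> : alpha R s k = 0 by apply/eqP; apply: contraNT nw; exact: alpha_window.
  by rewrite expr0n/= mulr0 !mul0r.
rewrite mul1r mulrAC; apply: le_trans (weight_window w).
rewrite ler_piMr//; first by rewrite !mulr_ge0 ?exprn_ge0 ?powR_ge0// sqr_ge0.
by rewrite -real_normK ?num_real// expr_le1// kcoef_bound.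
Qed.

Lemma weak_estimate a0 a1 phi (t L : R) N :
  cint a0 -> periodic a0 -> torus_fun a1 -> sobolev_repr r1 a1 phi -> 0 < t -> 0 < L ->
  (forall s, {ae mu, forall x, gblock a0 s x <= L}) ->
  (\int[mu]_x (normc (phi x) ^+ 2)%:E <= ((L / t) ^+ 2)%:E)%E ->
  (\sum_(s <- box d N) (2 ^+ norm1 s)%:E *
     \int[mu]_x ((2 * L < gblock (fun x => a0 x + a1 x) s x)%R%:R)%:E <= (overlap_const / t ^+ 2)%:E)%E.
Proof.
move=> i0 p0 tf1 repr1 t0 L0 h0 hphi.
have r1_gt : 1 / 2 < r1 by rewrite r1E; move: r0_gt0; lra.
have [M [M0 bM]] := sobolev_ae_bounded r1_gt repr1.
have m1 : cmeas a1 by case: tf1.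
have p1 : periodic a1 by case: tf1.
have [i1 _] := cint_ae_bounded m1 M0 bM.
have mphi : cmeas phi by case: repr1 => -[[]].
pose n := (2 ^ N.+1)%N.
pose E s : R := L^-2 * ((2 `^ (r0 * (norm1 s)%:R)) ^+ 2 *
   \sum_(k <- boxZ d n) alpha R s k ^+ 2 * (fweight r1 k ^+ 2 * normc (fcoef phi k) ^+ 2)).
apply: (@le_trans _ _ (\sum_(s <- box d N) (2 ^+ norm1 s * E s)%:E)%E).
  rewrite big_seq [leRHS]big_seq; apply: lee_sum => s sN.
  rewrite EFinM lee_wpmul2l ?lee_fin ?exprn_ge0//.
  apply: (@le_trans _ _ (\int[mu]_x (L^-2 * gblock a1 s x ^+ 2)%:E)%E).
    have mg1 : measurable_fun setT (gblock a1 s) by exact: measurable_gblock.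
    have mg : measurable_fun setT (gblock (fun x => a0 x + a1 x) s).
      by apply: measurable_gblock; [exact: cintD|move=> i x; rewrite p0 p1].
    apply: ae_le_integral.
    - rewrite (_ : (fun _ => _) = (fun x => if (2 * L < gblock (fun x => a0 x + a1 x) s x)%R then 1 else 0)); last first.
        by apply/funext => x; case: ifP.
      by apply: measurable_fun_ifT => //; exact: measurable_fun_ltr.
    - by apply: measurable_funM => //; exact: measurable_funX.
    - by move=> x; exact: ler0n.
    - by move=> x; rewrite mulr_ge0 ?sqr_ge0// invr_ge0 sqr_ge0.
    apply: (ae_imp (h0 s)) => x h0x; case: ltrP => h; last first.
      by rewrite mulr_ge0 ?sqr_ge0// invr_ge0 sqr_ge0.
    (* Chebyshev: where the indicator is 1 the [a0] part is at most [L], so the [a1] part exceeds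
       [L]. *)
    rewrite mulrC ler_pdivlMr ?exprn_gt0// mul1r ler_sqr ?nnegrE ?gblock_ge0 ?(ltW L0)//.
    have : gblock (fun x => a0 x + a1 x) s x <= gblock a0 s x + gblock a1 s x.
      by rewrite /gblock block_opD// -mulrDr ler_wpM2l ?powR_ge0// normcD_le.
    lra.
  rewrite /E; under eq_integral do rewrite /gblock exprMn mulrA EFinM.
  rewrite ge0_integralZl//; last 3 first.
  - by apply: cmeas_normc2; exact: cmeas_block_op.
  - by move=> x _; rewrite lee_fin sqr_ge0.
  - by rewrite lee_fin mulr_ge0 ?sqr_ge0// invr_ge0 sqr_ge0.
  rewrite (parseval_block_op sN)// -EFinM lee_fin -mulrA.
  rewrite le_eqVlt; apply/orP; left; apply/eqP; congr (_ * (_ * _)).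
  apply: eq_bigr => k _; rewrite (fcoef_sobolev r1_gt tf1 repr1).
  by rewrite Normc.normcM normc_real exprMn real_normK ?num_real.
rewrite sumEFin lee_fin.
(* Bessel for [phi] yields [(L / t)^2], in which [L] cancels against the [L^-2] from Chebyshev. *)
have b := bessel mphi (boxZ_uniq d n).
have {}b : \sum_(k <- boxZ d n) normc (fcoef phi k) ^+ 2 <= (L / t) ^+ 2.
  by rewrite -lee_fin (le_trans b).
apply: (@le_trans _ _ (L^-2 * (overlap_const * \sum_(k <- boxZ d n) normc (fcoef phi k) ^+ 2))); last first.
  apply: (@le_trans _ _ (L^-2 * (overlap_const * (L / t) ^+ 2))).
    rewrite ler_wpM2l ?invr_ge0 ?sqr_ge0// ler_wpM2l// mulr_ge0 ?exprn_ge0 ?powR_ge0//.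
  by rewrite le_eqVlt; apply/orP; left; apply/eqP; field; rewrite !gt_eqF.
under eq_bigr do rewrite /E mulrCA.
rewrite -mulr_sumr ler_wpM2l ?invr_ge0 ?sqr_ge0//.
under eq_bigr do rewrite mulrA mulr_sumr.
(* Summing over [s] first lets [alpha_overlap] act on each frequency. *)
rewrite exchange_big/= mulr_sumr; apply: ler_sum => k _.
under eq_bigr do rewrite mulrA mulrA.
rewrite -mulr_suml ler_wpM2r ?sqr_ge0//; apply: le_trans (alpha_overlap N k).
by apply: ler_sum => s _; rewrite le_eqVlt; apply/orP; left; apply/eqP; ring.
Qed.

End block_operators.

(** * Strong bounds from weak bounds *)

Section layer_cake.
Variable R : realType.
Local Notation leb := (@lebesgue_measure R).

Lemma integral_pos_half_line (f : R -> R) :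
  (\int[leb]_(t in `]0%R, +oo[) (f t)%:E = \int[leb]_t (if 0 < t then f t else 0)%:E)%E.
Proof.
rewrite integral_mkcond; apply: eq_integral => t _; rewrite patchE.
by rewrite mem_setE/= in_itv/= andbT; case: ifP.
Qed.

Lemma ge0_integral_lower (f : R -> R) (a b c : R) : measurable_fun setT f ->
  (forall t, 0 <= f t) -> a < b -> 0 <= c -> (forall t, a < t <= b -> c <= f t) ->
  ((c * (b - a))%:E <= \int[leb]_t (f t)%:E)%E.
Proof.
move=> mf f0 ab c0 cf.
have mE : measurable_fun setT (fun t => (f t)%:E) by exact/measurable_EFinP.
apply: (@le_trans _ _ (\int[leb]_(t in `]a, b]) (f t)%:E)%E); last first.
  by apply: ge0_subset_integral => // t _; rewrite lee_fin.
apply: (@le_trans _ _ (\int[leb]_(t in `]a, b]) (cst c%:E t))%E).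
  by rewrite integral_cst//= lebesgue_measure_itv/= lte_fin ab -EFinB -EFinM.
apply: ge0_le_integral => //=.
exact: measurable_funTS.
Qed.

Variable k : R -> R.
Hypotheses (k_nd : {homo k : x y / x <= y}) (k_ge0 : forall t, 0 <= k t)
  (k_dbl : forall t, 0 < t -> k (2 * t) <= 2 * k t).
Variable p : R.
Hypothesis p_gt2 : 2 < p.

Let mk : measurable_fun setT k. Proof. exact: nondecreasing_measurable. Qed.

(* If [4 * k t < g <= 4 * k (2 * t)], the integral of [layer g] over [t / 2, t] is comparable to [g `^ p]. *)
Definition layer (g t : R) : R := if (0 < t) && (4 * k t < g) then k t `^ p * t `^ (-1) else 0.

Lemma layer_ge0 g t : 0 <= layer g t.
Proof. by rewrite /layer; case: ifP => // _; rewrite mulr_ge0// powR_ge0. Qed.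

Lemma measurable_layer d (T : measurableType d) (g h : T -> R) :
  measurable_fun setT g -> measurable_fun setT h ->
  measurable_fun setT (fun z => layer (g z) (h z)).
Proof.
move=> mg mh; have mkh : measurable_fun setT (fun z => k (h z)) by exact: (measurableT_comp mk mh).
apply: measurable_fun_ifT => //.
  apply: measurable_and; first exact: measurable_fun_ltr.
  by apply: measurable_fun_ltr => //; exact: measurable_funM.
apply: measurable_funM; first exact: (measurableT_comp (measurable_powR p) mkh).
exact: (measurableT_comp (measurable_powR (-1)) mh).
Qed.

(** Take the least [n] with [g <= 4 * k (2^n * t1)]; it is not 0, and the preceding point is the
    crossing. *)
Lemma exists_dyadic_crossing (g t1 t2 : R) : 0 < t1 -> 4 * k t1 < g -> g <= 4 * k t2 ->
  exists t, [/\ 0 < t, 4 * k t < g & g <= 4 * k (2 * t)].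
Proof.
move=> t10 k1 k2.
have ex : exists n : nat, g <= 4 * k (2 ^+ n * t1).
  exists (Num.bound (t2 / t1)); apply: (le_trans k2); rewrite ler_pM2l//; apply: k_nd.
  rewrite -ler_pdivrMr//; case: (leP 0 (t2 / t1)) => h; last first.
    by rewrite (le_trans (ltW h))// exprn_ge0.
  rewrite (le_trans (ltW (archi_boundP h)))//.
  by rewrite -natrX ler_nat ltnW// ltn_expl.
case: (ex_minnP ex) => -[|n]; first by rewrite expr0 mul1r leNgt k1.
move=> h mn; exists (2 ^+ n * t1); split; first by rewrite mulr_gt0// exprn_gt0.
  by rewrite ltNge; apply/negP => /mn; rewrite ltnn.
by rewrite mulrA -exprS.
Qed.

(** At a crossing [t], doubling twice gives [g <= 4 * k (4 * u) <= 16 * k u] for [u] in []t / 2,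
    t]], and this interval alone contributes at least [(g / 16)^p / 2]. *)
Lemma powR_layer (g t1 t2 : R) : 0 < t1 -> 4 * k t1 < g -> g <= 4 * k t2 ->
  ((g `^ p)%:E <= (2 * 16 `^ p)%:E * \int[leb]_t (layer g t)%:E)%E.
Proof.
move=> t10 k1 k2; have [t [t0 kt kt2]] := exists_dyadic_crossing t10 k1 k2.
have g0 : 0 <= g by rewrite (le_trans _ (ltW k1))// mulr_ge0.
have low := @ge0_integral_lower (layer g) (t / 2) t ((g / 16) `^ p * t `^ (-1)).
apply: (@le_trans _ _ ((2 * 16 `^ p)%:E * ((g / 16) `^ p * t `^ (-1) * (t - t / 2))%:E)%E).
  rewrite -EFinM lee_fin le_eqVlt; apply/orP; left; apply/eqP.
  have -> : g `^ p = 16 `^ p * (g / 16) `^ p.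
    by rewrite -powRM ?divr_ge0// mulrC divfK.
  by rewrite powR_inv1 ?ltW//; field; rewrite gt_eqF.
have c0 : 0 < 2 * 16 `^ p by rewrite mulr_gt0// powR_gt0.
rewrite lee_pmul2l ?lte_fin//.
apply: low.
- exact: measurable_layer.
- by move=> u; exact: layer_ge0.
- by lra.
- by rewrite mulr_ge0// powR_ge0.
move=> u /andP[u1 u2]; have u0 : 0 < u by lra.
have kut : k u <= k t by exact: k_nd.
rewrite /layer u0 ifT; last by rewrite /=; lra.
have ku : g / 16 <= k u.
  have h1 : k (2 * t) <= k (2 * (2 * u)) by apply: k_nd; lra.
  have h2 := k_dbl u0; have h3 : k (2 * (2 * u)) <= 2 * k (2 * u) by apply: k_dbl; lra.
  lra.
apply: ler_pM; rewrite ?powR_ge0//.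
  by apply: ge0_ler_powR; rewrite ?nnegrE ?divr_ge0//; move: p_gt2; lra.
by rewrite (powR_inv1 (ltW t0)) (powR_inv1 (ltW u0)) lef_pV2 ?posrE.
Qed.

Definition kmass : \bar R := (\int[leb]_(t in `]0%R, +oo[) (k t `^ p * t `^ (-3))%:E)%E.

(** Otherwise [k >= g / 4] on the half-line, while [t^-3] is not integrable at 0: the interval []e /
    2, e]] contributes a multiple of [e^-2]. *)
Lemma exists_small_k (g : R) : (kmass < +oo)%E -> 0 < g -> exists2 t, 0 < t & 4 * k t < g.
Proof.
move=> J g0; apply: contrapT => nex.
have kg t : 0 < t -> g / 4 <= k t.
  move=> t0; rewrite leNgt; apply/negP => kt; apply: nex; exists t => //.
  by move: kt; rewrite ltr_pdivlMr//; lra.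
have g4 : 0 < (g / 4) `^ p by rewrite powR_gt0// divr_gt0.
pose f t : R := if 0 < t then k t `^ p * t `^ (-3) else 0.
have mf : measurable_fun setT f.
  apply: measurable_fun_ifT => //; first exact: measurable_fun_ltr.
  apply: measurable_funM; first exact: (measurableT_comp (measurable_powR p) mk).
  exact: measurable_powR.
have f0 t : 0 <= f t by rewrite /f; case: ifP => // _; rewrite mulr_ge0// powR_ge0.
have low e : 0 < e -> (((g / 4) `^ p * e `^ (-3) * (e - e / 2))%:E <= kmass)%E.
  move=> e0; rewrite /kmass integral_pos_half_line; apply: (@ge0_integral_lower f) => //.
  - lra.
  - by rewrite mulr_ge0// powR_ge0.
  move=> u /andP[u1 u2]; have u0 : 0 < u by lra.
  rewrite /f u0; apply: ler_pM; rewrite ?powR_ge0//.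
    by apply: ge0_ler_powR; rewrite ?nnegrE ?divr_ge0//; [move: p_gt2; lra|exact: ltW|exact: kg].
  rewrite !(powRN _ 3) lef_pV2 ?posrE ?powR_gt0//.
  by apply: ge0_ler_powR; rewrite // nnegrE ltW.
have Jfin : kmass \is a fin_num.
  rewrite ge0_fin_numE// /kmass; apply: integral_ge0 => t _.
  by rewrite lee_fin mulr_ge0// powR_ge0.
pose J0 := fine kmass.
have low' e : 0 < e -> (g / 4) `^ p / 2 <= J0 * e ^+ 2.
  move=> e0; have := low e e0; rewrite -(fineK Jfin) lee_fin -/J0.
  have -> : (g / 4) `^ p * e `^ (-3) * (e - e / 2) = (g / 4) `^ p / 2 / e ^+ 2.
    by rewrite (@powR_invn _ e 3) ?ltW//; field; rewrite gt_eqF.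
  by rewrite ler_pdivrMr// exprn_gt0.
have J00 : 0 < J0.
  by have := low' 1 ltr01; rewrite expr1n mulr1; apply: lt_le_trans; rewrite divr_gt0.
pose c := (g / 4) `^ p / 2; have c0 : 0 < c by rewrite divr_gt0.
(* For this [e], [J0 * e^2 <= J0 * e <= c / 2], which contradicts [low']. *)
have e1 : 0 < Num.min 1 (c / (2 * J0)) by rewrite lt_min ltr01 divr_gt0// mulr_gt0.
have := low' _ e1; rewrite -/c; set e := Num.min _ _.
have he1 : e <= 1 by rewrite ge_min lexx.
have he2 : e <= c / (2 * J0) by rewrite ge_min lexx orbT.
rewrite ler_pdivlMr in he2; last by rewrite mulr_gt0.
have he0 : 0 < e := e1.
have : J0 * e ^+ 2 <= J0 * e.
  by rewrite ler_pM2l// expr2 ler_piMr// ltW.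
lra.
Qed.

Lemma measurable_ltb dT (T : measurableType dT) (u v : T -> R) :
  measurable_fun setT u -> measurable_fun setT v ->
  measurable_fun setT (fun z => (u z < v z)%R%:R : R).
Proof.
move=> mu mv; rewrite (_ : (fun _ => _) = (fun z => if (u z < v z)%R then 1 else 0)).
  by apply: measurable_fun_ifT => //; exact: measurable_fun_ltr.
by apply/funext => z; case: ifP.
Qed.

Section strong_from_weak.
Context dT (T : measurableType dT) (P : probability T R) (I : eqType) (S : seq I).
Variables (w : I -> R) (g : I -> T -> R) (C1 : R).
Hypotheses (w_gt0 : forall i, 0 < w i) (mg : forall i, measurable_fun setT (g i))
  (g_ge0 : forall i x, 0 <= g i x) (C1_gt0 : 0 < C1).
Hypothesis weak : forall t, 0 < t ->
  (\sum_(i <- S) (w i)%:E * \int[P]_x ((4 * k t < g i x)%R%:R)%:E <= (C1 / t ^+ 2)%:E)%E.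
Hypothesis J : (kmass < +oo)%E.

Let m i (t : R) : \bar R := (\int[P]_x ((4 * k t < g i x)%R%:R)%:E)%E.

Let m_ge0 i t : (0 <= m i t)%E.
Proof. by apply: integral_ge0 => x _; rewrite lee_fin ler0n. Qed.

(** This provides the [t2] of [powR_layer]. Points without one lie in every [A n], whose measure is
    at most [t0 / (n + 1)^2]; here [t0] is only the constant of the weak bound. *)
Lemma ae_dominated_by_k i t0 : 0 < t0 ->
  (forall t, 0 < t -> (m i t <= (t0 / t ^+ 2)%:E)%E) ->
  {ae P, forall x, exists t, g i x <= 4 * k t}.
Proof.
move=> t00 mi.
pose A n : set T := [set x | 4 * k n.+1%:R < g i x].
have mA n : measurable (A n).
  have mI : measurable (`]4 * k n.+1%:R, +oo[ : set R) by exact: measurable_itv.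
  have := mg i measurableT mI.
  by rewrite setTI; congr measurable; apply/seteqP; split=> x /=; rewrite in_itv/= andbT.
have PA n : (P (A n) <= (t0 / n.+1%:R ^+ 2)%:E)%E.
  apply: le_trans (mi n.+1%:R _); last by [].
  rewrite -[A n]setIT -integral_indic// /m; apply: ge0_le_integral => //=.
  - by apply/measurable_EFinP; exact: measurable_indic.
  - by apply/measurable_EFinP; exact: measurable_ltb.
  by move=> x _; rewrite lee_fin indicE ler_nat; case: (boolP (x \in A n)) => //; rewrite inE /A/= => ->.
exists (\bigcap_n A n); split.
- exact: bigcapT_measurable.
- apply/eqP; rewrite eq_le measure_ge0 andbT; apply/lee_addgt0Pr => e e0; rewrite add0e.
  pose n := Num.bound (t0 / e).
  have hn : t0 / e < n%:R by apply: archi_boundP; rewrite divr_ge0// ltW.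
  apply: (@le_trans _ _ (P (A n))).
    by apply: le_measure; rewrite ?inE//; [exact: bigcapT_measurable|move=> x; apply].
  apply: (le_trans (PA n)); rewrite lee_fin ler_pdivrMr ?exprn_gt0// mulrC -ler_pdivrMr//.
  rewrite (le_trans (ltW hn))//.
  have h1 : n%:R <= n.+1%:R :> R by rewrite ler_nat.
  by rewrite (le_trans h1)// expr2 ler_peMr// ler1n.
- move=> x /= nx n _ /=; rewrite /A/= ltNge; apply/negP => h; apply: nx.
  by exists n.+1%:R.
Qed.

Lemma strong_from_weak :
  (\sum_(i <- S) (w i)%:E * \int[P]_x (g i x `^ p)%:E <= (2 * 16 `^ p * C1)%:E * kmass)%E.
Proof.
have p0 : 0 < p by move: p_gt2; lra.
pose Cp : R := 2 * 16 `^ p; have Cp0 : 0 < Cp by rewrite mulr_gt0// powR_gt0.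
pose Phi (t : R) : R := if 0 < t then k t `^ p * t `^ (-1) else 0.
have Phi0 t : 0 <= Phi t by rewrite /Phi; case: ifP => // _; rewrite mulr_ge0// powR_ge0.
have mPhi : measurable_fun setT Phi.
  apply: measurable_fun_ifT => //; first exact: measurable_fun_ltr.
  apply: measurable_funM; last exact: measurable_powR.
  exact: (measurableT_comp (measurable_powR p) mk).
have mPhiE : measurable_fun setT (fun t => (Phi t)%:E) by exact/measurable_EFinP.
have mm i : measurable_fun setT (m i).
  apply: (@measurable_fun_fubini_tonelli_F _ _ _ _ _ P (fun z : R * T => ((4 * k z.1 < g i z.2)%R%:R)%:E)).
  - apply/measurable_EFinP; apply: measurable_ltb.
      by apply: measurable_funM => //; exact: (measurableT_comp mk).
    exact: (measurableT_comp (mg i)).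
  - by move=> z; rewrite lee_fin ler0n.
have ml i : measurable_fun setT (fun z : T * R => (layer (g i z.1) z.2)%:E).
  apply/measurable_EFinP; apply: measurable_layer => //.
  exact: (measurableT_comp (mg i)).
(* For one index: apply [powR_layer] pointwise and exchange [x] and [t] by Tonelli, which leaves the
   measures [m i t] of the level sets. *)
have one i : i \in S -> (\int[P]_x (g i x `^ p)%:E <= Cp%:E * \int[leb]_t ((Phi t)%:E * m i t))%E.
  move=> iS.
  (* The constant here depends on [i], but serves only to get [dom]; the bound itself uses the weak
     estimate for the whole sum. *)
  have wm t : 0 < t -> (m i t <= (C1 / w i / t ^+ 2)%:E)%E.
    move=> t0; have := weak t0; rewrite (big_rem i)//= => h.
    have {}h : ((w i)%:E * m i t <= (C1 / t ^+ 2)%:E)%E.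
      apply: le_trans h; rewrite leeDl//; apply: sume_ge0 => j _.
      by rewrite mule_ge0 ?lee_fin ?(ltW (w_gt0 j))// m_ge0.
    rewrite -(@lee_pmul2l _ (w i)%:E) ?lte_fin// (le_trans h)// -EFinM lee_fin.
    by rewrite le_eqVlt; apply/orP; left; apply/eqP; field; rewrite !gt_eqF.
  have dom := ae_dominated_by_k (divr_gt0 C1_gt0 (w_gt0 i)) wm.
  apply: (@le_trans _ _ (\int[P]_x (Cp%:E * \int[leb]_t (layer (g i x) t)%:E))%E).
    apply: ae_ge0_le_integral => //.
    - by move=> x _; rewrite lee_fin powR_ge0.
    - by apply/measurable_EFinP; exact: (measurableT_comp (measurable_powR p) (mg i)).
    - move=> x _; rewrite mule_ge0 ?lee_fin ?(ltW Cp0)//; apply: integral_ge0 => t _.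
      by rewrite lee_fin layer_ge0.
    - apply: emeasurable_funM => //.
      apply: (@measurable_fun_fubini_tonelli_F _ _ _ _ _ leb _ (ml i)).
      by move=> z; rewrite lee_fin layer_ge0.
    apply: (ae_imp dom) => x [t2 ht2] _.
    have [g0|] := eqVneq (g i x) 0.
      rewrite g0 powR0 ?gt_eqF// mule_ge0 ?lee_fin ?(ltW Cp0)//.
      by apply: integral_ge0 => t _; rewrite lee_fin layer_ge0.
    move=> gn0; have gp : 0 < g i x by rewrite lt_neqAle eq_sym gn0/=.
    have [t1 t10 ht1] := exists_small_k J gp.
    exact: powR_layer t10 ht1 ht2.
  rewrite ge0_integralZl//; last 3 first.
  - apply: (@measurable_fun_fubini_tonelli_F _ _ _ _ _ leb _ (ml i)).
    by move=> z; rewrite lee_fin layer_ge0.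
  - by move=> x _; apply: integral_ge0 => t _; rewrite lee_fin layer_ge0.
  - by rewrite lee_fin ltW.
  rewrite lee_pmul2l ?lte_fin//.
  rewrite (@fubini_tonelli _ _ _ _ _ P leb _ (ml i)); last by move=> z; rewrite lee_fin layer_ge0.
  rewrite le_eqVlt; apply/orP; left; apply/eqP; apply: eq_integral => t _.
  transitivity (\int[P]_x ((Phi t)%:E * ((4 * k t < g i x)%R%:R)%:E))%E.
    apply: eq_integral => x _ /=; rewrite -EFinM; congr EFin; rewrite /layer /Phi.
    by case: (0 < t); case: ltrP; rewrite ?mulr1 ?mulr0 ?mul0r.
  rewrite ge0_integralZl// ?lee_fin//.
  by apply/measurable_EFinP; exact: measurable_ltb.
have PhiG0 i t : (0 <= (w i)%:E * ((Phi t)%:E * m i t))%E.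
  by rewrite !mule_ge0 ?lee_fin ?(ltW (w_gt0 i)) ?m_ge0.
have mPhiG i : measurable_fun setT (fun t => (w i)%:E * ((Phi t)%:E * m i t))%E.
  by apply: emeasurable_funM => //; exact: emeasurable_funM.
apply: (@le_trans _ _ (Cp%:E * \int[leb]_t \sum_(i <- S) (w i)%:E * ((Phi t)%:E * m i t))%E).
  rewrite ge0_integral_sum// ge0_sume_distrr; last first.
    by move=> i _; apply: integral_ge0 => t _; exact: PhiG0.
  rewrite big_seq [leRHS]big_seq; apply: lee_sum => i iS.
  have -> : (\int[leb]_t ((w i)%:E * ((Phi t)%:E * m i t)) = (w i)%:E * \int[leb]_t ((Phi t)%:E * m i t))%E.
    have mPm : measurable_fun setT (fun t => (Phi t)%:E * m i t)%E by exact: emeasurable_funM.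
    refine (@ge0_integralZl _ _ _ leb setT measurableT _ mPm _ _ _); last by rewrite lee_fin ltW.
    by move=> t _; rewrite mule_ge0 ?lee_fin ?m_ge0.
  by rewrite muleCA lee_pmul2l ?lte_fin// one.
have -> : (2 * 16 `^ p * C1)%:E = (Cp%:E * C1%:E)%E by rewrite -EFinM.
rewrite -muleA lee_pmul2l ?lte_fin//.
(* The weak bound [C1 / t^2] turns the [t^-1] of [Phi] into [t^-3]. *)
pose Psi (t : R) : R := if 0 < t then k t `^ p * t `^ (-3) else 0.
have mPsi : measurable_fun setT (fun t => (Psi t)%:E).
  apply/measurable_EFinP; apply: measurable_fun_ifT => //; first exact: measurable_fun_ltr.
  apply: measurable_funM; last exact: measurable_powR.
  exact: (measurableT_comp (measurable_powR p) mk).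
have Psi0 t : 0 <= Psi t by rewrite /Psi; case: ifP => // _; rewrite mulr_ge0// powR_ge0.
rewrite /kmass integral_pos_half_line -/Psi.
have <- : (\int[leb]_t (C1%:E * (Psi t)%:E) = C1%:E * \int[leb]_t (Psi t)%:E)%E.
  refine (@ge0_integralZl _ _ _ leb setT measurableT _ mPsi _ _ _); last by rewrite lee_fin ltW.
  by move=> t _; rewrite lee_fin.
apply: ge0_le_integral => //.
- by move=> t _; apply: sume_ge0 => i _; exact: PhiG0.
- exact: emeasurable_sum.
- exact: emeasurable_funM.
move=> t _; rewrite /Psi; case: (ltrP 0 t) => t0; last first.
  rewrite mule0 big1// => i _; rewrite /Phi ltNge t0/= mul0e mule0//.
under eq_bigr do rewrite muleCA.
rewrite -ge0_sume_distrr; last by move=> i _; rewrite mule_ge0 ?lee_fin ?(ltW (w_gt0 i)) ?m_ge0.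
apply: (@le_trans _ _ ((Phi t)%:E * (C1 / t ^+ 2)%:E)%E); first by rewrite lee_wpmul2l ?lee_fin// weak.
rewrite /Phi t0 -!EFinM lee_fin le_eqVlt; apply/orP; left; apply/eqP.
by rewrite (powR_inv1 (ltW t0)) (@powR_invn _ t 3 (ltW t0)); field; rewrite gt_eqF.
Qed.

End strong_from_weak.

End layer_cake.

Section esum_boxes.
Variables (R : realType) (d : nat) (F : d.-tuple nat -> \bar R).
Hypothesis F0 : forall s, (0 <= F s)%E.

Lemma finite_set_box (A : set (d.-tuple nat)) : finite_set A ->
  exists N, A `<=` [set` box d N].
Proof.
move=> /finite_seqP[r ->]; exists ((\max_(s <- r) norm1 s)%N).+1 => s sr.
rewrite /= (sub_box _ (mem_box_norm1 s))// ltnS.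
exact: leq_bigmax_seq.
Qed.

(** The sum is a supremum over finite sets, and each of these lies in a box. *)
Lemma esum_box_le M : (forall N, \sum_(s <- box d N) F s <= M)%E ->
  (\esum_(s in [set: d.-tuple nat]) F s <= M)%E.
Proof.
move=> h; apply: ge_ereal_sup => _ [A [fA _] <-].
have [N AN] := finite_set_box fA; apply: le_trans (h N).
rewrite [leRHS]fsbig_seq ?box_uniq//; apply: lee_fsum_nneg_subset => //.
by move=> s; rewrite !inE => /AN.
Qed.

Lemma le_esum_box N : (\sum_(s <- box d N) F s <= \esum_(s in [set: d.-tuple nat]) F s)%E.
Proof.
apply: ereal_sup_ubound; exists [set` box d N]; first by split => //; exact: finite_seq.
by rewrite -fsbig_seq ?box_uniq.
Qed.

End esum_boxes.

(** * The K-functional of a couple of normed spaces *)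

Section K_functional_properties.
Variables (R : realType) (V : zmodType) (A0 A1 : nspace R V) (a : V).
Hypotheses (n0_ge0 : forall x, (0 <= nnorm A0 x)%E) (n1_ge0 : forall x, (0 <= nnorm A1 x)%E)
  (n0_lty : forall x, carrier A0 x -> (nnorm A0 x < +oo)%E)
  (n1_lty : forall x, carrier A1 x -> (nnorm A1 x < +oo)%E)
  (sum_a : sum_carrier A0 A1 a).
Local Notation K t := (K_functional A0 A1 t a).

Lemma K_functional_ge0 t : 0 <= t -> (0 <= K t)%E.
Proof.
move=> t0; apply: le_ereal_inf_tmp => _ [a0 [a1 [_ _ _ ->]]].
by rewrite adde_ge0// mule_ge0// lee_fin.
Qed.

Lemma K_functional_lty t : 0 <= t -> (K t < +oo)%E.
Proof.
move=> t0; have [a0 [a1 [h0 h1 aE]]] := sum_a.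
apply: (@le_lt_trans _ _ (nnorm A0 a0 + t%:E * nnorm A1 a1)%E).
  by apply: ereal_inf_lbound; exists a0, a1.
by rewrite lte_add_pinfty ?n0_lty// lte_mul_pinfty// n1_lty.
Qed.

Lemma K_functional_fin t : 0 <= t -> K t \is a fin_num.
Proof. by move=> t0; rewrite ge0_fin_numE ?K_functional_ge0 ?K_functional_lty. Qed.

Lemma le_K_functional t u : 0 <= t -> t <= u -> (K t <= K u)%E.
Proof.
move=> t0 tu; apply: le_ereal_inf_tmp => _ [a0 [a1 [h0 h1 aE ->]]].
apply: (@le_trans _ _ (nnorm A0 a0 + t%:E * nnorm A1 a1)%E).
  by apply: ereal_inf_lbound; exists a0, a1.
by rewrite leeD2l// lee_wpmul2r.
Qed.

Lemma K_functional_double t : 0 <= t -> (K (2 * t) <= 2%:E * K t)%E.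
Proof.
move=> t0; rewrite muleC -lee_pdivrMr//.
apply: le_ereal_inf_tmp => _ [a0 [a1 [h0 h1 aE ->]]].
rewrite lee_pdivrMr//.
apply: (@le_trans _ _ (nnorm A0 a0 + (2 * t)%:E * nnorm A1 a1)%E).
  by apply: ereal_inf_lbound; exists a0, a1.
rewrite [leRHS]muleC ge0_muleDr ?mule_ge0 ?lee_fin// EFinM muleA leeD2r//.
by rewrite lee_pemull// lee_fin ler1n.
Qed.

(** The value 0 off the positive half-line makes this nondecreasing on all of [R], hence
    measurable. *)
Definition Kfun (t : R) : R := if 0 < t then fine (K t) else 0.

Lemma KfunE t : 0 < t -> K t = (Kfun t)%:E.
Proof. by move=> t0; rewrite /Kfun t0 fineK// K_functional_fin// ltW. Qed.

Lemma Kfun_ge0 t : 0 <= Kfun t.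
Proof. by rewrite /Kfun; case: ltrP => // t0; rewrite fine_ge0// K_functional_ge0// ltW. Qed.

Lemma Kfun_nd : {homo Kfun : x y / x <= y}.
Proof.
move=> x y xy; case: (ltrP 0 x) => x0; last by rewrite {1}/Kfun ltNge x0 Kfun_ge0.
have y0 : 0 < y by exact: lt_le_trans xy.
by rewrite -lee_fin -!KfunE// le_K_functional// ltW.
Qed.

Lemma Kfun_double t : 0 < t -> Kfun (2 * t) <= 2 * Kfun t.
Proof.
by move=> t0; rewrite -lee_fin EFinM -!KfunE ?mulr_gt0// K_functional_double// ltW.
Qed.

(** Because [theta * p = 2], the weight [t^(- theta * p) / t] is [t^-3]. *)
Lemma interpolation_normE theta p : 0 < p -> theta = 2 / p ->
  interpolation_norm A0 A1 theta p a = (kmass Kfun p `^ p^-1)%E.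
Proof.
move=> p0 tE; rewrite /interpolation_norm /kmass; congr (_ `^ _)%E.
apply: eq_integral => t; rewrite inE/= in_itv/= andbT => t0.
rewrite KfunE// -EFinM; congr EFin.
rewrite powRM ?powR_ge0 ?Kfun_ge0// -powRrM -(powR_inv1 (ltW t0)).
rewrite mulrAC -powRD; last by rewrite (gt_eqF t0) implybT.
by rewrite mulrC; congr (_ * _ `^ _); rewrite tE; field; rewrite gt_eqF.
Qed.

End K_functional_properties.

Section interpolation_into_besov.
Variables (R : realType) (d : nat) (p r0 r1 : R).
Hypotheses (p_gt2 : 2 < p) (r0_gt0 : 0 < r0) (r1E : r1 = r0 + 1 / 2).
Local Notation mu := (torus_measure R d).
Local Notation X0 := (besov d r0 +oo%E +oo%E).
Local Notation X1 := (sobolev2 d r1).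

Lemma besovy_ge0 f : (0 <= nnorm X0 f)%E.
Proof.
apply: (@le_trans _ _ ((2 `^ (r0 * (norm1 [tuple 0%N | i < d])%:R))%:E *
   torus_norm +oo%E (block_op [tuple 0%N | i < d] f))%E).
  by rewrite mule_ge0 ?lee_fin ?powR_ge0 ?torus_norm_ge0.
by apply: ereal_sup_ubound; exists [tuple 0%N | i < d].
Qed.

Lemma sobolev2_ge0 f : (0 <= nnorm X1 f)%E.
Proof. by apply: le_ereal_inf_tmp => _ [phi _ <-]; exact: torus_norm_ge0. Qed.

Lemma besovy_lty f : carrier X0 f -> (nnorm X0 f < +oo)%E.
Proof. by case. Qed.

Lemma sobolev2_lty f : carrier X1 f -> (nnorm X1 f < +oo)%E.
Proof.
case=> _ [phi rphi]; apply: (@le_lt_trans _ _ (torus_norm 2%:E phi)).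
  by apply: ereal_inf_lbound; exists phi.
by case: rphi => -[].
Qed.

Lemma ae_bounded_Lpy f : torus_Lp +oo%E f ->
  exists M : R, 0 <= M /\ {ae mu, forall x, normc (f x) <= M}.
Proof.
move=> [tf fy]; have f0 := torus_norm_ge0 +oo%E f.
exists (fine (torus_norm +oo%E f)); split; first by rewrite fine_ge0.
by apply/torus_normy_le; rewrite fineK// ge0_fin_numE.
Qed.

Lemma sum_carrier_ae_bounded f : sum_carrier X0 X1 f -> torus_fun f /\
  exists M : R, 0 <= M /\ {ae mu, forall x, normc (f x) <= M}.
Proof.
have r1_gt : 1 / 2 < r1 by rewrite r1E; move: r0_gt0; lra.
move=> [a0 [a1 [[L0 _] [t1 [phi rphi]] ->]]].
have [M0 [M00 h0]] := ae_bounded_Lpy L0.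
have [M1 [M10 h1]] := sobolev_ae_bounded r1_gt rphi.
have [[m0 m0' p0] _] := L0; have [m1 m1' p1] := t1.
have [mr mi] := cmeasD (conj m0 m0') (conj m1 m1').
split; first by split => //= i x; rewrite /GRing.add/= p0 p1.
exists (M0 + M1); split; first exact: addr_ge0.
have := ae_and h0 h1; move/ae_imp; apply => x [hx0 hx1].
by rewrite (le_trans (normcD_le _ _))// lerD.
Qed.

Section weak_bound.
Variable a : point R d -> R[i].
Hypothesis sum_a : sum_carrier X0 X1 a.
Local Notation k := (Kfun X0 X1 a).

Let ca : cint a /\ periodic a.
Proof.
have [[mr mi pa] [M [M0 h]]] := sum_carrier_ae_bounded sum_a.
by have [ci _] := cint_ae_bounded (conj mr mi) M0 h.
Qed.

Lemma weak_bound_gt (t L : R) N : 0 < t -> k t < L ->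
  (\sum_(s <- box d N) (2 ^+ norm1 s)%:E *
     \int[mu]_x ((2 * L < gblock r0 a s x)%R%:R)%:E <= (overlap_const d r1 / t ^+ 2)%:E)%E.
Proof.
move=> t0 kL.
have k0 := Kfun_ge0 a besovy_ge0 sobolev2_ge0 t.
have L0 : 0 < L by exact: le_lt_trans kL.
have KL : (K_functional X0 X1 t a < L%:E)%E.
  by rewrite (KfunE besovy_ge0 sobolev2_ge0 besovy_lty sobolev2_lty sum_a t0) lte_fin.
have [_ [a0 [a1 [h0 h1 aE ->]]] yL] := ereal_inf_lt KL.
have n0 := besovy_ge0 a0; have n1 := sobolev2_ge0 a1.
have f0 : nnorm X0 a0 \is a fin_num by rewrite ge0_fin_numE// besovy_lty.
have f1 : nnorm X1 a1 \is a fin_num by rewrite ge0_fin_numE// sobolev2_lty.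
have sumL : fine (nnorm X0 a0) + t * fine (nnorm X1 a1) < L.
  by move: yL; rewrite -(fineK f0) -(fineK f1) -EFinM -EFinD lte_fin.
have a0L : fine (nnorm X0 a0) <= L.
  rewrite (le_trans _ (ltW sumL))// lerDl mulr_ge0 ?(ltW t0)// fine_ge0//.
have a1L : (nnorm X1 a1 < (L / t)%:E)%E.
  rewrite -(fineK f1) lte_fin ltr_pdivlMr// mulrC; apply: le_lt_trans sumL.
  by rewrite lerDr fine_ge0.
have [_ [phi rphi <-] phiL] := ereal_inf_lt a1L.
have [L0a _] := h0; have [M0 [M00 b0]] := ae_bounded_Lpy L0a.
have [[m0 m0' p0] _] := L0a.
have [i0 _] := cint_ae_bounded (conj m0 m0') M00 b0.
rewrite aE; apply: (weak_estimate r1E r0_gt0 N i0 p0 _ rphi t0 L0).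
- by case: h1.
- move=> s.
  have : ((2 `^ (r0 * (norm1 s)%:R))%:E * torus_norm +oo%E (block_op s a0) <= L%:E)%E.
    apply: (@le_trans _ _ (nnorm X0 a0)); first by apply: ereal_sup_ubound; exists s.
    by rewrite -(fineK f0) lee_fin.
  have w0 : 0 < 2 `^ (r0 * (norm1 s)%:R) :> R by rewrite powR_gt0.
  rewrite muleC -lee_pdivlMr// -EFinM => /torus_normy_le/ae_imp; apply => x.
  by rewrite ler_pdivlMr// /gblock mulrC.
- by rewrite -torus_norm2_le ?ltW// divr_gt0.
Qed.

(** If [k t > 0], take [L = 2 * k t]. If [k t = 0], let [L = 1 / (n + 1)] tend to 0 and pass to the
    limit by Fatou. *)
Lemma weak_bound t N : 0 < t ->
  (\sum_(s <- box d N) (2 ^+ norm1 s)%:E *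
     \int[mu]_x ((4 * k t < gblock r0 a s x)%R%:R)%:E <= (overlap_const d r1 / t ^+ 2)%:E)%E.
Proof.
move=> t0; have [ci pa] := ca.
have := Kfun_ge0 a besovy_ge0 sobolev2_ge0 t; rewrite le_eqVlt => /orP[/eqP k0|k0]; last first.
  have h : k t < 2 * k t by lra.
  have := weak_bound_gt N t0 h.
  by rewrite mulrA (_ : 2 * 2 = 4 :> R)//; ring.
rewrite -k0 mulr0.
pose L n : R := n.+1%:R^-1.
have L0 n : 0 < L n by rewrite invr_gt0.
have wL n := @weak_bound_gt t (L n) N t0.
pose u n x : \bar R := (\sum_(s <- box d N) 2 ^+ norm1 s * (2 * L n < gblock r0 a s x)%R%:R)%:E.
have mg s : measurable_fun setT (gblock r0 a s) by exact: measurable_gblock.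
have mu_ n : measurable_fun setT (u n).
  apply/measurable_EFinP; apply: measurable_sum => s.
  by apply: measurable_funM => //; exact: measurable_ltb.
have u0 n x : (0 <= u n x)%E.
  by rewrite lee_fin sumr_ge0// => s _; rewrite mulr_ge0// ?exprn_ge0// ler0n.
have intE (c : R) : (\int[mu]_x (\sum_(s <- box d N) 2 ^+ norm1 s * (c < gblock r0 a s x)%R%:R)%:E =
    \sum_(s <- box d N) (2 ^+ norm1 s)%:E * \int[mu]_x ((c < gblock r0 a s x)%R%:R)%:E)%E.
  under eq_integral do rewrite -sumEFin.
  rewrite ge0_integral_sum//; last first.
    by move=> s; apply/measurable_EFinP; apply: measurable_funM => //; exact: measurable_ltb.
  apply: eq_bigr => s _; under eq_integral do rewrite EFinM.
  have mi : measurable_fun setT (fun x => ((c < gblock r0 a s x)%R%:R)%:E : \bar R).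
    by apply/measurable_EFinP; exact: measurable_ltb.
  refine (@ge0_integralZl _ _ _ mu setT measurableT _ mi _ _ _); last by rewrite lee_fin exprn_ge0.
  by move=> x _; rewrite lee_fin ler0n.
rewrite -intE.
apply: (@le_trans _ _ (\int[mu]_x limn_einf (u ^~ x))%E).
  rewrite le_eqVlt; apply/orP; left; apply/eqP; apply: eq_integral => x _.
  apply/esym; suff cx : u n x @[n --> \oo] --> (\sum_(s <- box d N) 2 ^+ norm1 s * (0 < gblock r0 a s x)%R%:R)%:E.
    by rewrite (cvg_limn_einf_sup cx).1.
  apply: cvg_EFin; first exact: nearW.
  rewrite /u; elim: (box d N) => [|s S IH].
    by rewrite big_nil; under eq_fun do rewrite /= big_nil; exact: cvg_cst.
  rewrite big_cons; under eq_fun do rewrite /= big_cons.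
  apply: cvgD => //; apply: cvgM; first exact: cvg_cst.
  apply: cvg_near_cst.
  case: (ltrP 0 (gblock r0 a s x)) => g0; last first.
    by apply: nearW => n; rewrite ltNge (le_trans g0)// mulr_ge0// ltW.
  exists (Num.bound (2 / gblock r0 a s x)) => // n /= bn.
  suff -> : 2 * L n < gblock r0 a s x by [].
  rewrite /L ltr_pdivrMr// mulrC -ltr_pdivrMr//.
  rewrite (lt_le_trans (archi_boundP _))// ?divr_ge0// ?(ltW g0)//.
  by rewrite ler_nat (leq_trans bn).
apply: (le_trans (fatou _ _ _ _)) => //.
rewrite limn_einf_lim; apply: lime_le; first exact: is_cvg_einfs.
apply: nearW => n; apply: (@le_trans _ _ (\int[mu]_x u n x)%E).
  by apply: ereal_inf_lbound; exists n => //=.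
by rewrite intE; apply: wL; rewrite -k0.
Qed.

End weak_bound.

Variables (theta r : R).
Hypotheses (thetaE : theta = 2 / p) (rE : r = r0 + 1 / p).

Definition besov_sum (f : point R d -> R[i]) : \bar R :=
  (\esum_(s in [set: d.-tuple nat]) ((2 ^+ norm1 s)%:E * \int[mu]_x (gblock r0 f s x `^ p)%:E))%E.

(** Since [r * p = r0 * p + 1], the weight of the Besov norm is [2^|s|] times the one already
    contained in [gblock]. *)
Lemma besov_normE f : cint f -> periodic f ->
  besov_norm r p%:E p%:E f = (besov_sum f `^ p^-1)%E.
Proof.
move=> ci pf; have p0 : p != 0 by rewrite gt_eqF//; move: p_gt2; lra.
rewrite /besov_norm; congr (_ `^ _)%E; apply: eq_esum => s _.
rewrite [X in (_ * X)%E](torus_norm_pow (block_op s f) p0).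
under [in RHS]eq_integral do rewrite /gblock powRM ?powR_ge0 ?normc_ge0// EFinM.
have mn : measurable_fun setT (fun x => (normc (block_op s f x) `^ p)%:E).
  apply/measurable_EFinP; apply: (measurableT_comp (measurable_powR p)).
  by apply: cmeas_normc; exact: cmeas_block_op.
have -> : (\int[mu]_x ((2 `^ (r0 * (norm1 s)%:R) `^ p)%:E * (normc (block_op s f x) `^ p)%:E) =
   (2 `^ (r0 * (norm1 s)%:R) `^ p)%:E * \int[mu]_x (normc (block_op s f x) `^ p)%:E)%E.
  refine (@ge0_integralZl _ _ _ mu setT measurableT _ mn _ _ _); last by rewrite lee_fin powR_ge0.
  by move=> x _; rewrite lee_fin powR_ge0.
rewrite muleA; congr (_ * _)%E; rewrite -EFinM; congr EFin.
rewrite -powR_mulrn// -powRrM -powRD; last by rewrite pnatr_eq0 implybT.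
by congr (_ `^ _); rewrite rE; field.
Qed.

Lemma besov_term_ge0 f s : (0 <= (2 ^+ norm1 s)%:E * \int[mu]_x (gblock r0 f s x `^ p)%:E)%E.
Proof.
rewrite mule_ge0 ?lee_fin ?exprn_ge0//; apply: integral_ge0 => x _.
by rewrite lee_fin powR_ge0.
Qed.

Theorem interpolation_sub_besov : exists2 C : R, 0 < C &
  forall a, carrier (real_interpolation X0 X1 theta p) a ->
    carrier (besov d r p%:E p%:E) a /\
    (nnorm (besov d r p%:E p%:E) a <= C%:E * nnorm (real_interpolation X0 X1 theta p) a)%E.
Proof.
have p0 : 0 < p by move: p_gt2; lra.
have oc0 : 0 < overlap_const d r1 by rewrite /overlap_const mulr_gt0// ?exprn_gt0// powR_gt0// exprn_gt0.
pose C := 2 * 16 `^ p * overlap_const d r1.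
have C0 : 0 < C by rewrite !mulr_gt0// powR_gt0.
exists (C `^ p^-1); first by rewrite powR_gt0.
move=> a [sum_a ia].
have [[mr mi pa] [M [M0 bM]]] := sum_carrier_ae_bounded sum_a.
have [ci _] := cint_ae_bounded (conj mr mi) M0 bM.
have iE := interpolation_normE besovy_ge0 sobolev2_ge0 besovy_lty sobolev2_lty sum_a p0 thetaE.
pose k := Kfun X0 X1 a.
have km0 : (0 <= kmass k p)%E.
  by apply: integral_ge0 => t _; rewrite lee_fin mulr_ge0// powR_ge0.
have J : (kmass k p < +oo)%E.
  by move: ia; rewrite iE; apply: lty_poweRy; rewrite invr_eq0 gt_eqF.
have bs : (besov_sum a <= C%:E * kmass k p)%E.
  apply: esum_box_le => [s|N]; first exact: besov_term_ge0.
  have k_nd := Kfun_nd besovy_ge0 sobolev2_ge0 besovy_lty sobolev2_lty sum_a.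
  have k_ge0 := Kfun_ge0 a besovy_ge0 sobolev2_ge0.
  have k_dbl := Kfun_double besovy_ge0 sobolev2_ge0 besovy_lty sobolev2_lty sum_a.
  apply: (strong_from_weak k_nd k_ge0 k_dbl p_gt2 (P := mu) (w := fun s => 2 ^+ norm1 s) (g := gblock r0 a)) => //.
  - by move=> s; exact: measurable_gblock.
  - by move=> s x; exact: gblock_ge0.
  - by move=> t t0; exact: weak_bound.
have bs0 : (0 <= besov_sum a)%E by apply: esum_ge0 => s _; exact: besov_term_ge0.
have nle : (nnorm (besov d r p%:E p%:E) a <= (C `^ p^-1)%:E * nnorm (real_interpolation X0 X1 theta p) a)%E.
  have -> : nnorm (besov d r p%:E p%:E) a = (besov_sum a `^ p^-1)%E by exact: besov_normE.
  have -> : nnorm (real_interpolation X0 X1 theta p) a = (kmass k p `^ p^-1)%E by exact: iE.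
  rewrite -poweR_EFin -poweRM ?lee_fin ?(ltW C0)//.
  by rewrite poweR_le ?invr_gt0// mule_ge0// lee_fin ltW.
split => //; split; last first.
  apply: (le_lt_trans nle); rewrite lte_mul_pinfty ?lee_fin ?powR_ge0//.
split => //; apply: lty_torus_norm; first by rewrite gt_eqF.
apply: (@le_lt_trans _ _ (M `^ p)%:E); last exact: ltry.
rewrite -[leRHS](integral_torus_cst d); apply: (@ae_le_integral _ _ _ (fun=> M `^ p)) => //.
- by apply: (measurableT_comp (measurable_powR p)); exact: cmeas_normc (conj mr mi).
- by move=> x; exact: powR_ge0.
- by move=> x; exact: powR_ge0.
apply: (ae_imp bM) => x h; apply: ge0_ler_powR; rewrite ?nnegrE ?normc_ge0//; exact: ltW.
Qed.

End interpolation_into_besov.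

(** * From Besov to interpolation spaces *)

Lemma ge0_integralZl_real dT (T : measurableType dT) (R : realType) (m : {measure set T -> \bar R})
    (u : T -> R) (c : R) : measurable_fun setT u -> (forall x, 0 <= u x) -> 0 <= c ->
  (\int[m]_x (c * u x)%:E = c%:E * \int[m]_x (u x)%:E)%E.
Proof.
move=> mu u0 c0; under eq_integral do rewrite EFinM.
have mE : measurable_fun setT (fun x => (u x)%:E) by exact/measurable_EFinP.
refine (@ge0_integralZl _ _ _ m setT measurableT _ mE _ _ _); last by rewrite lee_fin.
by move=> x _; rewrite lee_fin.
Qed.

(** A box whose partial sum is within [e] of the total leaves at most [e] for any further term. *)
Lemma esum_tail (R : realType) d (F : d.-tuple nat -> \bar R) (e : R) :
  (forall s, (0 <= F s)%E) -> (\esum_(s in [set: d.-tuple nat]) F s < +oo)%E -> 0 < e ->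
  exists N, forall s, s \notin box d N -> (F s <= e%:E)%E.
Proof.
move=> F0 Foo e0; have fF : \esum_(s in [set: d.-tuple nat]) F s \is a fin_num.
  by rewrite ge0_fin_numE// esum_ge0.
have [_ [A [fA _] <-] hA] := ub_ereal_sup_adherent e0 fF.
have [N AN] := finite_set_box fA; exists N => s sN.
have h1 : (\esum_(s in [set: d.-tuple nat]) F s - e%:E < \sum_(s <- box d N) F s)%E.
  apply: (lt_le_trans hA); rewrite [leRHS]fsbig_seq ?box_uniq//.
  by apply: lee_fsum_nneg_subset => // t; rewrite !inE => /AN.
have h2 : (F s + \sum_(s <- box d N) F s <= \esum_(s in [set: d.-tuple nat]) F s)%E.
  have <- : (\sum_(t <- s :: box d N) F t = F s + \sum_(s <- box d N) F s)%E by rewrite big_cons.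
  apply: ereal_sup_ubound; exists [set` s :: box d N]; first by split => //; exact: finite_seq.
  by rewrite -fsbig_seq//= sN box_uniq.
have fb : \sum_(s <- box d N) F s \is a fin_num.
  rewrite ge0_fin_numE ?sume_ge0//; exact: le_lt_trans (le_esum_box F N) Foo.
move: h1 h2; rewrite -(fineK fF) -(fineK fb) -EFinB lte_fin => h1.
case: (F s) (F0 s) => [x| |]//= x0; rewrite -EFinD !lee_fin => h2; lra.
Qed.

(** If [g > e], then [g = g^(1 - p) * g^p] and [g^(1 - p) <= e^(1 - p)]. It takes the place of
    Hoelder's inequality, with [e] free. *)
Lemma powR_young (R : realType) (p g e : R) : 1 < p -> 0 <= g -> 0 < e ->
  g <= e + e `^ (1 - p) * g `^ p.
Proof.
move=> p1 g0 e0; case: (leP g e) => ge.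
  by rewrite (le_trans ge)// lerDl mulr_ge0// powR_ge0.
have gp : 0 < g by exact: lt_trans ge.
rewrite -[leLHS]add0r lerD ?(ltW e0)//.
have {1}-> : g = g `^ (1 - p) * g `^ p.
  by rewrite -powRD ?subrK ?powRr1// gt_eqF ?implybT.
rewrite ler_wpM2r ?powR_ge0// -!(opprB p 1) !powRN lef_pV2 ?posrE ?powR_gt0//.
by apply: ge0_ler_powR; rewrite ?nnegrE ?subr_ge0 ?ltW.
Qed.

Section besov_functions.
Variables (R : realType) (d : nat) (p r0 : R).
Hypotheses (p_gt2 : 2 < p) (r0_gt0 : 0 < r0).
Local Notation mu := (torus_measure R d).
Variable f : point R d -> R[i].
Hypotheses (ci : cint f) (pf : periodic f) (bf : (besov_sum p r0 f < +oo)%E).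
Local Notation g := (gblock r0 f).

Let term s : \bar R := ((2 ^+ norm1 s)%:E * \int[mu]_x (g s x `^ p)%:E)%E.

Let term_ge0 s : (0 <= term s)%E. Proof. exact: besov_term_ge0. Qed.

Lemma cint_block_op s : cint (block_op s f).
Proof.
have := cint_tpoly (boxZ d (2 ^ (norm1 s).+2)) (fun k => (alpha R s k)%:C%C * fcoef f k).
by congr cint; apply/funext => x; rewrite (block_op_tpoly _ (mem_box_norm1 s)).
Qed.

Lemma fcoef_block_op s k : fcoef (block_op s f) k = (alpha R s k)%:C%C * fcoef f k.
Proof.
pose N := maxn (norm1 s).+1 (\sum_i `|k i|).
have sN : s \in box d N by apply: (sub_box (leq_maxl _ _)); exact: mem_box_norm1.
have kN : k \in boxZ d (2 ^ N.+1).
  rewrite mem_boxZ; apply/forallP => i.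
  apply: (@leq_trans N); first by rewrite leq_max (bigD1 i)//= leq_addr orbT.
  by rewrite ltnW// (leq_trans (ltn_expl N (isT : 1 < 2)%N))// leq_exp2l.
rewrite (_ : block_op s f = tpoly (boxZ d (2 ^ N.+1)) (fun k => (alpha R s k)%:C%C * fcoef f k)).
  by rewrite fcoef_tpoly ?boxZ_uniq// kN.
by apply/funext => x; rewrite (block_op_tpoly _ sN).
Qed.

Lemma conv_bkern N s u x : s \in box d N -> cint u -> periodic u ->
  conv u (fun y => (bkern s y)%:C%C) x =
  tpoly (boxZ d (2 ^ N.+1)) (fun k => (beta R s k)%:C%C * fcoef u k) x.
Proof.
move=> sN ui up; rewrite -conv_tpoly//; congr conv; apply/funext => y.
by rewrite (bkern_tpoly _ sN).
Qed.

Lemma block_op_reproduce s x :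
  block_op s f x = conv (block_op s f) (fun y => (bkern s y)%:C%C) x.
Proof.
have sN := mem_box_norm1 s.
rewrite (conv_bkern _ sN); [|exact: cint_block_op|exact: block_op_periodic].
rewrite (block_op_tpoly _ sN)//; apply: eq_bigr => k _; congr (_ * _).
by rewrite fcoef_block_op mulrA -rmorphM beta_alpha.
Qed.

Lemma measurable_bkern s : measurable_fun setT (bkern s : point R d -> R).
Proof. exact: measurable_kern. Qed.

(** A Nikolskii inequality: write the block as its convolution with [bkern s] and split its modulus
    by [powR_young]. The part [e] meets the L_1 norm of the kernel, at most [6^d]; the part with
    [g^p] meets its supremum [20^d * 2^|s|], whose last factor completes [term s]. *)
Lemma gblock_sup_le s x (e A : R) : 0 < e -> (term s <= A%:E)%E ->
  g s x <= 2 * (e * 6 ^+ d + e `^ (1 - p) * 20 ^+ d * A).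
Proof.
move=> e0 sA; have p1 : 1 < p by move: p_gt2; lra.
have p0 : 0 <= p by lra.
pose G y := g s (point_sub x y); pose b y : R := bkern s y.
have cf := cint_block_op s; have pb := block_op_periodic s ci pf.
have mg : measurable_fun setT (g s) by exact: measurable_gblock.
have mG : measurable_fun setT G.
  exact: (measurableT_comp mg (measurable_point_sub x)).
have mb := measurable_bkern s.
have ib : cint (fun y => block_op s f (point_sub x y) * (b y)%:C%C).
  apply: (@cintMr _ _ _ _ (20 ^+ d * 2 ^+ norm1 s)).
  - exact: cint_reflect.
  - exact: cmeas_real.
  - by move=> y; rewrite normc_real; exact: bkern_sup.
have w0 : 0 < 2 `^ (r0 * (norm1 s)%:R) :> R by rewrite powR_gt0.
rewrite /g block_op_reproduce -lee_fin EFinM.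
apply: (@le_trans _ _ ((2 `^ (r0 * (norm1 s)%:R))%:E *
    (2%:E * \int[mu]_y (normc (block_op s f (point_sub x y) * (b y)%:C%C))%:E))%E).
  by rewrite lee_pmul2l ?lte_fin//; exact: le_normc_torus_integral.
rewrite muleCA EFinM lee_pmul2l//.
have mib : cmeas (fun y => block_op s f (point_sub x y) * (b y)%:C%C) by case: ib.
rewrite -ge0_integralZl_real ?(ltW w0)//; last 2 first.
- exact: cmeas_normc.
- by move=> y; exact: normc_ge0.
pose c := e `^ (1 - p) * (20 ^+ d * 2 ^+ norm1 s).
have c0 : 0 <= c by rewrite mulr_ge0 ?powR_ge0// mulr_ge0 ?exprn_ge0.
have mGr : measurable_fun setT (fun y => G y `^ p) by exact: (measurableT_comp (measurable_powR p) mG).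
have mbr : measurable_fun setT (fun y => `|b y|) by exact: measurableT_comp.
apply: (@le_trans _ _ (\int[mu]_y ((e * `|b y|)%:E + (c * G y `^ p)%:E))%E).
  apply: ae_ge0_le_integral => //.
  - move=> y _; rewrite lee_fin mulr_ge0 ?normc_ge0//; exact: ltW.
  - by apply/measurable_EFinP; apply: measurable_funM => //; exact: cmeas_normc.
  - by move=> y _; rewrite -EFinD lee_fin addr_ge0// mulr_ge0 ?powR_ge0// ltW.
  - by apply: emeasurable_funD; apply/measurable_EFinP; exact: measurable_funM.
  apply: aeW => y _; rewrite -EFinD lee_fin Normc.normcM normc_real mulrA -/(g s (point_sub x y)) -/(G y).
  have G0 : 0 <= G y by exact: gblock_ge0.
  apply: (@le_trans _ _ ((e + e `^ (1 - p) * G y `^ p) * `|b y|)).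
    by rewrite ler_wpM2r// powR_young.
  rewrite mulrDl lerD2l /c -mulrA -mulrA ler_wpM2l ?powR_ge0// mulrC ler_wpM2r ?powR_ge0//.
  exact: bkern_sup.
rewrite ge0_integralD//; last 4 first.
- by move=> y _; rewrite lee_fin mulr_ge0// ltW.
- by apply/measurable_EFinP; exact: measurable_funM.
- by move=> y _; rewrite lee_fin mulr_ge0// powR_ge0.
- by apply/measurable_EFinP; exact: measurable_funM.
rewrite EFinD; apply: leeD.
  rewrite ge0_integralZl_real// ?(ltW e0)//.
  by rewrite EFinM lee_pmul2l ?lte_fin// kern_L1.
rewrite ge0_integralZl_real//; last by move=> y; exact: powR_ge0.
have -> : (\int[mu]_y (G y `^ p)%:E = \int[mu]_y (g s y `^ p)%:E)%E.
  apply: (@integral_torus_reflect _ _ (fun y => (g s y `^ p)%:E) x).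
    by apply/measurable_EFinP; exact: (measurableT_comp (measurable_powR p) mg).
  by move=> i y; rewrite /gblock pb.
have -> : c%:E = ((e `^ (1 - p) * 20 ^+ d)%:E * (2 ^+ norm1 s)%:E)%E by rewrite -EFinM /c mulrA.
have -> : (e `^ (1 - p) * 20 ^+ d * A)%:E = ((e `^ (1 - p) * 20 ^+ d)%:E * A%:E)%E by rewrite -EFinM.
by rewrite -muleA lee_wpmul2l// lee_fin mulr_ge0 ?powR_ge0// exprn_ge0.
Qed.

Lemma gblock_bounded : exists2 M : R, 0 < M & forall s x, g s x <= M.
Proof.
have b0 : (0 <= besov_sum p r0 f)%E by apply: esum_ge0 => s _; exact: term_ge0.
have ts s : (term s <= (fine (besov_sum p r0 f))%:E)%E.
  rewrite fineK ?ge0_fin_numE//; apply: ereal_sup_ubound.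
  exists [set s]; first by split => //; exact: finite_set1.
  by rewrite fsbig_set1.
exists (2 * (1 * 6 ^+ d + 1 `^ (1 - p) * 20 ^+ d * fine (besov_sum p r0 f)) + 1) => [|s x].
  by rewrite ltr_pwDr// mulr_ge0// addr_ge0 ?mulr_ge0 ?exprn_ge0 ?powR_ge0// fine_ge0.
by apply: (le_trans (gblock_sup_le x ltr01 (ts s))); rewrite lerDl.
Qed.

(** The choices of [e] and [A] make both terms of [gblock_sup_le] equal to [l / 4]; the Besov terms
    are summable, so they are at most [A] off a box. *)
Lemma gblock_tail (l : R) : 0 < l -> exists N, forall s, s \notin box d N -> forall x, g s x <= l.
Proof.
move=> l0; pose e := l / (4 * 6 ^+ d).
have e0 : 0 < e by rewrite divr_gt0 ?mulr_gt0 ?exprn_gt0.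
pose A := l / (4 * (e `^ (1 - p) * 20 ^+ d)).
have c0 : 0 < e `^ (1 - p) * 20 ^+ d by rewrite mulr_gt0 ?powR_gt0 ?exprn_gt0.
have A0 : 0 < A by apply: divr_gt0 => //; exact: mulr_gt0.
have [N hN] := esum_tail term_ge0 bf A0; exists N => s sN x.
apply: (le_trans (gblock_sup_le x e0 (hN s sN))).
have c1 : 0 < 6 ^+ d :> R by rewrite exprn_gt0.
have -> : e * 6 ^+ d = l / 4.
  by rewrite /e; move: (6 ^+ d) c1 => z z0; field; rewrite gt_eqF.
have -> : e `^ (1 - p) * 20 ^+ d * A = l / 4.
  by rewrite /A; move: (e `^ (1 - p) * 20 ^+ d) c0 => z z0; field; rewrite gt_eqF.
by lra.
Qed.

End besov_functions.

Lemma sum_box_split (V : nmodType) d N M (F : d.-tuple nat -> V) : (N <= M)%N ->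
  \sum_(s <- box d M) F s = \sum_(s <- box d N) F s + \sum_(s <- box d M | s \notin box d N) F s.
Proof.
move=> NM; rewrite (bigID (mem (box d N)))/=; congr (_ + _).
rewrite -big_filter; apply: perm_big; apply: uniq_perm; rewrite ?filter_uniq ?box_uniq//.
by move=> s; rewrite mem_filter; apply/andP/idP => [[]//|sN]; split => //; exact: sub_box sN.
Qed.

Section geometric_boxes.
Variables (R : realType) (d : nat) (q : R).
Hypotheses (q0 : 0 < q) (q1 : q < 1).

Definition geobox N : R := \sum_(s <- box d N) q ^+ norm1 s.

Lemma geobox_le N : geobox N <= ((1 - q)^-1) ^+ d.
Proof.
have -> : geobox N = \prod_(i < d) \sum_(j < N) q ^+ j.
  rewrite -(sum_box_prod N (fun i j => q ^+ j)); apply: eq_bigr => s _.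
  by rewrite /norm1 (big_morph _ (exprD q) (expr0 q)).
rewrite -[X in _ ^+ X](card_ord d) -prodr_const; apply: ler_prod => i _.
rewrite sumr_ge0/=; last by move=> j _; rewrite exprn_ge0// ltW.
rewrite -[leRHS]mul1r ler_pdivlMr ?subr_gt0//.
have -> : (\sum_(j < N) q ^+ j) * (1 - q) = 1 - q ^+ N.
  elim: N => [|N IH]; first by rewrite big_ord0 mul0r expr0 subrr.
  by rewrite big_ord_recr/= mulrDl IH exprS; ring.
by rewrite gerBl exprn_ge0// ltW.
Qed.

Lemma geobox_nd : nondecreasing_seq geobox.
Proof.
move=> n m nm; rewrite /geobox (sum_box_split _ nm) lerDl sumr_ge0// => s _.
by rewrite exprn_ge0// ltW.
Qed.

Lemma is_cvg_geobox : cvgn geobox.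
Proof.
apply: nondecreasing_is_cvgn; first exact: geobox_nd.
by exists (((1 - q)^-1) ^+ d) => _ [n _ <-]; exact: geobox_le.
Qed.

Lemma geobox_le_lim N : geobox N <= limn geobox.
Proof. exact: nondecreasing_cvgn_le geobox_nd is_cvg_geobox N. Qed.

(* A sequence dominated by the increments of [geobox] becomes monotone after adding a multiple of [geobox]. *)
Lemma cvg_of_geobox (u : nat -> R) (M : R) : 0 <= M ->
  (forall n m, (n <= m)%N -> `|u m - u n| <= M * (geobox m - geobox n)) ->
  cvgn u /\ forall n, `|limn u - u n| <= M * (limn geobox - geobox n).
Proof.
move=> M0 h; pose v n := u n + M * geobox n.
have vnd : nondecreasing_seq v.
  move=> n m nm; rewrite /v; have := h n m nm; rewrite ler_norml => /andP[h1 _]; lra.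
have cv : cvgn v.
  apply: nondecreasing_is_cvgn => //.
  exists (u 0%N + M * (limn geobox - geobox 0%N) + M * limn geobox) => _ [n _ <-].
  have := h 0%N n (leq0n n); rewrite ler_norml => /andP[_ h1].
  have h2 : M * geobox n <= M * limn geobox by rewrite ler_wpM2l// geobox_le_lim.
  by rewrite /v; lra.
have cu : cvgn u.
  have -> : u = (fun n => v n - M * geobox n) by apply/funext => n; rewrite /v addrK.
  by apply: is_cvgB => //; apply: is_cvgM => //; [exact: is_cvg_cst|exact: is_cvg_geobox].
split=> // n; rewrite ler_norml.
have hn m : (n <= m)%N -> `|u m - u n| <= M * (limn geobox - geobox n).
  by move=> nm; rewrite (le_trans (h n m nm))// ler_wpM2l// lerD2r geobox_le_lim.
apply/andP; split.
  suff : u n - M * (limn geobox - geobox n) <= limn u by lra.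
  apply: limr_ge => //; exists n => // m /= nm.
  by have := hn m nm; rewrite ler_norml => /andP[? _]; lra.
suff : limn u <= u n + M * (limn geobox - geobox n) by lra.
apply: limr_le => //; exists n => // m /= nm.
by have := hn m nm; rewrite ler_norml => /andP[_ ?]; lra.
Qed.

End geometric_boxes.

Section besov_bounded.
Variables (R : realType) (d : nat) (p r0 : R).
Hypotheses (p_gt2 : 2 < p) (r0_gt0 : 0 < r0).
Local Notation mu := (torus_measure R d).
Variable f : point R d -> R[i].
Hypotheses (ci : cint f) (pf : periodic f) (bf : (besov_sum p r0 f < +oo)%E).

Let q : R := 2 `^ (- r0).

Let q0 : 0 < q. Proof. by rewrite powR_gt0. Qed.

Let q1 : q < 1.
Proof.
rewrite /q powRN invf_lt1 ?powR_gt0//.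
have : 1 `^ r0 < 2 `^ r0 :> R by apply: gt0_ltr_powR; rewrite ?nnegrE ?ltr1n.
by rewrite powR1.
Qed.

Lemma block_op_le (M : R) s x : gblock r0 f s x <= M -> normc (block_op s f x) <= M * q ^+ norm1 s.
Proof.
have w0 : 0 < 2 `^ (r0 * (norm1 s)%:R) :> R by rewrite powR_gt0.
rewrite /gblock mulrC -ler_pdivlMr// => h; apply: (le_trans h).
rewrite -powRN -(powR_mulrn _ (ltW q0)) /q -powRrM le_eqVlt; apply/orP; left; apply/eqP.
by congr (_ * _ `^ _); ring.
Qed.

Definition psum N x : R[i] := \sum_(s <- box d N) block_op s f x.

Lemma cint_psum N : cint (psum N).
Proof. by apply: cint_sum => s; exact: cint_block_op. Qed.

Lemma fcoef_psum k : exists N0, forall N, (N0 <= N)%N -> fcoef (psum N) k = fcoef f k.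
Proof.
exists (\sum_i `|k i|).+1%N => -[//|N] kN.
rewrite fcoef_sum; last by move=> s; exact: cint_block_op.
under eq_bigr do rewrite fcoef_block_op//.
rewrite -mulr_suml -rmorph_sum sum_alpha ?mul1r// => i.
apply: (@leq_trans N); last by rewrite ltnW// ltn_expl.
by apply: leq_trans (kN : (\sum_i `|k i| <= N)%N); rewrite (bigD1 i)//= leq_addr.
Qed.

Lemma psum_dist (M : R) n m x : (forall s x, gblock r0 f s x <= M) -> (n <= m)%N ->
  normc (psum m x - psum n x) <= M * (geobox d q m - geobox d q n).
Proof.
move=> gM nm; rewrite /psum /geobox (sum_box_split _ nm) (sum_box_split (fun s => q ^+ norm1 s) nm).
rewrite addrAC subrr add0r addrAC subrr add0r mulr_sumr (le_trans (normc_sum _ _ _))//.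
by apply: ler_sum => s _; exact: block_op_le.
Qed.

(** Block [s] is at most [M * q^|s|], so the partial sums converge uniformly to a bounded [h] with
    the Fourier coefficients of [f], and uniqueness gives [f = h] a.e. This supplies the L_oo
    membership required by the endpoint space. *)
Lemma besov_ae_bounded : exists2 M : R, 0 <= M & {ae mu, forall x, normc (f x) <= M}.
Proof.
have [M M0 gM] := gblock_bounded p_gt2 ci pf bf.
have Re_dist x n m : (n <= m)%N ->
    `|complex.Re (psum m x) - complex.Re (psum n x)| <= M * (geobox d q m - geobox d q n).
  move=> nm; apply: le_trans (psum_dist x gM nm).
  by have := Re_le_normc (psum m x - psum n x); case: (psum m x) (psum n x) => a b [u v].
have Im_dist x n m : (n <= m)%N ->
    `|complex.Im (psum m x) - complex.Im (psum n x)| <= M * (geobox d q m - geobox d q n).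
  move=> nm; apply: le_trans (psum_dist x gM nm).
  by have := Im_le_normc (psum m x - psum n x); case: (psum m x) (psum n x) => a b [u v].
pose hr x := limn (fun n => complex.Re (psum n x)).
pose hi x := limn (fun n => complex.Im (psum n x)).
pose h x : R[i] := (hr x +i* hi x)%C.
have cr x := cvg_of_geobox q0 q1 (ltW M0) (Re_dist x).
have cim x := cvg_of_geobox q0 q1 (ltW M0) (Im_dist x).
have hdist n x : normc (h x - psum n x) <= 2 * (M * (limn (geobox d q) - geobox d q n)).
  have [_ h1] := cr x; have [_ h2] := cim x.
  rewrite (le_trans (normc_le_ReIm _))//.
  have -> : complex.Re (h x - psum n x) = hr x - complex.Re (psum n x) by case: (psum n x).
  have -> : complex.Im (h x - psum n x) = hi x - complex.Im (psum n x) by case: (psum n x).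
  by rewrite mulr_natl mulr2n lerD.
have mh : cmeas h.
  split; rewrite /h/=.
    apply: (@measurable_fun_cvg _ _ _ _ (fun n x => complex.Re (psum n x))) => [n|x _].
      by have [[? ?] _] := cint_psum n.
    by have [] := cr x.
  apply: (@measurable_fun_cvg _ _ _ _ (fun n x => complex.Im (psum n x))) => [n|x _].
    by have [[? ?] _] := cint_psum n.
  by have [] := cim x.
pose C := M * geobox d q 0%N + 2 * (M * (limn (geobox d q) - geobox d q 0%N)).
have hC x : normc (h x) <= C.
  rewrite -[h x](subrK (psum 0 x)) addrC (le_trans (normcD_le _ _))// lerD//.
  rewrite (le_trans (normc_sum _ _ _))// /geobox mulr_sumr; apply: ler_sum => s _.
  exact: block_op_le.
have ih : cint h by exact: cint_bounded hC.
have fh k : fcoef h k = fcoef f k.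
  apply/eqP; rewrite -subr_eq0; apply/eqP/Normc.eq0_normc.
  apply/eqP; rewrite eq_le normc_ge0 andbT; apply/ler_addgt0Pl => e e0; rewrite addr0.
  have [N0 hN0] := fcoef_psum k.
  have /cvgrPdist_le := @is_cvg_geobox R d q q0 q1.
  (* The 4 is the factor 2 of [normc_fcoef_le] times the factor 2 of [hdist]. *)
  have e40 : 0 < e / (4 * M) by rewrite divr_gt0// mulr_gt0.
  move=> /(_ _ e40) [N1 _ hN1].
  pose N := maxn N0 N1.
  rewrite -(hN0 N (leq_maxl _ _)) -fcoefB//; last exact: cint_psum.
  have mD : cmeas (fun x => h x - psum N x) by apply: cmeasB => //; case: (cint_psum N).
  have b0 : 0 <= 2 * (M * (limn (geobox d q) - geobox d q N)).
    by rewrite !mulr_ge0 ?(ltW M0)// subr_ge0 geobox_le_lim.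
  have [cD iD] := cint_ae_bounded mD b0 (aeW _ (hdist N)).
  rewrite -lee_fin (le_trans (normc_fcoef_le _ cD))//.
  apply: (@le_trans _ _ (2%:E * (2 * (M * (limn (geobox d q) - geobox d q N)))%:E)%E).
    by rewrite lee_pmul2l.
  rewrite -EFinM lee_fin.
  have := hN1 N (leq_maxr _ _); rewrite /= ger0_norm ?subr_ge0 ?geobox_le_lim//.
  by rewrite ler_pdivlMr ?mulr_gt0//; lra.
exists C; first exact: le_trans (normc_ge0 (h [tuple of nseq d 0])) (hC _).
have cD : cint (fun x => f x - h x) by exact: cintD ci (cintN ih).
have h0 : {ae mu, forall x, f x - h x = 0}.
  by apply: fcoef_eq0_ae => // k; rewrite fcoefB// fh subrr.
by apply: (ae_imp h0) => x /eqP; rewrite subr_eq0 => /eqP ->.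
Qed.

End besov_bounded.

(** Expand the nonnegative sum of [w i * (A * b i - m)^2] and bound the total weight by [A]. *)
Lemma weighted_cauchy_schwarz (R : realFieldType) (I : eqType) (s : seq I) (w b : I -> R) (A : R) :
  0 < A -> (forall i, 0 <= w i) -> \sum_(i <- s) w i <= A ->
  (\sum_(i <- s) w i * b i) ^+ 2 <= A * \sum_(i <- s) w i * b i ^+ 2.
Proof.
move=> A0 w0 wA; set m := \sum_(i <- s) w i * b i; set q := \sum_(i <- s) _ * _ ^+ 2.
have h0 : 0 <= \sum_(i <- s) w i * (A * b i - m) ^+ 2.
  by apply: sumr_ge0 => i _; rewrite mulr_ge0// sqr_ge0.
have E z : \sum_(i <- s) w i * (A * b i - z) ^+ 2 =
    A ^+ 2 * q - 2 * A * z * (\sum_(i <- s) w i * b i) + z ^+ 2 * \sum_(i <- s) w i.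
  by rewrite /q !mulr_sumr -sumrB -big_split/=; apply: eq_bigr => i _; ring.
have h1 : m ^+ 2 * \sum_(i <- s) w i <= m ^+ 2 * A by rewrite ler_wpM2l// sqr_ge0.
have h2 : 0 <= A * (A * q - m ^+ 2).
  have -> : A * (A * q - m ^+ 2) = A ^+ 2 * q - 2 * A * m * m + m ^+ 2 * A by ring.
  by move: h0; rewrite E -/m; lra.
by move: h2; rewrite pmulr_rge0// subr_ge0.
Qed.

Section block_multipliers.
Variables (R : realType) (d : nat).
Local Notation mu := (torus_measure R d).
Local Notation freq := {ffun 'I_d -> int}.
Implicit Types (f h u : point R d -> R[i]) (s : d.-tuple nat) (k : freq).

Lemma conv_kern_le A B h (M : R) x : cmeas h -> 0 <= M -> (forall y, normc (h y) <= M) ->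
  normc (conv h (fun y => (kern A B y)%:C%C) x) <= 2 * 6 ^+ d * M.
Proof.
move=> mh M0 hM; pose K y : R := kern A B y.
have mK : measurable_fun setT K by exact: measurable_kern.
have ch : cint (fun y => h (point_sub x y)) by apply: cint_bounded (cmeas_sub x mh) _ => y; exact: hM.
have ci : cint (fun y => h (point_sub x y) * (K y)%:C%C).
  apply: (@cintMr _ _ _ _ (\prod_i (5 * (A i)%:R + 5 * (B i)%:R))) => //.
  by move=> y; rewrite normc_real; apply: kern_le.
rewrite -lee_fin (le_trans (le_normc_torus_integral ci))//.
rewrite -mulrA EFinM lee_pmul2l//.
apply: (@le_trans _ _ (\int[mu]_y (M * `|K y|)%:E)%E).
  apply: ge0_le_integral => //.
  - by move=> y _; rewrite lee_fin normc_ge0.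
  - by apply: cmeas_Enormc; case: ci.
  - by apply/measurable_EFinP; apply: measurable_funM => //; exact: measurableT_comp.
  - by move=> y _; rewrite lee_fin Normc.normcM normc_real ler_wpM2r.
rewrite ge0_integralZl_real//; last exact: measurableT_comp.
by rewrite mulrC EFinM lee_wpmul2l// kern_L1.
Qed.

Lemma boxZ_exp k s : exists N, s \in box d N /\ k \in boxZ d (2 ^ N.+1).
Proof.
pose N := maxn (norm1 s).+1 (\sum_i `|k i|); exists N; split.
  by apply: (sub_box (leq_maxl _ _)); exact: mem_box_norm1.
rewrite mem_boxZ; apply/forallP => i.
apply: (@leq_trans N); first by rewrite leq_max (bigD1 i)//= leq_addr orbT.
by rewrite ltnW// (leq_trans (ltn_expl N (isT : 1 < 2)%N))// leq_exp2l.
Qed.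

Definition bconv s u : point R d -> R[i] := conv u (fun y => (bkern s y)%:C%C).

Lemma cint_bconv s u : cint u -> periodic u -> cint (bconv s u).
Proof.
move=> ci pu; have sN := mem_box_norm1 s.
have := cint_tpoly (boxZ d (2 ^ (norm1 s).+2)) (fun k => (beta R s k)%:C%C * fcoef u k).
by congr cint; apply/funext => x; rewrite /bconv (conv_bkern _ sN).
Qed.

Lemma bconv_periodic s u : cint u -> periodic u -> periodic (bconv s u).
Proof.
by move=> ci pu i x; rewrite /bconv !(conv_bkern _ (mem_box_norm1 s))// tpoly_periodic.
Qed.

Lemma fcoef_bconv s u k : cint u -> periodic u ->
  fcoef (bconv s u) k = (beta R s k)%:C%C * fcoef u k.
Proof.
move=> ci pu; have [N [sN kN]] := boxZ_exp k s.
rewrite (_ : bconv s u = tpoly (boxZ d (2 ^ N.+1)) (fun k => (beta R s k)%:C%C * fcoef u k)).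
  by rewrite fcoef_tpoly ?boxZ_uniq// kN.
by apply/funext => x; rewrite /bconv (conv_bkern _ sN).
Qed.

Lemma block_op_sum s I (S : seq I) (F : I -> point R d -> R[i]) x :
  (forall i, cint (F i)) -> (forall i, periodic (F i)) ->
  block_op s (fun y => \sum_(i <- S) F i y) x = \sum_(i <- S) block_op s (F i) x.
Proof.
move=> ci pF; have sN := mem_box_norm1 s.
under eq_bigr do rewrite (block_op_tpoly _ sN)//.
rewrite (block_op_tpoly _ sN)//; last by move=> i y; apply: eq_bigr => j _; exact: pF.
  rewrite /tpoly exchange_big/=; apply: eq_bigr => k _.
  by rewrite fcoef_sum// mulr_sumr mulr_suml.
exact: cint_sum.
Qed.

Lemma block_op_bconv_far s' s u x : cint u -> periodic u -> ~~ near_idx s s' ->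
  block_op s' (bconv s u) x = 0.
Proof.
move=> ci pu nn; have sN := mem_box_norm1 s'.
rewrite (block_op_tpoly _ sN); [|exact: cint_bconv|exact: bconv_periodic].
rewrite /tpoly big1// => k _; rewrite fcoef_bconv// mulrA -rmorphM/=.
suff -> : alpha R s' k * beta R s k = 0 by rewrite !mul0r.
apply/eqP; rewrite mulf_eq0; apply: contraNT nn; rewrite negb_or => /andP[a0 b0].
exact: window_near (beta_window b0) (alpha_window a0).
Qed.

(** Each of the two convolutions costs a factor [2 * 6^d], and indices that are not near have no
    common frequency. *)
Lemma block_op_bconv_le s' s u (M : R) x : cint u -> periodic u -> 0 <= M ->
  (forall y, normc (u y) <= M) ->
  normc (block_op s' (bconv s u) x) <= (near_idx s s')%:R * ((2 * 6 ^+ d) ^+ 2 * M).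
Proof.
move=> ci pu M0 uM; have [nn|nn] := boolP (near_idx s s'); last first.
  by rewrite block_op_bconv_far// Normc.normc0 mul0r.
have c0 : 0 <= 2 * 6 ^+ d :> R by rewrite mulr_ge0// exprn_ge0.
rewrite mul1r expr2 -mulrA.
have -> : block_op s' (bconv s u) x =
    conv (bconv s u) (fun y => (kern (fun i => 2 ^ tnth s' i)%N (fun i => (2 ^ tnth s' i)./2) y)%:C%C) x.
  by rewrite /block_op; congr conv; apply/funext => y; rewrite blockE.
apply: conv_kern_le; [by case: (cint_bconv s ci pu)|exact: mulr_ge0|].
by move=> y; apply: conv_kern_le => //; case: ci.
Qed.

End block_multipliers.

Lemma besovy_norm_le (R : realType) d (r : R) (f : point R d -> R[i]) (M : R) :
  (forall s x, gblock r f s x <= M) -> (nnorm (besov d r +oo%E +oo%E) f <= M%:E)%E.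
Proof.
move=> fM; apply: ge_ereal_sup => _ [s _ <-].
have w0 : 0 < 2 `^ (r * (norm1 s)%:R) :> R by rewrite powR_gt0.
rewrite -lee_pdivlMl// -EFinM; apply/torus_normy_le/aeW => x.
by rewrite ler_pdivlMl//; exact: fM.
Qed.

(** * Decomposition of a Besov function at a level *)

Section level_decomposition.
Variables (R : realType) (d : nat) (p r0 r1 : R).
Hypotheses (p_gt2 : 2 < p) (r0_gt0 : 0 < r0) (r1E : r1 = r0 + 1 / 2).
Local Notation mu := (torus_measure R d).
Local Notation X0 := (besov d r0 +oo%E +oo%E).
Local Notation X1 := (sobolev2 d r1).
Local Notation freq := {ffun 'I_d -> int}.
Variable f : point R d -> R[i].
Hypotheses (ci : cint f) (pf : periodic f) (bf : (besov_sum p r0 f < +oo)%E).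
Local Notation g := (gblock r0 f).

Definition level_energy (l : R) s : \bar R :=
  (\int[mu]_x (if l < g s x then g s x ^+ 2 else 0)%:E)%E.

Variables (l : R) (N : nat) (y : R).
Hypotheses (l_gt0 : 0 < l) (tailN : forall s, s \notin box d N -> forall x, g s x <= l)
  (y_ge0 : 0 <= y)
  (energy_le : (\sum_(s <- box d N) (2 ^+ norm1 s)%:E * level_energy l s <= (y ^+ 2)%:E)%E).

(** The pointwise cut spoils the frequency localisation of the block; [bconv s] restores it. *)
Definition upper_part s x : R[i] := if l < g s x then block_op s f x else 0.
Definition lower_part s x : R[i] := if l < g s x then 0 else block_op s f x.

Lemma near_idxC (s s' : d.-tuple nat) : near_idx s s' = near_idx s' s.
Proof. by apply: eq_forallb => i; rewrite andbC. Qed.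

Lemma cint_upper_part s : cint (upper_part s).
Proof.
have cb := cint_block_op ci pf s; have mg := measurable_gblock r0 s ci pf.
have mlt : measurable_fun setT (fun x => l < g s x) by exact: measurable_fun_ltr.
apply: (@cint_le _ _ _ (fun x => (normc (block_op s f x))%:E)).
- case: (cb) => -[mr mi] _; split; rewrite /upper_part.
    rewrite (_ : (fun _ => _) = fun x => if l < g s x then complex.Re (block_op s f x) else 0).
      exact: measurable_fun_ifT.
    by apply/funext => x; case: ifP.
  rewrite (_ : (fun _ => _) = fun x => if l < g s x then complex.Im (block_op s f x) else 0).
    exact: measurable_fun_ifT.
  by apply/funext => x; case: ifP.
- by apply: cmeas_Enormc; case: cb.
- by case: cb.
by move=> x; rewrite lee_fin /upper_part; case: ifP => // _; rewrite Normc.normc0 normc_ge0.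
Qed.

Lemma periodic_gblock s : periodic (g s).
Proof. by move=> i x; rewrite /gblock block_op_periodic. Qed.

Lemma upper_part_periodic s : periodic (upper_part s).
Proof. by move=> i x; rewrite /upper_part periodic_gblock block_op_periodic. Qed.

Lemma lower_partE s : lower_part s = fun x => block_op s f x - upper_part s x.
Proof.
by apply/funext => x; rewrite /lower_part /upper_part; case: ifP; rewrite ?subrr ?subr0.
Qed.

Lemma cint_lower_part s : cint (lower_part s).
Proof.
by rewrite lower_partE; exact: cintD (cint_block_op ci pf s) (cintN (cint_upper_part s)).
Qed.

Lemma lower_part_periodic s : periodic (lower_part s).
Proof. by move=> i x; rewrite /lower_part periodic_gblock block_op_periodic. Qed.

Let q : R := 2 `^ (- r0).

Lemma lower_part_le s x : normc (lower_part s x) <= l * q ^+ norm1 s.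
Proof.
rewrite /lower_part; case: ltrP => h; last exact: block_op_le.
by rewrite Normc.normc0 mulr_ge0 ?(ltW l_gt0)// exprn_ge0// powR_ge0.
Qed.

(* The block [s] of [f] is unchanged by [bconv s], so [f] is the sum of the [bconv s] of both parts of its blocks. *)
Definition smooth_part x : R[i] := \sum_(s <- box d N) bconv s (upper_part s) x.
Definition rough_part x : R[i] := f x - smooth_part x.
Definition smooth_coef k : R[i] := \sum_(s <- box d N) (beta R s k)%:C%C * fcoef (upper_part s) k.

Lemma cint_smooth_part : cint smooth_part.
Proof. by apply: cint_sum => s; apply: cint_bconv; [exact: cint_upper_part|exact: upper_part_periodic]. Qed.

Lemma smooth_part_periodic : periodic smooth_part.
Proof.
move=> i x; apply: eq_bigr => s _.
by apply: bconv_periodic; [exact: cint_upper_part|exact: upper_part_periodic].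
Qed.

Lemma smooth_part_tpoly x : smooth_part x = tpoly (boxZ d (2 ^ N.+1)) smooth_coef x.
Proof.
rewrite /smooth_part big_seq; under eq_bigr => s sN.
  rewrite /bconv (conv_bkern _ sN); [|exact: cint_upper_part|exact: upper_part_periodic]; over.
rewrite -big_seq /tpoly exchange_big/=; apply: eq_bigr => k _.
by rewrite mulr_suml.
Qed.

Lemma fcoef_smooth_part k : fcoef smooth_part k = smooth_coef k.
Proof.
rewrite fcoef_sum; last by move=> s; apply: cint_bconv; [exact: cint_upper_part|exact: upper_part_periodic].
by apply: eq_bigr => s _; apply: fcoef_bconv; [exact: cint_upper_part|exact: upper_part_periodic].
Qed.

Lemma inv_fweight_window (s : d.-tuple nat) (k : freq) : window k s ->
  (fweight r1 k ^+ 2)^-1 <= (4 ^+ d) `^ (2 * r1) * (2 ^+ norm1 s * (2 `^ (r0 * (norm1 s)%:R)) ^+ 2) :> R.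
Proof.
move=> w; have [h _] := window_bweight R w.
have r1_ge : 0 <= 2 * r1 by rewrite r1E; move: r0_gt0; lra.
have b0 : 0 <= bweight R k by exact: le_trans ler01 (bweight_ge1 R k).
have -> : (fweight r1 k ^+ 2)^-1 = bweight R k `^ (2 * r1).
  rewrite -powR_mulrn ?powR_ge0// /fweight -powRrM -powRN; congr (_ `^ _); ring.
rewrite (exp2_weight r1E) -powRM ?exprn_ge0//.
by apply: ge0_ler_powR; rewrite ?nnegrE// mulr_ge0 ?exprn_ge0.
Qed.

Definition sobolev_repr_part : point R d -> R[i] :=
  tpoly (boxZ d (2 ^ N.+1)) (fun k => smooth_coef k / (fweight r1 k)%:C%C).

(** At most [4^d] indices have [k] in their window, so Cauchy-Schwarz moves the square inside the
    sum at that cost. On these indices [inv_fweight_window] trades the Sobolev weight for the block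
    weight. *)
Lemma sobolev_repr_coef_le k :
  normc (smooth_coef k / (fweight r1 k)%:C%C) ^+ 2 <=
  overlap_const d r1 * \sum_(s <- box d N) 2 ^+ norm1 s * (2 `^ (r0 * (norm1 s)%:R)) ^+ 2 *
     normc (fcoef (upper_part s) k) ^+ 2.
Proof.
have fw0 := fweight_gt0 r1 k.
rewrite Normc.normcM -(fmorphV (real_complex R)) normc_real exprMn real_normK ?num_real// exprVn.
have h1 : normc (smooth_coef k) <= \sum_(s <- box d N) (window k s)%:R * normc (fcoef (upper_part s) k).
  rewrite (le_trans (normc_sum _ _ _))//; apply: ler_sum => s _.
  rewrite Normc.normcM normc_real ler_wpM2r ?normc_ge0//.
  have [->|b0] := eqVneq (beta R s k) 0; first by rewrite normr0.
  by rewrite (beta_window b0) kcoef_bound.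
have h2 : normc (smooth_coef k) ^+ 2 <=
    4 ^+ d * \sum_(s <- box d N) (window k s)%:R * normc (fcoef (upper_part s) k) ^+ 2.
  apply: (@le_trans _ _ ((\sum_(s <- box d N) (window k s)%:R * normc (fcoef (upper_part s) k)) ^+ 2)).
    by rewrite ler_sqr ?nnegrE ?normc_ge0// (le_trans (normc_ge0 _) h1).
  by apply: weighted_cauchy_schwarz; rewrite ?exprn_gt0 ?card_window.
apply: (@le_trans _ _ ((4 ^+ d * \sum_(s <- box d N) (window k s)%:R * normc (fcoef (upper_part s) k) ^+ 2) *
   (fweight r1 k ^+ 2)^-1)).
  by rewrite ler_wpM2r// invr_ge0 sqr_ge0.
rewrite /overlap_const -!mulrA ler_wpM2l ?exprn_ge0// mulr_suml mulr_sumr.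
apply: ler_sum => s _; have [w|nw] := boolP (window k s); last first.
  by rewrite !mul0r !mulr_ge0 ?powR_ge0 ?exprn_ge0 ?normc_ge0 ?powR_ge0.
rewrite mul1r; apply: (le_trans (ler_wpM2l (sqr_ge0 _) (inv_fweight_window w))).
by rewrite le_eqVlt; apply/orP; left; apply/eqP; ring.
Qed.

Lemma sobolev_repr_norm :
  (\int[mu]_x (normc (sobolev_repr_part x) ^+ 2)%:E <= (overlap_const d r1 * y ^+ 2)%:E)%E.
Proof.
have o0 : 0 <= overlap_const d r1 :> R by rewrite mulr_ge0 ?powR_ge0 ?exprn_ge0.
rewrite parseval_tpoly ?boxZ_uniq//.
apply: (@le_trans _ _ ((overlap_const d r1)%:E * \sum_(s <- box d N) (2 ^+ norm1 s)%:E * level_energy l s)%E);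
  last by rewrite (EFinM (overlap_const d r1) (y ^+ 2)) lee_wpmul2l ?lee_fin.
apply: (@le_trans _ _ ((overlap_const d r1)%:E * (\sum_(s <- box d N) 2 ^+ norm1 s * ((2 `^ (r0 * (norm1 s)%:R)) ^+ 2 *
     \sum_(k <- boxZ d (2 ^ N.+1)) normc (fcoef (upper_part s) k) ^+ 2))%:E)%E).
  rewrite -EFinM lee_fin.
  apply: (@le_trans _ _ (\sum_(k <- boxZ d (2 ^ N.+1)) overlap_const d r1 * \sum_(s <- box d N)
      2 ^+ norm1 s * (2 `^ (r0 * (norm1 s)%:R)) ^+ 2 * normc (fcoef (upper_part s) k) ^+ 2)).
    by apply: ler_sum => k _; exact: sobolev_repr_coef_le.
  rewrite -mulr_sumr ler_wpM2l// exchange_big/=; apply: ler_sum => s _.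
  by rewrite -mulr_sumr mulrA.
rewrite -sumEFin lee_wpmul2l ?lee_fin//; apply: lee_sum => s _.
rewrite EFinM lee_wpmul2l ?lee_fin ?exprn_ge0//.
have mv : cmeas (upper_part s) by case: (cint_upper_part s).
(* A cut block need not be a polynomial, but Bessel still bounds its coefficients on the frequency
   box. *)
have b := bessel mv (boxZ_uniq d (2 ^ N.+1)).
rewrite EFinM (@le_trans _ _ ((2 `^ (r0 * (norm1 s)%:R) ^+ 2)%:E * \int[mu]_x (normc (upper_part s x) ^+ 2)%:E)%E)//.
  by rewrite lee_wpmul2l ?lee_fin ?sqr_ge0.
rewrite -ge0_integralZl_real ?sqr_ge0//; last 2 first.
- by apply/measurable_EFinP; exact: cmeas_normc2.
- by move=> x; exact: sqr_ge0.
rewrite le_eqVlt; apply/orP; left; apply/eqP/eq_integral => x _.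
rewrite /upper_part /gblock; case: ifP => _; first by rewrite -exprMn.
by rewrite Normc.normc0 expr0n/= mulr0.
Qed.

Lemma sobolev_repr_smooth : sobolev_repr r1 smooth_part sobolev_repr_part.
Proof.
have r1_gt : 1 / 2 < r1 by rewrite r1E; move: r0_gt0; lra.
split; last by apply: aeW => x; rewrite sobolev_tpoly// smooth_part_tpoly.
split; first by have [mr mi] := cmeas_tpoly (boxZ d (2 ^ N.+1)) (fun k => smooth_coef k / (fweight r1 k)%:C%C);
  split => // i x; exact: tpoly_periodic.
apply: lty_torus_norm => //; rewrite integral_normc2E.
exact: le_lt_trans sobolev_repr_norm (ltry _).
Qed.

(** Block [s'] sees only frequencies up to [2^(N'+1)], where the [alpha] over the box of size
    [N' + 2] add up to 1; there the coefficients of [f] are those of the sum of its blocks. Since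
    [beta * alpha = alpha], subtracting the upper parts leaves the lower ones, and outside [box d N]
    the upper parts vanish. *)
Lemma block_op_rough s' x : exists M,
  block_op s' rough_part x = \sum_(s <- box d M) block_op s' (bconv s (lower_part s)) x.
Proof.
pose N' := maxn N (norm1 s').+1; exists N'.+2.
have sN : s' \in box d N' by apply: (sub_box (leq_maxr _ _)); exact: mem_box_norm1.
have cb s : cint (bconv s (lower_part s)).
  by apply: cint_bconv; [exact: cint_lower_part|exact: lower_part_periodic].
have pb s : periodic (bconv s (lower_part s)).
  by apply: bconv_periodic; [exact: cint_lower_part|exact: lower_part_periodic].
rewrite -block_op_sum// !(block_op_tpoly _ sN); last 4 first.
- exact: cint_sum.
- by move=> i z; apply: eq_bigr => s _; exact: pb.
- exact: cintD ci (cintN cint_smooth_part).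
- by move=> i z; rewrite /rough_part pf smooth_part_periodic.
apply: eq_tpoly => k; rewrite mem_boxZ => /forallP kn; congr (_ * _).
rewrite fcoefB//; last exact: cint_smooth_part.
rewrite fcoef_smooth_part fcoef_sum//.
have cl := cint_lower_part; have pl := lower_part_periodic.
under [RHS]eq_bigr do rewrite fcoef_bconv//.
under [RHS]eq_bigr.
  move=> s _; rewrite lower_partE fcoefB; [|exact: cint_block_op|exact: cint_upper_part].
  rewrite mulrBr fcoef_block_op// mulrA -rmorphM/= beta_alpha; over.
rewrite sumrB -mulr_suml -rmorph_sum/= sum_alpha// mul1r; congr (_ - _).
have NN : (N <= N'.+2)%N by rewrite /N' (leq_trans (leq_maxl N (norm1 s').+1))// ltnW.
rewrite (sum_box_split _ NN)/= [X in _ + X]big1 ?addr0// => s snN.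
suff -> : upper_part s = (fun=> 0).
  by rewrite /fcoef; under eq_torus_integral do rewrite mul0r; rewrite torus_integral0 mulr0.
by apply/funext => z; rewrite /upper_part ltNge tailN.
Qed.

(** The number of near indices, the cost of two convolutions, and the largest ratio of the weights
    of near indices. *)
Definition rough_const : R := 7 ^+ d * ((2 * 6 ^+ d) ^+ 2 * (2 `^ r0) ^+ (3 * d)).

Lemma gblock_rough_le s' x : gblock r0 rough_part s' x <= rough_const * l.
Proof.
have [M EM] := block_op_rough s' x; pose B : R := 2 `^ r0.
have B1 : 1 <= B by rewrite -[leLHS](powRr0 2) ler_powR ?ler1n// ltW.
have B0 : 0 < B by exact: lt_le_trans B1.
have wE (n : nat) : 2 `^ (r0 * n%:R) = B ^+ n :> R by rewrite powRrM powR_mulrn ?powR_ge0.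
have qE : q = B^-1 by rewrite /q powRN.
rewrite /gblock EM wE.
apply: (@le_trans _ _ (B ^+ norm1 s' * \sum_(s <- box d M) (near_idx s s')%:R * ((2 * 6 ^+ d) ^+ 2 * (l * q ^+ norm1 s)))).
  rewrite ler_wpM2l ?exprn_ge0 ?(ltW B0)//; rewrite (le_trans (normc_sum _ _ _))//.
  apply: ler_sum => s _; apply: block_op_bconv_le.
  - exact: cint_lower_part.
  - exact: lower_part_periodic.
  - by rewrite mulr_ge0 ?(ltW l_gt0)// exprn_ge0// powR_ge0.
  - exact: lower_part_le.
rewrite /rough_const -mulrA.
apply: (@le_trans _ _ (\sum_(s <- box d M) (near_idx s' s)%:R * ((2 * 6 ^+ d) ^+ 2 * B ^+ (3 * d) * l))); last first.
  rewrite -mulr_suml ler_wpM2r ?card_near//.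
  by rewrite !mulr_ge0 ?exprn_ge0 ?mulr_ge0 ?exprn_ge0 ?(ltW B0) ?(ltW l_gt0).
rewrite mulr_sumr; apply: ler_sum => s _; rewrite near_idxC.
have [nn|nn] := boolP (near_idx s' s); last by rewrite !mul0r mulr0.
have hw : B ^+ norm1 s' * q ^+ norm1 s <= B ^+ (3 * d).
  rewrite qE exprVn ler_pdivrMr ?exprn_gt0// -exprD ler_weXn2l//.
  by rewrite addnC norm1_near// near_idxC.
rewrite !mul1r; have c0 : 0 <= (2 * 6 ^+ d) ^+ 2 :> R by exact: sqr_ge0.
move: c0 hw l_gt0; clear; move: ((2 * 6 ^+ d) ^+ 2) (B ^+ norm1 s') (q ^+ norm1 s) (B ^+ (3 * d)) => c b e D c0 hw l0.
have -> : b * (c * (l * e)) = c * l * (b * e) by ring.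
have -> : c * D * l = c * l * D by ring.
by rewrite ler_wpM2l// mulr_ge0// ltW.
Qed.

Lemma carrier_smooth : carrier X1 smooth_part.
Proof.
split; last by exists sobolev_repr_part; exact: sobolev_repr_smooth.
have [[mr mi] _] := cint_smooth_part.
by split; [exact: mr|exact: mi|exact: smooth_part_periodic].
Qed.

Lemma besov_norm_rough : (nnorm X0 rough_part <= (rough_const * l)%:E)%E.
Proof. by apply: besovy_norm_le => s x; exact: gblock_rough_le. Qed.

Lemma carrier_rough : carrier X0 rough_part.
Proof.
split; last exact: le_lt_trans besov_norm_rough (ltry _).
have [[fr fi] _] := ci; have [[sr si] _] := cint_smooth_part.
have [mr mi] : cmeas rough_part by exact: cmeasB.
split.
  by split; [exact: mr|exact: mi|move=> i x; rewrite /rough_part pf smooth_part_periodic].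
have [M M0 fM] := besov_ae_bounded p_gt2 r0_gt0 ci pf bf.
pose T := \sum_(k <- boxZ d (2 ^ N.+1)) normc (smooth_coef k).
apply: (@le_lt_trans _ _ (M + T)%:E); last exact: ltry.
apply/torus_normy_le; apply: (ae_imp fM) => x fx.
by rewrite (le_trans (normcB_le _ _))// lerD// smooth_part_tpoly normc_tpoly_le.
Qed.

Lemma level_decomposition t : 0 < t ->
  sum_carrier X0 X1 f /\
  (K_functional X0 X1 t f <= (rough_const * l + t * (Num.sqrt (overlap_const d r1) * y))%:E)%E.
Proof.
move=> t0; have c0 := carrier_rough; have c1 := carrier_smooth.
have fE : f = rough_part + smooth_part.
  by apply/funext => x; rewrite -[LHS](subrK (smooth_part x)).
split; first by exists rough_part, smooth_part.
apply: (@le_trans _ _ (nnorm X0 rough_part + t%:E * nnorm X1 smooth_part)%E).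
  by apply: ereal_inf_lbound; exists rough_part, smooth_part.
rewrite EFinD leeD ?besov_norm_rough// EFinM lee_wpmul2l ?lee_fin ?(ltW t0)//.
apply: (@le_trans _ _ (torus_norm 2%:E sobolev_repr_part)).
  by apply: ereal_inf_lbound; exists sobolev_repr_part => //; exact: sobolev_repr_smooth.
have o0 : 0 <= overlap_const d r1 :> R by rewrite mulr_ge0 ?powR_ge0 ?exprn_ge0.
rewrite torus_norm2_le ?mulr_ge0 ?sqrtr_ge0// exprMn sqr_sqrtr//.
exact: sobolev_repr_norm.
Qed.

End level_decomposition.

(** * Integrating a bound given at all levels *)

Section upper_layer.
Variable R : realType.
Local Notation leb := (@lebesgue_measure R).

Lemma integral_inv_cube (a : R) : 0 < a ->
  (\int[leb]_t (if a < t then t `^ (-3) else 0)%:E <= (2^-1 / a ^+ 2)%:E)%E.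
Proof.
move=> a0; pose F (t : R) : R := - 2^-1 * (t^-1) ^+ 2; pose f (t : R) : R := (t^-1) ^+ 3.
have dF (x : R) : 0 < x -> is_derive x 1 F (f x).
  move=> x0; have xn : x != 0 by rewrite gt_eqF.
  have dV : is_derive x 1 (fun t : R => t^-1) (- (x ^- 2)).
    by have := @is_deriveV _ id x 1 1 (lt0r_neq0 x0) (is_derive_id _ _); rewrite /GRing.scale/= mulr1.
  have dX := is_deriveZ (- 2^-1) (is_deriveX 2 dV).
  apply: (is_derive_eq dX); rewrite /f /GRing.scale/=; field.
  exact: xn.
have contV n (x : R) : 0 < x -> {for x, continuous (fun t : R => t^-1 ^+ n)}.
  move=> x0; apply: (@continuous_comp _ _ _ (fun t : R => t^-1) (fun t => t ^+ n)).
    by apply: inv_continuous; rewrite gt_eqF.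
  exact: exprn_continuous.
have contF (x : R) : 0 < x -> {for x, continuous F}.
  by move=> x0; apply: cvgM; [exact: cvg_cst|exact: contV].
have cw : {within `[a, +oo[, continuous f}.
  apply/continuous_within_itvcyP; split.
    by move=> x; rewrite in_itv/= andbT => ax; apply: contV; exact: lt_trans ax.
  by apply: cvg_at_right_filter; exact: contV.
have -> : (\int[leb]_t (if a < t then t `^ (-3) else 0)%:E = \int[leb]_(t in `]a, +oo[) (f t)%:E)%E.
  rewrite [RHS]integral_mkcond; apply: eq_integral => t _; rewrite patchE.
  rewrite mem_setE/= in_itv/= andbT; case: ltrP => // at0; congr EFin.
  by rewrite (@powR_invn _ t 3) ?(ltW (lt_trans a0 at0))// /f exprVn.
(* Closing the left end puts the integral in the form of the fundamental theorem of calculus. *)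
apply: (@le_trans _ _ (\int[leb]_(t in `[a, +oo[) (f t)%:E)%E).
  apply: ge0_subset_integral => //=.
  - by apply/measurable_EFinP; exact: subspace_continuous_measurable_fun.
  - by move=> t /=; rewrite in_itv/= andbT => at0; rewrite lee_fin exprn_ge0// invr_ge0 (le_trans (ltW a0)).
  - by apply: subset_itvr; rewrite bnd_simp.
rewrite (@ge0_continuous_FTC2y _ f F a 0).
- rewrite sub0e lee_fin /F exprVn; lra.
- by move=> x ax; rewrite exprn_ge0// invr_ge0 (le_trans (ltW a0)).
- exact: cw.
- rewrite -(mulr0 (- 2^-1)); apply: cvgM; first exact: cvg_cst.
  have <- : 0 ^+ 2 = 0 :> R by rewrite expr0n.
  apply: (@cvg_comp _ _ _ (fun t : R => t^-1) (fun t => t ^+ 2)); last exact: exprn_continuous.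
  by apply/gtr0_cvgV0 => //; exact: nbhs_pinfty_gt.
- by move=> x ax; have [] := dF x (lt_trans a0 ax).
- by apply: cvg_at_right_filter; exact: contF.
- move=> x; rewrite in_itv/= andbT => ax; rewrite derive1E; have := dF x (lt_trans a0 ax).
  by move=> h; rewrite derive_val.
Qed.
Variables (k e : R -> R) (p C : R).
Hypotheses (k_nd : {homo k : x y / x <= y}) (k_ge0 : forall t, 0 <= k t)
  (me : measurable_fun setT e) (e_ge0 : forall u, 0 <= e u) (p_gt2 : 2 < p) (C_gt0 : 0 < C).
(** Levels are written [l = u^m]; since [u = l^(p - 2)], the measure [l^(p - 3) dl] becomes a
    multiple of [du]. *)
Let m : R := (p - 2)^-1.
(** In terms of the level: once [t * sqrt (e u)] is at most [l], [k t] is at most [C * l]. *)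
Hypothesis k_le : forall t u, 0 < t -> 0 < u -> t ^+ 2 * e u <= u `^ (2 * m) -> k t <= C * u `^ m.

Let m_gt0 : 0 < m. Proof. by rewrite invr_gt0 subr_gt0. Qed.

Let mk : measurable_fun setT k. Proof. exact: nondecreasing_measurable. Qed.

Definition uplayer (t u : R) : R := if (0 < u) && (u `^ (2 * m) < t ^+ 2 * e u) then u `^ (2 * m) else 0.

Lemma uplayer_ge0 t u : 0 <= uplayer t u.
Proof. by rewrite /uplayer; case: ifP => // _; exact: powR_ge0. Qed.

Lemma measurable_uplayer d (T : measurableType d) (v w : T -> R) :
  measurable_fun setT v -> measurable_fun setT w ->
  measurable_fun setT (fun z => uplayer (v z) (w z)).
Proof.
move=> mv mw; have mp : measurable_fun setT (fun z => w z `^ (2 * m)).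
  exact: (measurableT_comp (measurable_powR (2 * m)) mw).
apply: measurable_fun_ifT => //.
apply: measurable_and; first exact: measurable_fun_ltr.
apply: measurable_fun_ltr => //; apply: measurable_funM; first exact: measurable_funX.
exact: (measurableT_comp me mw).
Qed.

Definition uplayer_const : R := C `^ p * 4 `^ (1 + 2 * m).

Lemma uplayer_const_gt0 : 0 < uplayer_const.
Proof. by rewrite mulr_gt0 ?powR_gt0. Qed.

(** Let [C * b^m = k t]. For [u < b] the premise of [k_le] must fail, so [uplayer t u = u^(2 m)];
    integrating over []b / 4, b / 2]] gives at least [(b / 4)^(1 + 2 m)], and
    [(p - 2) * (1 + 2 m) = p]. *)
Lemma powR_uplayer t : 0 < t ->
  ((k t `^ p)%:E <= uplayer_const%:E * \int[leb]_u (uplayer t u)%:E)%E.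
Proof.
move=> t0; have c0 := uplayer_const_gt0; have p0 : p != 0 by apply/eqP; move: p_gt2; lra.
have [->|kn] := eqVneq (k t) 0.
  rewrite powR0// mule_ge0 ?lee_fin ?(ltW c0)//.
  by apply: integral_ge0 => u _; rewrite lee_fin uplayer_ge0.
have k0 : 0 < k t by rewrite lt_neqAle eq_sym kn k_ge0.
pose b : R := (k t / C) `^ (p - 2).
have kC0 : 0 < k t / C by rewrite divr_gt0.
have b0 : 0 < b by rewrite powR_gt0.
have mE : (p - 2) * m = 1 by rewrite /m divff// subr_eq0 gt_eqF.
have bm : b `^ m = k t / C by rewrite /b -powRrM mE powRr1// ltW.
have m2 : 0 <= 2 * m by rewrite mulr_ge0// ltW.
have low := @ge0_integral_lower _ (uplayer t) (b / 4) (b / 2) ((b / 4) `^ (2 * m)).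
apply: (@le_trans _ _ (uplayer_const%:E * ((b / 4) `^ (2 * m) * (b / 2 - b / 4))%:E)%E); last first.
  rewrite lee_pmul2l ?lte_fin//; apply: low.
  - exact: measurable_uplayer.
  - by move=> u; exact: uplayer_ge0.
  - lra.
  - exact: powR_ge0.
  move=> u /andP[u1 u2]; have u0 : 0 < u by lra.
  rewrite /uplayer u0/= ifT.
    by apply: ge0_ler_powR; rewrite ?nnegrE; lra.
  rewrite ltNge; apply/negP => /(k_le t0 u0).
  apply/negP; rewrite -ltNge mulrC -ltr_pdivlMr// -bm.
  by apply: gt0_ltr_powR; rewrite ?nnegrE//; lra.
rewrite -EFinM lee_fin le_eqVlt; apply/orP; left; apply/eqP.
have -> : b / 2 - b / 4 = (b / 4) `^ 1 by rewrite powRr1 ?divr_ge0 ?(ltW b0)//; lra.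
rewrite -powRD; last by apply/implyP => _; rewrite gt_eqF// divr_gt0.
rewrite /uplayer_const -mulrA (addrC (2 * m)) -powRM ?divr_ge0 ?(ltW b0)//.
rewrite mulrCA divff// mulr1 /b -powRrM.
have -> : (p - 2) * (1 + 2 * m) = p by rewrite mulrDr mulr1 mulrCA mE; ring.
by rewrite -powRM ?(ltW C_gt0) ?(ltW kC0)// mulrCA divff ?mulr1// gt_eqF.
Qed.

(** After Tonelli, for fixed [u] only [t > a = u^m / sqrt (e u)] count; the integral of [t^-3]
    beyond [a] is [1 / (2 a^2) = e u / (2 u^(2 m))], and the factor [u^(2 m)] cancels. *)
Lemma kmass_le : (kmass k p <= uplayer_const%:E * \int[leb]_u (if 0 < u then e u else 0)%:E)%E.
Proof.
have c0 := uplayer_const_gt0.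
pose w (t : R) : R := if 0 < t then t `^ (-3) else 0.
have w0 t : 0 <= w t by rewrite /w; case: ifP => // _; exact: powR_ge0.
have mw : measurable_fun setT w.
  by apply: measurable_fun_ifT => //; exact: measurable_fun_ltr.
pose L (z : R * R) : R := w z.1 * uplayer z.1 z.2.
have L0 z : 0 <= L z by rewrite mulr_ge0 ?uplayer_ge0.
have mL : measurable_fun setT (fun z => (L z)%:E).
  apply/measurable_EFinP; apply: measurable_funM; last exact: measurable_uplayer.
  exact: (measurableT_comp mw).
have mLt : measurable_fun setT (fun t => \int[leb]_u (L (t, u))%:E)%E.
  by apply: (@measurable_fun_fubini_tonelli_F _ _ _ _ _ leb (fun z => (L z)%:E)) => // z; rewrite lee_fin.
have iL0 t : (0 <= \int[leb]_u (L (t, u))%:E)%E by apply: integral_ge0 => u _; rewrite lee_fin.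
apply: (@le_trans _ _ (\int[leb]_t (uplayer_const%:E * \int[leb]_u (L (t, u))%:E))%E).
  rewrite /kmass integral_pos_half_line; apply: ge0_le_integral => //.
  - by move=> t _; rewrite lee_fin; case: ifP => // _; rewrite mulr_ge0// powR_ge0.
  - apply/measurable_EFinP; apply: measurable_fun_ifT => //; first exact: measurable_fun_ltr.
    apply: measurable_funM; last exact: measurable_powR.
    exact: (measurableT_comp (measurable_powR p) mk).
  - exact: emeasurable_funM.
  move=> t _; case: ltrP => t0; last by rewrite mule_ge0 ?lee_fin ?(ltW c0).
  rewrite /L/= ge0_integralZl_real//; last 2 first.
  - exact: measurable_uplayer.
  - by move=> u; exact: uplayer_ge0.
  rewrite /w t0 mulrC EFinM muleCA lee_wpmul2l ?lee_fin ?powR_ge0//.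
  exact: powR_uplayer.
have -> : (\int[leb]_t (uplayer_const%:E * \int[leb]_u (L (t, u))%:E) =
    uplayer_const%:E * \int[leb]_t \int[leb]_u (L (t, u))%:E)%E.
  by refine (@ge0_integralZl _ _ _ leb setT measurableT _ mLt _ _ _) => //; rewrite lee_fin ltW.
rewrite lee_pmul2l ?lte_fin//.
rewrite (@fubini_tonelli _ _ _ _ _ leb leb (fun z => (L z)%:E))//.
have mLu : measurable_fun setT (fun u => \int[leb]_t (L (t, u))%:E)%E.
  by apply: (@measurable_fun_fubini_tonelli_G _ _ _ _ _ leb (fun z => (L z)%:E)) => // z; rewrite lee_fin.
apply: ge0_le_integral => //.
- by move=> u _; apply: integral_ge0 => t _; rewrite lee_fin.
- by apply/measurable_EFinP; apply: measurable_fun_ifT => //; exact: measurable_fun_ltr.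
move=> u _; case: ltrP => u0; last first.
  rewrite integral0_eq// => t _; rewrite /L /uplayer/= ltNge u0/= mulr0//.
have [e0|en] := eqVneq (e u) 0.
  rewrite integral0_eq ?lee_fin// => t _.
  by rewrite /L /uplayer/= e0 mulr0 (le_gtF (powR_ge0 _ _)) andbF mulr0.
have eu0 : 0 < e u by rewrite lt_neqAle eq_sym en e_ge0.
pose a : R := u `^ m / Num.sqrt (e u).
have se0 : 0 < Num.sqrt (e u) by rewrite sqrtr_gt0.
have a0 : 0 < a by rewrite divr_gt0 ?powR_gt0.
have um : u `^ (2 * m) = (u `^ m) ^+ 2 by rewrite mulrC powRrM powR_mulrn ?powR_ge0.
have a2 : a ^+ 2 = u `^ (2 * m) / e u by rewrite /a expr_div_n -um sqr_sqrtr// ltW.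
have LE t : L (t, u) = u `^ (2 * m) * (if a < t then t `^ (-3) else 0).
  rewrite /L /uplayer /w/= u0/=; case: (ltrP 0 t) => t0; last first.
    by rewrite mul0r (le_gtF (le_trans t0 (ltW a0))) mulr0.
  have -> : (u `^ (2 * m) < t ^+ 2 * e u) = (a < t).
    by rewrite -ltr_pdivrMr// -a2 ltr_sqr ?nnegrE ?ltW.
  by case: ltrP; rewrite ?mulr0// mulrC.
under eq_integral do rewrite LE.
rewrite ge0_integralZl_real ?powR_ge0//; last 2 first.
- by apply: measurable_fun_ifT => //; exact: measurable_fun_ltr.
- by move=> t; case: ifP => // _; exact: powR_ge0.
apply: (@le_trans _ _ ((u `^ (2 * m))%:E * (2^-1 / a ^+ 2)%:E)%E).
  by rewrite lee_wpmul2l ?lee_fin ?powR_ge0// integral_inv_cube.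
have u2 : 0 < u `^ (2 * m) by rewrite powR_gt0.
rewrite -EFinM lee_fin a2.
have -> : u `^ (2 * m) * (2^-1 / (u `^ (2 * m) / e u)) = e u / 2.
  by field; rewrite !gt_eqF.
by rewrite ler_pdivrMr// ler_peMr ?ler1n.
Qed.

End upper_layer.

(** * The energy of the blocks above a level *)

Section energy_of_levels.
Variables (R : realType) (d : nat) (p r0 r1 : R).
Hypotheses (p_gt2 : 2 < p) (r0_gt0 : 0 < r0) (r1E : r1 = r0 + 1 / 2).
Local Notation mu := (torus_measure R d).
Local Notation leb := (@lebesgue_measure R).
Local Notation X0 := (besov d r0 +oo%E +oo%E).
Local Notation X1 := (sobolev2 d r1).
Let m : R := (p - 2)^-1.

Let m_gt0 : 0 < m. Proof. by rewrite invr_gt0 subr_gt0. Qed.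

(* The level [l] is parametrised as [u `^ m] so that integrating over [u] produces the power [p]. *)
Definition truncated_square (u a : R) : R := if (0 < u) && (u `^ m < a) then a ^+ 2 else 0.

Lemma truncated_square_ge0 u a : 0 <= truncated_square u a.
Proof. by rewrite /truncated_square; case: ifP => // _; exact: sqr_ge0. Qed.

Lemma lt_level u a : 0 < u -> 0 < a -> (u `^ m < a) = (u < a `^ (p - 2)).
Proof.
move=> u0 a0; have p2 : 0 < p - 2 by rewrite subr_gt0.
have mE : (p - 2) * m = 1 by rewrite /m divff// gt_eqF.
have aE : a = (a `^ (p - 2)) `^ m by rewrite -powRrM mE powRr1// ltW.
have uE : u = (u `^ m) `^ (p - 2) by rewrite -powRrM mulrC mE powRr1// ltW.
apply/idP/idP => h.
  by rewrite uE; apply: gt0_ltr_powR; rewrite ?nnegrE ?powR_ge0// ltW.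
by rewrite aE; apply: gt0_ltr_powR; rewrite ?nnegrE ?powR_ge0// ltW.
Qed.

Lemma sqr_powR a : 0 < a -> a ^+ 2 * a `^ (p - 2) = a `^ p.
Proof.
move=> a0; rewrite -powR_mulrn ?ltW// -powRD; last by apply/implyP => _; rewrite gt_eqF.
by congr (_ `^ _); ring.
Qed.

(** Where the square survives, [u < a^(p - 2)]. This makes the energy at each level finite. *)
Lemma truncated_square_le u a : 0 < u -> 0 <= a -> truncated_square u a <= u^-1 * a `^ p.
Proof.
move=> u0 a0; rewrite /truncated_square u0/=; case: ltrP => h; last first.
  by rewrite mulr_ge0 ?powR_ge0// invr_ge0 ltW.
have ap : 0 < a by rewrite (le_lt_trans _ h)// powR_ge0.
rewrite mulrC ler_pdivlMr// -sqr_powR// ler_wpM2l ?sqr_ge0// ltW//.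
by rewrite -lt_level.
Qed.

Lemma measurable_truncated_square dT (T : measurableType dT) (v w : T -> R) :
  measurable_fun setT v -> measurable_fun setT w ->
  measurable_fun setT (fun z => truncated_square (v z) (w z)).
Proof.
move=> mv mw; apply: measurable_fun_ifT => //; last exact: measurable_funX.
apply: measurable_and; first exact: measurable_fun_ltr.
apply: measurable_fun_ltr => //; exact: (measurableT_comp (measurable_powR m) mv).
Qed.

(** The square survives for [u] in an interval of length [a^(p - 2)]. *)
Lemma integral_truncated_square a : 0 <= a ->
  (\int[leb]_u (truncated_square u a)%:E <= (a `^ p)%:E)%E.
Proof.
rewrite le_eqVlt => /predU1P[<-|a0].
  rewrite integral0_eq ?lee_fin ?powR_ge0// => u _.
  by rewrite /truncated_square (le_gtF (powR_ge0 _ _)) andbF.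
have -> : (\int[leb]_u (truncated_square u a)%:E = \int[leb]_(u in `]0%R, (a `^ (p - 2))%R[) (cst (a ^+ 2)%:E u))%E.
  rewrite [RHS]integral_mkcond; apply: eq_integral => u _; rewrite patchE mem_setE/= in_itv/=.
  rewrite /truncated_square; case: (ltrP 0 u) => //= u0; rewrite lt_level//.
  by case: ifP.
rewrite integral_cst//= lebesgue_measure_itv/= lte_fin powR_gt0// sube0 -EFinM lee_fin.
by rewrite sqr_powR.
Qed.

Variable f : point R d -> R[i].
Hypotheses (ci : cint f) (pf : periodic f) (bf : (besov_sum p r0 f < +oo)%E).
Local Notation g := (gblock r0 f).

Definition block_energy s (u : R) : \bar R := (\int[mu]_x (truncated_square u (g s x))%:E)%E.

Definition box_energy N (u : R) : \bar R :=
  (\sum_(s <- box d N) (2 ^+ norm1 s)%:E * block_energy s u)%E.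

(** As a limit along boxes rather than an unordered sum, it inherits measurability from the terms
    and is open to monotone convergence. *)
Definition total_energy (u : R) : \bar R := limn (fun N => box_energy N u).

Lemma block_energy_ge0 s u : (0 <= block_energy s u)%E.
Proof. by apply: integral_ge0 => x _; rewrite lee_fin truncated_square_ge0. Qed.

Lemma box_energy_ge0 N u : (0 <= box_energy N u)%E.
Proof. by apply: sume_ge0 => s _; rewrite mule_ge0 ?lee_fin ?exprn_ge0 ?block_energy_ge0. Qed.

Lemma box_energy_nd u : nondecreasing_seq (fun N => box_energy N u).
Proof.
move=> n k nk; rewrite /box_energy [leRHS](sum_box_split _ nk) leeDl//.
by apply: sume_ge0 => s _; rewrite mule_ge0 ?lee_fin ?exprn_ge0 ?block_energy_ge0.
Qed.

Let is_cvg_box_energy u : cvgn (fun N => box_energy N u).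
Proof. exact: ereal_nondecreasing_is_cvgn (@box_energy_nd u). Qed.

Lemma box_energy_le_total N u : (box_energy N u <= total_energy u)%E.
Proof.
apply: lime_ge; first exact: is_cvg_box_energy.
by exists N => // M /= NM; exact: box_energy_nd.
Qed.

Let mg s : measurable_fun setT (g s). Proof. exact: measurable_gblock. Qed.

Lemma box_energy_le u N : 0 < u -> (box_energy N u <= u^-1%:E * besov_sum p r0 f)%E.
Proof.
move=> u0; have iu : 0 <= u^-1 by rewrite invr_ge0 ltW.
apply: (@le_trans _ _ (u^-1%:E * \sum_(s <- box d N) (2 ^+ norm1 s)%:E * \int[mu]_x (g s x `^ p)%:E)%E); last first.
  by rewrite lee_wpmul2l ?lee_fin//; exact: le_esum_box.
rewrite ge0_sume_distrr; last by move=> s _; exact: besov_term_ge0.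
apply: lee_sum => s _; rewrite muleCA lee_wpmul2l ?lee_fin ?exprn_ge0//.
have mp : measurable_fun setT (fun x => g s x `^ p) by exact: (measurableT_comp (measurable_powR p) (mg s)).
rewrite -ge0_integralZl_real//; last by move=> x; exact: powR_ge0.
apply: ge0_le_integral => //.
- by move=> x _; rewrite lee_fin truncated_square_ge0.
- by apply/measurable_EFinP; exact: measurable_truncated_square.
- by apply/measurable_EFinP; exact: measurable_funM.
by move=> x _; rewrite lee_fin truncated_square_le// gblock_ge0.
Qed.

Lemma total_energy_fin u : total_energy u \is a fin_num.
Proof.
rewrite ge0_fin_numE; last by apply: (le_trans (box_energy_ge0 0 u)); exact: box_energy_le_total.
case: (ltrP 0 u) => u0.
  apply: (@le_lt_trans _ _ (u^-1%:E * besov_sum p r0 f)%E); last first.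
    by rewrite lte_mul_pinfty// lee_fin invr_ge0 ltW.
  apply: lime_le; first exact: is_cvg_box_energy.
  by apply: nearW => N; exact: box_energy_le.
apply: (@le_lt_trans _ _ 0%E); last exact: ltry.
apply: lime_le; first exact: is_cvg_box_energy.
apply: nearW => N; rewrite /box_energy big1// => s _.
rewrite /block_energy integral0_eq ?mule0// => x _.
by rewrite /truncated_square (le_gtF u0).
Qed.

Let mts s : measurable_fun setT (fun z : R * point R d => (truncated_square z.1 (g s z.2))%:E).
Proof.
apply/measurable_EFinP; apply: measurable_truncated_square => //.
exact: (measurableT_comp (mg s)).
Qed.

Lemma measurable_block_energy s : measurable_fun setT (block_energy s).
Proof.
apply: (@measurable_fun_fubini_tonelli_F _ _ _ _ _ mu _ (mts s)).
by move=> z; rewrite lee_fin truncated_square_ge0.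
Qed.

Lemma measurable_box_energy N : measurable_fun setT (box_energy N).
Proof.
by apply: emeasurable_sum => s; apply: emeasurable_funM => //; exact: measurable_block_energy.
Qed.

Lemma measurable_total_energy : measurable_fun setT total_energy.
Proof.
apply: (@emeasurable_fun_cvg _ _ _ _ box_energy) => [N|u _]; first exact: measurable_box_energy.
exact: is_cvg_box_energy.
Qed.

Lemma integral_box_energy N : (\int[leb]_u box_energy N u <= besov_sum p r0 f)%E.
Proof.
apply: le_trans (le_esum_box _ N); rewrite ge0_integral_sum//; last 2 first.
- by move=> s; apply: emeasurable_funM => //; exact: measurable_block_energy.
- by move=> s u _; rewrite mule_ge0 ?lee_fin ?exprn_ge0 ?block_energy_ge0.
apply: lee_sum => s _.
have -> : (\int[leb]_u ((2 ^+ norm1 s)%:E * block_energy s u) = (2 ^+ norm1 s)%:E * \int[leb]_u block_energy s u)%E.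
  refine (@ge0_integralZl _ _ _ leb setT measurableT _ (measurable_block_energy s) _ _ _); last by rewrite lee_fin exprn_ge0.
  by move=> u _; exact: block_energy_ge0.
rewrite lee_wpmul2l ?lee_fin ?exprn_ge0// /block_energy.
have t0 z : (0 <= (truncated_square z.1 (g s z.2))%:E :> \bar R)%E by rewrite lee_fin truncated_square_ge0.
rewrite (@fubini_tonelli _ _ _ _ _ leb mu _ (mts s) t0).
apply: ge0_le_integral => //.
- by move=> x _; apply: integral_ge0.
- exact: (@measurable_fun_fubini_tonelli_G _ _ _ _ _ leb _ (mts s) t0).
- by apply/measurable_EFinP; exact: (measurableT_comp (measurable_powR p) (mg s)).
by move=> x _ /=; exact: (integral_truncated_square (gblock_ge0 r0 f s x)).
Qed.

Lemma integral_total_energy : (\int[leb]_u total_energy u <= besov_sum p r0 f)%E.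
Proof.
rewrite /total_energy (@monotone_convergence _ _ _ leb setT measurableT box_energy); last 3 first.
- exact: measurable_box_energy.
- by move=> N u _; exact: box_energy_ge0.
- by move=> u _; exact: box_energy_nd.
apply: lime_le; last by apply: nearW => N; exact: integral_box_energy.
apply: ereal_nondecreasing_is_cvgn => n k nk; apply: ge0_le_integral => //.
- by move=> u _; exact: box_energy_ge0.
- exact: measurable_box_energy.
- exact: measurable_box_energy.
by move=> u _; exact: box_energy_nd.
Qed.

Definition level_const : R := rough_const d r0 + Num.sqrt (overlap_const d r1).

Lemma level_const_gt0 : 0 < level_const.
Proof.
rewrite ltr_pwDl ?sqrtr_ge0//; rewrite /rough_const.
by rewrite !mulr_gt0 ?exprn_gt0 ?mulr_gt0 ?exprn_gt0 ?powR_gt0.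
Qed.

(** The premise says [t * sqrt e <= u^m] for the energy [e], so the smooth part also costs only a
    multiple of the level [u^m]. *)
Lemma K_functional_level t u : 0 < t -> 0 < u ->
  sum_carrier X0 X1 f /\
  (t ^+ 2 * fine (total_energy u) <= u `^ (2 * m) ->
   (K_functional X0 X1 t f <= (level_const * u `^ m)%:E)%E).
Proof.
move=> t0 u0; have l0 : 0 < u `^ m by rewrite powR_gt0.
have [N tN] := gblock_tail p_gt2 ci pf bf l0.
pose e := fine (total_energy u).
have e0 : 0 <= e by apply: fine_ge0; apply: (le_trans (box_energy_ge0 0 u)); exact: box_energy_le_total.
have en : (\sum_(s <- box d N) (2 ^+ norm1 s)%:E * level_energy r0 f (u `^ m) s <= (Num.sqrt e ^+ 2)%:E)%E.
  rewrite sqr_sqrtr// /e fineK ?total_energy_fin//.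
  rewrite (le_trans _ (box_energy_le_total N u))// /box_energy; apply: lee_sum => s _.
  rewrite lee_wpmul2l ?lee_fin ?exprn_ge0// le_eqVlt; apply/orP; left; apply/eqP.
  by apply: eq_integral => x _; rewrite /truncated_square u0.
have [sc K] := level_decomposition p_gt2 r0_gt0 r1E ci pf bf l0 tN (sqrtr_ge0 e) en t0.
split => // te; apply: (le_trans K); rewrite lee_fin /level_const mulrDl lerD2l mulrCA ler_wpM2l ?sqrtr_ge0//.
rewrite -ler_sqr ?nnegrE ?mulr_ge0 ?(ltW t0) ?sqrtr_ge0 ?(ltW l0)//.
by rewrite exprMn sqr_sqrtr// (le_trans te)// mulrC powRrM powR_mulrn ?powR_ge0.
Qed.

Lemma kmass_besov :
  (kmass (Kfun X0 X1 f) p <= (uplayer_const p level_const)%:E * besov_sum p r0 f)%E.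
Proof.
have [sc _] := K_functional_level ltr01 ltr01.
have n0 := @besovy_ge0 R d r0; have n1 := @sobolev2_ge0 R d r1.
have l0 := @besovy_lty R d r0; have l1 := @sobolev2_lty R d r1.
pose e u := fine (total_energy u).
have me : measurable_fun setT e by apply: measurableT_comp => //; exact: measurable_total_energy.
have t0 u : (0 <= total_energy u)%E by apply: (le_trans (box_energy_ge0 0 u)); exact: box_energy_le_total.
have e0 u : 0 <= e u by exact: fine_ge0.
apply: (le_trans (@kmass_le R (Kfun X0 X1 f) e p level_const _ _ me e0 p_gt2 level_const_gt0 _)).
- exact: Kfun_nd n0 n1 l0 l1 sc.
- exact: Kfun_ge0 f n0 n1.
- move=> t u tt uu h; rewrite -lee_fin -(KfunE n0 n1 l0 l1 sc tt).
  by have [_] := K_functional_level tt uu; apply.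
have c0 : 0 <= uplayer_const p level_const by apply/ltW/uplayer_const_gt0; exact: level_const_gt0.
rewrite lee_wpmul2l ?lee_fin//.
apply: le_trans integral_total_energy; apply: ge0_le_integral => //.
- by move=> u _; rewrite lee_fin; case: ifP.
- by apply/measurable_EFinP; apply: measurable_fun_ifT => //; exact: measurable_fun_ltr.
- exact: measurable_total_energy.
by move=> u _; case: ifP => _ //; rewrite /e fineK ?total_energy_fin.
Qed.

End energy_of_levels.

Section besov_into_interpolation.
Variables (R : realType) (d : nat) (p r0 r1 theta r : R).
Hypotheses (p_gt2 : 2 < p) (r0_gt0 : 0 < r0) (r1E : r1 = r0 + 1 / 2).
Hypotheses (thetaE : theta = 2 / p) (rE : r = r0 + 1 / p).
Local Notation mu := (torus_measure R d).
Local Notation X0 := (besov d r0 +oo%E +oo%E).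
Local Notation X1 := (sobolev2 d r1).

Lemma cint_Lp (f : point R d -> R[i]) : torus_Lp p%:E f -> cint f /\ periodic f.
Proof.
have p0 : p != 0 by rewrite gt_eqF//; move: p_gt2; lra.
move=> [[mr mi pf] /(torus_norm_lty p0) fp]; split => //; have mf : cmeas f by split.
have mp : measurable_fun setT (fun x => normc (f x) `^ p).
  by apply: (measurableT_comp (measurable_powR p)); exact: cmeas_normc.
have mE : measurable_fun setT (fun x => (normc (f x) `^ p)%:E) by exact/measurable_EFinP.
apply: (@cint_le _ _ _ (fun x => 1%:E + (normc (f x) `^ p)%:E)%E) => //.
- exact: emeasurable_funD.
- rewrite ge0_integralD//; last by move=> x _; rewrite lee_fin powR_ge0.
  by rewrite integral_torus_cst lte_add_pinfty// ltry.
move=> x; rewrite -EFinD lee_fin.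
have := @powR_young R p (normc (f x)) 1 _ (normc_ge0 _) ltr01.
by rewrite powR1 mul1r; apply; move: p_gt2; lra.
Qed.

Theorem besov_sub_interpolation : exists2 C : R, 0 < C &
  forall a, carrier (besov d r p%:E p%:E) a ->
    carrier (real_interpolation X0 X1 theta p) a /\
    (nnorm (real_interpolation X0 X1 theta p) a <= C%:E * nnorm (besov d r p%:E p%:E) a)%E.
Proof.
have p0 : 0 < p by move: p_gt2; lra.
have n0 := @besovy_ge0 R d r0; have n1 := @sobolev2_ge0 R d r1.
have l0 := @besovy_lty R d r0; have l1 := @sobolev2_lty R d r1.
pose C := uplayer_const p (level_const d r0 r1).
have C0 : 0 < C by apply: uplayer_const_gt0 => //; exact: level_const_gt0.
exists (C `^ p^-1); first by rewrite powR_gt0.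
move=> a [La na]; have [ci pa] := cint_Lp La.
have bE : nnorm (besov d r p%:E p%:E) a = (besov_sum p r0 a `^ p^-1)%E by exact: besov_normE.
have bs0 : (0 <= besov_sum p r0 a)%E by apply: esum_ge0 => s _; exact: besov_term_ge0.
have bf : (besov_sum p r0 a < +oo)%E.
  by move: na; rewrite -[besov_norm _ _ _ _]/(nnorm (besov d r p%:E p%:E) a) bE; apply: lty_poweRy; rewrite invr_eq0 gt_eqF.
have [sc _] := K_functional_level p_gt2 r0_gt0 r1E ci pa bf ltr01 ltr01.
have iE : nnorm (real_interpolation X0 X1 theta p) a = (kmass (Kfun X0 X1 a) p `^ p^-1)%E.
  exact: interpolation_normE.
have km := kmass_besov p_gt2 r0_gt0 r1E ci pa bf.
have km0 : (0 <= kmass (Kfun X0 X1 a) p)%E.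
  by apply: integral_ge0 => t _; rewrite lee_fin mulr_ge0// powR_ge0.
have nle : (nnorm (real_interpolation X0 X1 theta p) a <= (C `^ p^-1)%:E * nnorm (besov d r p%:E p%:E) a)%E.
  rewrite bE iE -poweR_EFin -poweRM ?lee_fin ?(ltW C0)//.
  by rewrite poweR_le ?invr_gt0// mule_ge0// lee_fin ltW.
split => //; split => //; apply: (le_lt_trans nle).
by rewrite lte_mul_pinfty ?lee_fin ?powR_ge0.
Qed.

End besov_into_interpolation.

(** * The two embeddings combined *)

Theorem theorem4p6 (R : realType) (d : nat) (p r0 r1 theta r : R)
  (d_gt0 : (0 < d)%N) (p_gt2 : 2 < p) (r0_gt0 : 0 < r0) (r0_lt : r0 < 1 / 2)
  (r1E : r1 = r0 + 1 / 2) (thetaE : theta = 2 / p) (rE : r = r0 + 1 / p) :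
  same_space_equiv_norms
    (real_interpolation (besov d r0 +oo%E +oo%E) (sobolev2 d r1) theta p)
    (besov d r p%:E p%:E).
Proof.
have [C C0 hC] := @interpolation_sub_besov R d _ _ _ p_gt2 r0_gt0 r1E _ _ thetaE rE.
have [D D0 hD] := @besov_sub_interpolation R d _ _ _ _ _ p_gt2 r0_gt0 r1E thetaE rE.
split; first by apply/seteqP; split => f cf; [have [] := hC f cf|have [] := hD f cf].
(* [D] bounds the interpolation norm by the Besov norm, so the lower constant is its inverse. *)
exists D^-1, C; split; rewrite ?invr_gt0// => f cf.
have [cY hY] := hC f cf; have [_ hX] := hD f cY; split => //.
by rewrite muleC lee_pdivrMr// muleC.
Qed.
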